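(* Let $\mathcal F$ be a foliation of even codimension $2q$ ($q\ge 1$) on a manifold $M$. Then $N\mathcal F$ has an adapted connection which defines projectable almost complex structures $\mathcal I_1$ and $\mathcal I_2$ of $N\hat{\mathcal F}$ on $\mathcal Z(\mathcal F)$ if and only if $\mathcal F$ has a (projectable) transversal projective structure whose normal complementary class $[\phi]_N\in H^1(M,\underline{\wedge^{2,0}M\otimes N\mathcal F})$ vanishes.
   Context: All objects are $C^\infty$. $(M,\mathcal F)$ is a manifold of dimension $n=p+2q$ with a foliation $\mathcal F$ of codimension $2q$; $F=T\mathcal F\subset TM$, $N\mathcal F=TM/F$, $\pi_N:TM\to N\mathcal F$ is the projection, $\Gamma$ denotes sections. A vector field $X$ (on an open set) is foliated if $[X,Y]\in\Gamma F$ for all $Y\in\Gamma F$; a section of $N\mathcal F$ is foliated if locally it is $\pi_N X$ with $X$ foliated. An object is foliated (= projectable) if locally it is the lift of an object of the local slice spaces (local leaf spaces). An adapted (Bott) connection is a linear connection $\nabla$ on $N\mathcal F$ with $\nabla_Y(\pi_NX)=\pi_N[Y,X]$ for $Y\in\Gamma F$, $X\in\Gamma TM$. It is foliated (projectable) if $\nabla_X s$ is foliated whenever $X$ and $s$ are foliated. Its torsion is $T_\nabla(X,Y)=\nabla_X(\pi_NY)-\nabla_Y(\pi_NX)-\pi_N[X,Y]$. Transversal twistor space: $\mathcal Z(\mathcal F)=\{J\in End(N_x\mathcal F): J^2=-Id,\ x\in M\}$, with projection $Q:\mathcal Z(\mathcal F)\to M$. An adapted connection $\nabla$ gives $T\mathcal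 Z(\mathcal F)=\mathcal H\oplus\mathcal V$, where $\mathcal V=\ker Q_*$ and $\mathcal H$ is the distribution of velocities of $\nabla$-parallel curves. The lifted foliation $\hat{\mathcal F}$ has as tangent space at $J$ the horizontal lift of $F_{Q(J)}$ (independent of the choice of adapted connection). One identifies $\mathcal V_J=\{A\in End(N_{Q(J)}\mathcal F): AJ+JA=0\}$, and $N\hat{\mathcal F}=T\mathcal Z(\mathcal F)/T\hat{\mathcal F}\cong Q^*N\mathcal F\oplus\mathcal V$ (via $\mathcal H/T\hat{\mathcal F}\cong Q^*N\mathcal F$). The connection $\nabla$ defines two complex structures of the bundle $N\hat{\mathcal F}$: $\mathcal I_1(v,A)=(Jv,J\circ A)$, $\mathcal I_2(v,A)=(Jv,-J\circ A)$ at $J$. $\mathcal I_a$ is ($\hat{\mathcal F}$-)projectable if it maps foliated local sections of $N\hat{\mathcal F}$ to foliated sections, i.e. it is locally the lift of an almost complex structure of the local slice spaces of $\hat{\mathcal F}$. A foliated $1$-form is a local pullback of a $1$-form of the slice spaces. A transversal projective structure of $\mathcal F$ is a maximal system consisting of an open covering $M=\bigcup_\alpha U_\alpha$ by $\mathcal F$-adapted coordinate neighborhoods and torsionless foliated connections $\nabla^\alpha$ on $N\mathcal F|_{U_\alpha}$ such that on $U_\alpha\cap U_\beta$ one has $\nabla^\beta-\nabla^\alpha=\phi_{\alpha\beta}\odot\pi_N$ with foliated $1$-forms $\phi_{\alpha\beta}$, where $(\phi\odot\pi_N)(X,Y)=\phi(X)\pi_NY+\phi(Y)\pi_NX$, and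 the difference of connections is $(X,Y)\mapsto\nabla^\beta_X(\pi_NY)-\nabla^\alpha_X(\pi_NY)$. Let $\wedge^{k,0}M$ be the bundle of $k$-forms annihilated by contraction with $F$, and let an underlined bundle denote the sheaf of germs of its foliated sections. The normal complementary class of the projective structure is the Čech class $[\phi]_N\in H^1(M,\underline{\wedge^{2,0}M\otimes N\mathcal F})$ of the cocycle $\{\pi_N\wedge\phi_{\alpha\beta}\}$, where $\pi_N\wedge\phi$ is the $N\mathcal F$-valued $2$-form $(X,Y)\mapsto \phi(Y)\pi_NX-\phi(X)\pi_NY$. *)

(* Defs.v *)
From HB Require Import structures.
From mathcomp Require Import all_boot all_order all_algebra.
From mathcomp Require Import all_classical all_reals all_analysis.

Set Implicit Arguments.
Unset Strict Implicit.
Unset Printing Implicit Defensive.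

Import GRing.Theory numFieldNormedType.Exports.
Local Open Scope classical_set_scope.
Local Open Scope ring_scope.

(* [smooth_on A f]: f is C^oo on the open set A.  The spaces V used below are
   finite dimensional, so iterating directional derivatives is enough. *)
Section Smooth.
Context {R : realType} {V W : normedModType R}.

Fixpoint Ck_on (k : nat) (A : set V) (f : V -> W) : Prop :=
  match k with
  | 0 => forall x, A x -> {for x, continuous f}
  | k'.+1 => (forall x, A x -> differentiable f x) /\
             forall v, Ck_on k' A (fun x => 'D_v f x)
  end.

Definition smooth_on (A : set V) (f : V -> W) : Prop :=
  forall k, Ck_on k A f.

End Smooth.

(* A chart is a pair of total functions, meaningful on [cdom] and on its image
   only; the topological requirements are in [is_chart]. *)
Record chart (T V : Type) := Chart {
  cdom : set T;
  cto :> T -> V;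
  cof : V -> T }.

Record charted (R : realType) (V : normedModType R) := Charted {
  cpts :> Type;
  catlas : set (chart cpts V);
  pchart : cpts -> chart cpts V }.

(* The tangent space at x of a manifold modelled on V is V itself, a vector
   being represented by its components in the preferred chart [pchart x]. *)
Section Charted.
Context {R : realType} {V : normedModType R} (X : charted V).
Implicit Types (c : chart X V) (x : X) (W : set X) (Y Z : X -> V).

(* components in c of the tangent vector v at x *)
Definition coord c x (v : V) : V := 'd (c \o cof (pchart x)) (pchart x x) v.

(* tangent vector at x with components a in c *)
Definition vect c x (a : V) : V := 'd (pchart x \o cof c) (c x) a.

Definition chart_open W : Prop :=
  forall c, catlas c -> open (c @` (W `&` cdom c)).

Definition smooth_map (U : normedModType R) W (f : X -> U) : Prop :=
  forall c, catlas c -> smooth_on (c @` (W `&` cdom c)) (f \o cof c).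

Definition dmap (U : normedModType R) (f : X -> U) x (v : V) : U :=
  'd (f \o cof (pchart x)) (pchart x x) v.

Definition field_rep c Y (z : V) : V := coord c (cof c z) (Y (cof c z)).

Definition smooth_field W Y : Prop :=
  forall c, catlas c -> smooth_on (c @` (W `&` cdom c)) (field_rep c Y).

Definition lie Y Z x : V :=
  let c := pchart x in
  'D_(field_rep c Y (c x)) (field_rep c Z) (c x) -
  'D_(field_rep c Z (c x)) (field_rep c Y) (c x).

End Charted.

Section FoliatedCharts.
Context {R : realType} (p m : nat).
Notation E := 'cV[R]_(p + m).

Definition is_chart (T : topologicalType) (c : chart T E) : Prop :=
  [/\ open (cdom c),
      open (c @` cdom c),
      forall x, cdom c x -> cof c (c x) = x,
      forall x, cdom c x -> {for x, continuous (cto c)} &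
      forall z, (c @` cdom c) z -> {for z, continuous (cof c)}].

(* The last m coordinates are constant along the leaves: the transition maps
   are locally of the form (x, y) |-> (f (x, y), g y). *)
Definition foliated_transition (T : Type) (c c' : chart T E) : Prop :=
  let D := c @` (cdom c `&` cdom c') in
  smooth_on D (c' \o cof c) /\
  forall z v, D z -> dsubmx v = 0 -> dsubmx ('d (c' \o cof c) z v : E) = 0.

End FoliatedCharts.

(* A (Hausdorff, second countable) manifold of dimension p + m with a foliation
   of codimension m, given by an atlas of adapted charts. *)
Record foliated_manifold (R : realType) (p m : nat) := FoliatedManifold {
  fm_space :> topologicalType;
  fm_hausdorff : hausdorff_space fm_space;
  fm_countable : @second_countable fm_space;
  fm_atlas : set (chart fm_space 'cV[R]_(p + m));
  fm_chart : forall c, fm_atlas c -> is_chart c;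
  fm_transition : forall c c',
    fm_atlas c -> fm_atlas c' -> foliated_transition c c';
  fm_cover : forall x, exists c, fm_atlas c /\ cdom c x }.

Section Foliation.
Context {R : realType} {p m : nat} (M : foliated_manifold R p m).
Notation E := 'cV[R]_(p + m).
Notation N := 'cV[R]_m.

Definition manifold : charted E :=
  @Charted R E M (@fm_atlas R p m M) (fun x => projT1 (cid (fm_cover x))).

(* T_xM = E (see above), F_x = {v | dsubmx v = 0}, N_x = T_xM / F_x = N *)
Definition pi_N (v : E) : N := dsubmx v.
Definition in_F (v : E) : Prop := pi_N v = 0.

Definition adapted_chart (c : chart M E) : Prop :=
  is_chart c /\
  forall c', fm_atlas c' -> foliated_transition c c' /\ foliated_transition c' c.

Definition adapted_neighborhood (U : set M) : Prop :=
  exists2 c, adapted_chart c & cdom c = U.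

Implicit Types (c : chart M E) (x : M) (U : set M)
  (X Y : M -> E) (s : M -> N).

(* components in c of a normal vector at x *)
Definition ncoord c x (w : N) : N :=
  pi_N (coord (X := manifold) c x (col_mx 0 w)).

Definition smooth_section U s : Prop :=
  forall c, fm_atlas c ->
  smooth_on (c @` (U `&` cdom c)) (fun z => ncoord c (cof c z) (s (cof c z))).

Definition vfield U X : Prop := smooth_field (X := manifold) U X.
Definition leaf_field U Y : Prop := vfield U Y /\ forall x, U x -> in_F (Y x).
Definition bracket X Y x : E := lie (X := manifold) X Y x.

Definition foliated_field U X : Prop :=
  vfield U X /\
  forall U' Y, open U' -> U' `<=` U -> leaf_field U' Y ->
    leaf_field U' (bracket X Y).

Definition foliated_section U s : Prop :=
  forall x, U x -> exists U' X,
    [/\ open U', U' x, U' `<=` U, foliated_field U' X &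
        forall x', U' x' -> s x' = pi_N (X x')].

(* The operator (s, x, v) |-> (nabla_v s)(x); its value matters only when s is
   smooth near x. *)
Definition connection_op := (M -> N) -> M -> E -> N.

Definition is_connection U (D : connection_op) : Prop :=
  forall U', open U' -> U' `<=` U ->
  [/\ forall s x, smooth_section U' s -> U' x -> linear (D s x),
      forall s t x v, smooth_section U' s -> smooth_section U' t -> U' x ->
        D (fun y => s y + t y) x v = D s x v + D t x v,
      forall (f : M -> R) s x v, smooth_map (X := manifold) U' f ->
        smooth_section U' s -> U' x ->
        D (fun y => f y *: s y) x v =
        dmap (X := manifold) f x v *: s x + f x *: D s x v &
      forall s X, smooth_section U' s -> vfield U' X ->
        smooth_section U' (fun x => D s x (X x))].

Definition adapted_connection U (D : connection_op) : Prop :=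
  is_connection U D /\
  forall U' X Y x, open U' -> U' `<=` U -> vfield U' X -> leaf_field U' Y ->
    U' x -> D (fun y => pi_N (X y)) x (Y x) = pi_N (bracket Y X x).

Definition foliated_connection U (D : connection_op) : Prop :=
  adapted_connection U D /\
  forall U' X s, open U' -> U' `<=` U -> foliated_field U' X ->
    foliated_section U' s -> foliated_section U' (fun x => D s x (X x)).

Definition torsion (D : connection_op) X Y x : N :=
  D (fun y => pi_N (Y y)) x (X x) - D (fun y => pi_N (X y)) x (Y x)
  - pi_N (bracket X Y x).

Definition torsionless U (D : connection_op) : Prop :=
  forall U' X Y x, open U' -> U' `<=` U -> vfield U' X -> vfield U' Y -> U' x ->
    torsion D X Y x = 0.

(* ** Foliated forms and transversal projective structures *)

(* submersion of cdom c onto the local slice space *)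
Definition slice c x : N := pi_N (c x).

Definition one_form := M -> E -> R.
Definition two_form := M -> E -> E -> N.

Definition foliated_one_form U (phi : one_form) : Prop :=
  forall x, U x -> exists c U' (theta : N -> 'rV[R]_m),
    [/\ fm_atlas c, open U', U' x, U' `<=` U `&` cdom c &
        smooth_on (slice c @` U') theta /\
        forall x' v, U' x' ->
          phi x' v = (theta (slice c x')
                      *m pi_N (coord (X := manifold) c x' v)) 0 0].

(* foliated sections of /\^{2,0}M (x) N: locally, lifts of vector valued
   2-forms of the slice spaces *)
Definition foliated_two_form U (omega : two_form) : Prop :=
  forall x, U x -> exists c U' (theta : N -> N -> N -> N),
    [/\ [/\ fm_atlas c, open U', U' x & U' `<=` U `&` cdom c],
        forall a b, smooth_on (slice c @` U') (fun y => theta y a b),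
        forall y a, (slice c @` U') y -> linear (theta y a),
        forall y a b, (slice c @` U') y -> theta y a b = - theta y b a &
        forall x' v w, U' x' ->
          ncoord c x' (omega x' v w) =
          theta (slice c x') (pi_N (coord (X := manifold) c x' v))
                             (pi_N (coord (X := manifold) c x' w))].

Definition odot (phi : one_form) x (v w : E) : N :=
  phi x v *: pi_N w + phi x w *: pi_N v.

Definition pi_wedge (phi : one_form) : two_form :=
  fun x v w => phi x w *: pi_N v - phi x v *: pi_N w.

(* D' - D = phi (.) pi_N on U *)
Definition projective_change U (D D' : connection_op) (phi : one_form) : Prop :=
  forall U' Y x v, open U' -> U' `<=` U -> vfield U' Y -> U' x ->
    D' (fun y => pi_N (Y y)) x v - D (fun y => pi_N (Y y)) x v =
    odot phi x v (Y x).

Definition projective_system (P : set (set M * connection_op)) : Prop :=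
  [/\ forall a, P a -> adapted_neighborhood a.1 /\
        foliated_connection a.1 a.2 /\ torsionless a.1 a.2,
      forall x, exists2 a, P a & a.1 x &
      forall a b, P a -> P b -> exists2 phi,
        foliated_one_form (a.1 `&` b.1) phi &
        projective_change (a.1 `&` b.1) a.2 b.2 phi].

Definition projective_structure (P : set (set M * connection_op)) : Prop :=
  projective_system P /\
  forall P', projective_system P' -> P `<=` P' -> P' = P.

End Foliation.

(* ** Cech cohomology in degree 1 *)

(* The sheaf is given by its sections [Sh U f] among functions with values in
   A; a class of H^1 is the predicate of the cocycles representing it, cocycles on
   different covers being compared on a common refinement.  ([set cocycle] is
   avoided for universe reasons.) *)
Section Cech.
Context {T : topologicalType} {A : zmodType}.
Variable Sh : set T -> (T -> A) -> Prop.

Definition open_cover (I : Type) (U : I -> set T) : Prop :=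
  (forall i, open (U i)) /\ forall x, exists i, U i x.

Definition is_cocycle (I : Type) (U : I -> set T) (z : I -> I -> T -> A) :=
  [/\ open_cover U,
      forall i j, Sh (U i `&` U j) (z i j) &
      forall i j k x, U i x -> U j x -> U k x -> z i j x + z j k x = z i k x].

Record cocycle := Cocycle {
  cc_index : Type;
  cc_cover : cc_index -> set T;
  cc_val : cc_index -> cc_index -> T -> A;
  cc_proof : is_cocycle cc_cover cc_val }.

Definition refines (K I : Type) (W : K -> set T) (U : I -> set T) (r : K -> I) :=
  forall k, W k `<=` U (r k).

Definition cohomologous (z z' : cocycle) : Prop :=
  exists (K : Type) (W : K -> set T) (r : K -> cc_index z)
    (r' : K -> cc_index z') (t : K -> T -> A),
    [/\ open_cover W, refines W (@cc_cover z) r, refines W (@cc_cover z') r',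
        forall k, Sh (W k) (t k) &
        forall k l x, W k x -> W l x ->
          cc_val (r' k) (r' l) x - cc_val (r k) (r l) x = t l x - t k x].

Definition H1_class (z : cocycle) : cocycle -> Prop := cohomologous z.

(* zero element of H^1: the cocycles that become coboundaries on a refinement *)
Definition H1_zero : cocycle -> Prop := fun z =>
  exists (K : Type) (W : K -> set T) (r : K -> cc_index z) (t : K -> T -> A),
    [/\ open_cover W, refines W (@cc_cover z) r,
        forall k, Sh (W k) (t k) &
        forall k l x, W k x -> W l x -> cc_val (r k) (r l) x = t l x - t k x].

End Cech.

Section NormalClass.
Context {R : realType} {p m : nat} (M : foliated_manifold R p m).
Notation E := 'cV[R]_(p + m).
Notation N := 'cV[R]_m.

Definition normal_cocycle := cocycle (@foliated_two_form R p m M).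

(* The forms phi are uniquely determined on the overlaps by the structure
   (when m > 0), whence a single class. *)
Definition normal_class (P : set (set M * connection_op M)) :
    normal_cocycle -> Prop := fun z =>
  exists phi : {a | P a} -> {a | P a} -> one_form M,
    (forall a b, let U := (sval a).1 `&` (sval b).1 in
       foliated_one_form U (phi a b) /\
       projective_change U (sval a).2 (sval b).2 (phi a b)) /\
    exists h : is_cocycle (@foliated_two_form R p m M)
                 (fun a : {a | P a} => (sval a).1)
                 (fun a b => pi_wedge (phi a b)),
      H1_class (Cocycle h) z.

Definition normal_class_vanishes (P : set (set M * connection_op M)) : Prop :=
  forall z, normal_class P z <-> H1_zero z.

End NormalClass.

(* ** The transversal twistor space *)

Section Twistor.
Context {R : realType} {p m : nat} (M : foliated_manifold R p m).
Notation E := 'cV[R]_(p + m).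
Notation N := 'cV[R]_m.
Notation EndN := 'M[R]_m.

(* matrix of ncoord c x *)
Definition nframe (c : chart M E) (x : M) : EndN :=
  \matrix_(i, j) ncoord c x (delta_mx j 0) i 0.

(* Total space of End(N): the point (x, J) is the endomorphism of N_x = R^m
   with matrix J.  Charts are induced by the adapted charts of M. *)
Definition end_chart (c : chart M E) : chart (M * EndN) (E * EndN) :=
  Chart [set e | cdom c e.1]
    (fun e => (c e.1, nframe c e.1 *m e.2 *m invmx (nframe c e.1)))
    (fun z => (cof c z.1,
       invmx (nframe c (cof c z.1)) *m z.2 *m nframe c (cof c z.1))).

Definition end_space : charted (E * EndN)%type :=
  @Charted R (E * EndN)%type (M * EndN)
    [set d | exists2 c, fm_atlas c & d = end_chart c]
    (fun e => end_chart (pchart (c := manifold M) e.1)).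

(* Z(F) is handled as the submanifold J^2 = -Id of [end_space]. *)
Definition twistor : set end_space := [set e | e.2 *m e.2 = - 1%:M].

Definition twistor_tangent (e : end_space) (xi : E * EndN) : Prop :=
  xi.2 *m e.2 + e.2 *m xi.2 = 0.

(* Fields on open subsets of Z(F) extend locally to end_space; W below is open
   in end_space and only the values on W `&` twistor matter. *)
Definition twistor_field (W : set end_space) (X : end_space -> E * EndN) :=
  smooth_field (X := end_space) W X /\
  forall e, W e -> twistor e -> twistor_tangent e (X e).

Section Lift.
Variable D : connection_op M.

(* Gamma(a): nabla_v e_j = \sum_i Gamma(a)_ij e_i, where v at x has components
   a in c and e_j is the section pi_N(d/dy^j) *)
Definition christoffel (c : chart M E) (x : M) (a : E) : EndN :=
  \matrix_(i, j) ncoord c x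
    (D (fun y => pi_N (vect (X := manifold M) c y (col_mx 0 (delta_mx j 0))))
       x (vect (X := manifold M) c x a)) i 0.

(* a smooth curve of Z(F) over cdom c, defined on A, with nabla J = 0 along its
   projection; in c this is J' + [Gamma(x'), J] = 0 *)
Definition parallel_curve (c : chart M E) (A : set R) (g : R -> end_space) :=
  smooth_on A (end_chart c \o g) /\
  forall t, A t ->
    [/\ cdom c (g t).1, twistor (g t) &
        let d := derive1 (end_chart c \o g) t in
        let J := (end_chart c (g t)).2 in
        let G := christoffel c (g t).1 d.1 in
        d.2 + (G *m J - J *m G) = 0].

Definition horizontal (e : end_space) (xi : E * EndN) : Prop :=
  exists (A : set R) (g : R -> end_space),
    [/\ open A, A 0, g 0 = e,
        parallel_curve (pchart (c := manifold M) e.1) A g &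
        derive1 (pchart e \o g) 0 = xi].

(* tangent space of the lifted foliation at e *)
Definition in_Fhat (e : end_space) (xi : E * EndN) : Prop :=
  horizontal e xi /\ in_F xi.1.

Definition Fhat_field (W : set end_space) (Y : end_space -> E * EndN) :=
  twistor_field W Y /\ forall e, W e -> twistor e -> in_Fhat e (Y e).

Definition foliated_twistor_field (W : set end_space)
    (X : end_space -> E * EndN) :=
  twistor_field W X /\
  forall W' Y, chart_open W' -> W' `<=` W -> Fhat_field W' Y ->
    Fhat_field W' (lie X Y).

(* Fibre of N\hat F at (x, J), as N_x (+) {A in End(N_x) | A J + J A = 0}, via
   the splitting defined by D: [Nhat_proj e xi s] means that s is the image in
   it of the tangent vector xi, i.e. s.1 = pi_N (Q_* xi) and s.2 is the
   vertical component of xi. *)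
Definition Nhat_proj (e : end_space) (xi : E * EndN) (s : N * EndN) : Prop :=
  [/\ s.1 = pi_N xi.1, s.2 *m e.2 + e.2 *m s.2 = 0 &
      horizontal e (xi.1, xi.2 - s.2)].

Definition foliated_Nhat_section (W : set end_space)
    (s : end_space -> N * EndN) : Prop :=
  forall e, W e -> twistor e -> exists W' X,
    [/\ chart_open W', W' e, W' `<=` W, foliated_twistor_field W' X &
        forall e', W' e' -> twistor e' -> Nhat_proj e' (X e') (s e')].

Definition I1 (e : end_space) (s : N * EndN) : N * EndN :=
  (e.2 *m s.1, e.2 *m s.2).

Definition I2 (e : end_space) (s : N * EndN) : N * EndN :=
  (e.2 *m s.1, - (e.2 *m s.2)).

Definition projectable (I : end_space -> N * EndN -> N * EndN) : Prop :=
  forall W s, chart_open W -> foliated_Nhat_section W s ->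
    foliated_Nhat_section W (fun e => I e (s e)).

End Lift.
End Twistor.

(* Main.v *)
(** In an adapted chart let Gamma be the connection matrix of D.  The structures
    I_1 and I_2 are projectable exactly when the commutators [Gamma(v), J], for all
    complex structures J of the fibre, are constant along the leaves.  A matrix
    commuting with every complex structure is scalar, so this means that the
    trace-free part of Gamma is constant along the leaves.

    Given such a D, let theta_c be 1/m times the trace of Gamma in the chart c and
    T_D the torsion of D.  The connections nabla^c = D - 1/2 theta_c (.) pi_N - 1/2 T_D
    are torsionless and projectable, with
    nabla^c' - nabla^c = 1/2 (theta_c - theta_c') (.) pi_N, and the projectable
    2-forms -1/2 (T_D - theta_c /\ pi_N) trivialize the normal cocycle of the
    projective structure that they generate.

    Conversely, if pi_N /\ phi_kl = t_k - t_l, then nabla^l + t_l and nabla^k + t_k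
    differ by 2 phi_kl Id; gluing the connections nabla^k + t_k with a partition
    of unity changes neither their trace-free parts nor, therefore, the
    commutators [Gamma(v), J]. *)

From HB Require Import structures.
From mathcomp Require Import all_boot all_order all_algebra all_fingroup.
From mathcomp Require Import all_classical all_reals all_analysis.
From mathcomp Require Import ring lra.
Require Import Defs.

Set Implicit Arguments.
Unset Strict Implicit.
Unset Printing Implicit Defensive.

Import Order.TTheory GRing.Theory Num.Theory numFieldNormedType.Exports.
Local Open Scope classical_set_scope.
Local Open Scope ring_scope.

(** * Calculus of smooth maps *)

(** In an adapted chart the connection matrix vanishes in leaf directions, so the lift of [F] to the
    twistor space consists of coordinate directions, and a field is foliated when its normal part
    [u] and its endomorphism part [A] are constant along them. The splitting defined by [D] replaces
    [A] by the vertical part [A + [Gamma(u), J]]: commutators enter through this change of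
    components only. Three circumstances shape the development. Horizontal vectors are velocities of
    parallel curves, so describing them by a linear equation requires solving a differential
    equation. The twistor space lies in the larger bundle End(N) and fields are constrained on
    [J^2 = -1] only, so some derivatives have to be taken along curves that stay there. Foliated
    forms are given near each point in one unspecified chart, while sums and differences need a
    common one. A difference of connections determines its form [phi], since the trace of
    [phi (.) pi_N] is [(m + 1) phi]; this makes the class of a structure independent of choices. *)

Section Calculus.
Context {R : realType}.
Implicit Types U V W : normedModType R.

Lemma near_eq_differentiable V W (f g : V -> W) x :
  (\forall y \near x, f y = g y) -> differentiable f x -> differentiable g x.
Proof.
move=> fg df.
have gE : g \o shift x = cst (g x) + 'd f x +o_ (0 : V) id.
  apply/eqaddoP => _/posnumP[e].
  have /eqaddoP/(_ _ (gt0 e)) := diff_locally df.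
  have : \forall h \near (0 : V), f (h + x) = g (h + x).
    by have := fg; rewrite (near_shift 0 x) /=; apply: filterS => h; rewrite subr0.
  rewrite -(nbhs_singleton fg); apply: filterS2 => h fgh.
  by rewrite !fctE/= fgh.
have dg : 'd g x = 'd f x :> (V -> W).
  by apply: diff_unique gE; exact: diff_continuous.
by apply/diff_locallyP; rewrite dg; split => //; exact: diff_continuous.
Qed.

Lemma Ck_on_sub k V W (A B : set V) (f : V -> W) :
  B `<=` A -> Ck_on k A f -> Ck_on k B f.
Proof.
elim: k A B f => [|k IH] A B f BA /=; first by move=> h x /BA; exact: h.
by move=> [h1 h2]; split => [x /BA|v]; [exact: h1|exact: IH (h2 v)].
Qed.

Lemma Ck_on_ext k V W (A : set V) (f g : V -> W) : open A ->
  (forall x, A x -> f x = g x) -> Ck_on k A f -> Ck_on k A g.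
Proof.
elim: k f g => [|k IH] f g oA fg /=.
  move=> cf x Ax; have := cf x Ax; rewrite /prop_for /continuous_at (fg _ Ax).
  apply: cvg_trans; apply: near_eq_cvg.
  by have := open_nbhs_nbhs (conj oA Ax); apply: filterS => y /fg.
have nfg x : A x -> \forall y \near x, f y = g y.
  by move=> Ax; have := open_nbhs_nbhs (conj oA Ax); apply: filterS => y /fg.
move=> [df Df]; split=> [x Ax|v].
  by apply: near_eq_differentiable (df _ Ax); exact: nfg.
apply: IH (Df v) => // x Ax; apply: near_eq_derive; exact: nfg.
Qed.

Lemma Ck_onS k V W (A : set V) (f : V -> W) : Ck_on k.+1 A f -> Ck_on k A f.
Proof.
elim: k f => [|k IH] f [df Df]; first by move=> x /df /differentiable_continuous.
by split => // v; exact: IH.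
Qed.

(** Smoothness of a germ. The conditions on fields and sections quantify over open sets, but the
    proofs pass between charts and control maps only near a point; [smooth_onP] translates back. *)
Definition smooth_near V W (x : V) (f : V -> W) :=
  exists A : set V, [/\ open A, A x & smooth_on A f].

Lemma smooth_on_near V W (A : set V) (f : V -> W) x :
  open A -> A x -> smooth_on A f -> smooth_near x f.
Proof. by move=> oA Ax sf; exists A. Qed.

Lemma smooth_onP V W (A : set V) (f : V -> W) :
  (forall x, A x -> smooth_near x f) -> smooth_on A f.
Proof.
move=> H k; elim: k f H => [|k IH] f H.
  by move=> x /H [B [_ Bx /(_ 0%N)]]; exact.
split => [x /H [B [_ Bx /(_ 1%N) [+ _]]]|v]; first exact.
apply: IH => x /H [B [oB Bx sB]]; exists B; split => // j.
by have [_ ] := sB j.+1; exact.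
Qed.

Lemma smooth_near_nbhs V W (x : V) (f : V -> W) :
  smooth_near x f -> \forall y \near x, smooth_near y f.
Proof.
move=> [A [oA Ax sA]]; apply: filterS (open_nbhs_nbhs (conj oA Ax)) => y Ay.
by exists A.
Qed.

Lemma smooth_near_diff V W (x : V) (f : V -> W) :
  smooth_near x f -> differentiable f x.
Proof. by move=> [A [oA Ax /(_ 1%N) [+ _]]]; exact. Qed.

Lemma smooth_near_cont V W (x : V) (f : V -> W) :
  smooth_near x f -> {for x, continuous f}.
Proof. by move=> [A [oA Ax /(_ 0%N)]]; exact. Qed.

Lemma smooth_near_derivable V W (x v : V) (f : V -> W) :
  smooth_near x f -> derivable f x v.
Proof. by move=> /smooth_near_diff/diff_derivable. Qed.

Lemma smooth_near_D V W (x v : V) (f : V -> W) :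
  smooth_near x f -> smooth_near x (fun y => 'D_v f y).
Proof.
by move=> [A [oA Ax sA]]; exists A; split => // k; have [_ ] := sA k.+1; exact.
Qed.

Lemma smooth_near_ext V W (x : V) (f g : V -> W) :
  (\forall y \near x, f y = g y) -> smooth_near x f -> smooth_near x g.
Proof.
move=> fg [A [oA Ax sA]]; have : nbhs x [set y | f y = g y] by exact: fg.
rewrite nbhsE /= => -[B [oB Bx] Bfg].
exists (A `&` B); split => //; first exact: openI.
move=> k; apply: (@Ck_on_ext _ _ _ _ f); first exact: openI.
  by move=> y [_ /Bfg].
by apply: Ck_on_sub (sA k) => y [].
Qed.

Lemma smooth_near_eq V W (x : V) (f g : V -> W) :
  (forall y, g y = f y) -> smooth_near x f -> smooth_near x g.
Proof. by move=> fg; rewrite (_ : g = f)//; exact: funext. Qed.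

(** Coinductive form of smoothness: stability of a class of maps under directional derivatives
    replaces the induction on the order. *)
Lemma smooth_near_coind V W (x : V) (A : set V) (S : (V -> W) -> Prop)
    (f : V -> W) : open A -> A x ->
  (forall g, S g -> (forall y, A y -> differentiable g y) /\
     forall v, exists2 h, S h & forall y, A y -> 'D_v g y = h y) ->
  S f -> smooth_near x f.
Proof.
move=> oA Ax HS Sf; exists A; split => // k.
elim: k f Sf => [|k IH] f Sf; have [df Df] := HS _ Sf.
  by move=> y /df /differentiable_continuous.
split => // v; have [h Sh hE] := Df v.
by apply: (@Ck_on_ext _ _ _ _ h) => // [y Ay|]; [rewrite hE|exact: IH].
Qed.

Lemma smooth_near_cst V W (x : V) (a : W) : smooth_near x (cst a : V -> W).
Proof.
apply: (@smooth_near_coind _ _ _ setT (fun f => exists b, f = cst b)).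
- exact: openT.
- by [].
- move=> _ [b ->]; split => [y _|v]; first exact: differentiable_cst.
  by exists (cst 0); [exists 0|move=> y _; rewrite derive_cst].
- by exists a.
Qed.

Lemma smooth_near_lin V W (x : V) (f : {linear V -> W}) :
  continuous f -> smooth_near x f.
Proof.
move=> cf; exists setT; split => //; first exact: openT.
case=> [|k]; first by move=> y _; exact: cf.
split=> [y _|v]; first exact: linear_differentiable.
apply: (@Ck_on_ext _ _ _ _ (cst (f v))); first exact: openT.
  by move=> y _; rewrite deriveE ?diff_lin//; exact: linear_differentiable.
have [A [oA Ax sA]] := smooth_near_cst x (f v).
have : smooth_on [set: V] (cst (f v)).
  by apply: smooth_onP => y _; exact: smooth_near_cst.
exact.
Qed.

Lemma smooth_near_id V (x : V) : smooth_near x (@id V).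
Proof. by apply: (@smooth_near_lin _ _ x (idfun : {linear V -> V})) => y; exact: cvg_id. Qed.

Lemma Ck_onD k V W (A : set V) (f g : V -> W) : open A ->
  Ck_on k A f -> Ck_on k A g -> Ck_on k A (fun y => f y + g y).
Proof.
move=> oA; elim: k f g => [|k IH] f g /=.
  by move=> cf cg y Ay; apply: continuousD; [exact: cf|exact: cg].
move=> [df Df] [dg Dg]; split=> [y Ay|v].
  by apply: (@differentiableD _ _ _ f g); [exact: df|exact: dg].
apply: (@Ck_on_ext _ _ _ _ (fun y => 'D_v f y + 'D_v g y)) => //; last exact: IH.
by move=> y Ay; rewrite (@deriveD _ _ _ f g)//; apply: diff_derivable;
  [exact: df|exact: dg].
Qed.

Lemma smooth_near2 V U1 U2 W (x : V) (f : V -> U1) (g : V -> U2) (h : V -> W) :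
  (forall k A, open A -> Ck_on k A f -> Ck_on k A g -> Ck_on k A h) ->
  smooth_near x f -> smooth_near x g -> smooth_near x h.
Proof.
move=> H [A [oA Ax sA]] [B [oB Bx sB]]; exists (A `&` B); split => //.
  exact: openI.
move=> k; apply: H; first exact: openI.
  by apply: Ck_on_sub (sA k) => y [].
by apply: Ck_on_sub (sB k) => y [].
Qed.

Lemma smooth_nearD V W (x : V) (f g : V -> W) :
  smooth_near x f -> smooth_near x g -> smooth_near x (fun y => f y + g y).
Proof. by apply: smooth_near2 => k A; exact: Ck_onD. Qed.

Lemma smooth_near_sum V W (x : V) (I : Type) (r : seq I) (P : pred I)
    (f : I -> V -> W) : (forall i, P i -> smooth_near x (f i)) ->
  smooth_near x (fun y => \sum_(i <- r | P i) f i y).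
Proof.
move=> sf; elim: r => [|i r IH].
  apply: smooth_near_eq => [y|]; [exact: big_nil|]; exact: smooth_near_cst.
apply: smooth_near_eq => [y|]; first exact: big_cons.
by case Pi: (P i) => //; apply: smooth_nearD => //; exact: sf.
Qed.

Lemma derive_comp V U W (x v : V) (f : V -> U) (g : U -> W) :
  differentiable f x -> differentiable g (f x) ->
  'D_v (fun y => g (f y)) x = 'D_('D_v f x) g (f x).
Proof.
move=> df dg; have dgf : differentiable (g \o f) x by exact: differentiable_comp.
by rewrite [LHS](deriveE _ dgf) diff_comp//= (deriveE _ dg) (deriveE _ df).
Qed.

Lemma derive_linc V W W' (x v : V) (l : {linear W -> W'}) (f : V -> W) :
  continuous l -> differentiable f x ->
  'D_v (fun y => l (f y)) x = l ('D_v f x).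
Proof.
move=> cl df; have dl : differentiable l (f x) by exact: linear_differentiable.
by rewrite derive_comp// (deriveE _ dl) diff_lin.
Qed.

Lemma differentiable_linc V W W' (x : V) (l : {linear W -> W'}) (f : V -> W) :
  continuous l -> differentiable f x -> differentiable (fun y => l (f y)) x.
Proof.
move=> cl df; apply: (@differentiable_comp _ _ _ _ f l) => //.
exact: linear_differentiable.
Qed.

Lemma Ck_on_linc k V W W' (A : set V) (l : {linear W -> W'}) (f : V -> W) :
  open A -> continuous l -> Ck_on k A f -> Ck_on k A (fun y => l (f y)).
Proof.
move=> oA cl; elim: k f => [|k IH] f.
  by move=> cf y Ay; apply: (@continuous_comp _ _ _ f l); [exact: cf|exact: cl].
move=> [df Df]; split=> [y Ay|v].
  by apply: differentiable_linc => //; exact: df.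
apply: (@Ck_on_ext _ _ _ _ (fun y => l ('D_v f y))) => //; last exact: IH (Df v).
by move=> y Ay; rewrite derive_linc//; exact: df.
Qed.

Lemma smooth_near_linc V W W' (x : V) (l : {linear W -> W'}) (f : V -> W) :
  continuous l -> smooth_near x f -> smooth_near x (fun y => l (f y)).
Proof.
by move=> cl [A [oA Ax sA]]; exists A; split => // k; exact: Ck_on_linc.
Qed.

Lemma continuous_pair (T : topologicalType) U W (f : T -> U) (g : T -> W) t :
  {for t, continuous f} -> {for t, continuous g} ->
  {for t, continuous (fun y => (f y, g y))}.
Proof. by move=> cf cg; apply: cvg_pair; [exact: cf|exact: cg]. Qed.

(** * Leibniz rules for bilinear maps *)

Section Bilinear.
Variables (V U1 U2 W : normedModType R) (b : {bilinear U1 -> U2 -> W}).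
Hypothesis cb : continuous (fun p : U1 * U2 => b p.1 p.2).

Lemma differentiable_bil (f : V -> U1) (g : V -> U2) x :
  differentiable f x -> differentiable g x ->
  differentiable (fun y => b (f y) (g y)) x.
Proof.
move=> df dg.
apply: (@differentiable_comp _ _ _ _ (fun y => (f y, g y)) (fun p => b p.1 p.2)).
  exact: differentiable_pair.
exact: differentiable_bilin.
Qed.

Lemma derive_bil (f : V -> U1) (g : V -> U2) x v :
  differentiable f x -> differentiable g x ->
  'D_v (fun y => b (f y) (g y)) x = b ('D_v f x) (g x) + b (f x) ('D_v g x).
Proof.
move=> df dg.
have dfg : differentiable (fun y => (f y, g y)) x by exact: differentiable_pair.
have db : differentiable (fun p => b p.1 p.2) (f x, g x) by exact: differentiable_bilin.
rewrite (@derive_comp _ _ _ x v (fun y => (f y, g y)) (fun p => b p.1 p.2))//.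
rewrite (deriveE _ db) diff_bilin//= (deriveE _ dfg) diff_pair//=.
by rewrite addrC (deriveE _ df) (deriveE _ dg).
Qed.

(** By Leibniz the derivative is a sum of two values of [b], each with one argument differentiated;
    the induction therefore runs over both functions at once, and [Ck_onS] weakens the argument that
    is not differentiated. *)
Lemma Ck_on_bil k (A : set V) (f : V -> U1) (g : V -> U2) : open A ->
  Ck_on k A f -> Ck_on k A g -> Ck_on k A (fun y => b (f y) (g y)).
Proof.
move=> oA; elim: k f g => [|k IH] f g.
  move=> cf cg y Ay.
  apply: (@continuous_comp _ _ _ (fun y => (f y, g y)) (fun p => b p.1 p.2)).
    by apply: cvg_pair; [exact: cf|exact: cg].
  exact: cb.
move=> Cf Cg; have [df Df] := Cf; have [dg Dg] := Cg; split=> [y Ay|v].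
  by apply: differentiable_bil; [exact: df|exact: dg].
apply: (@Ck_on_ext _ _ _ _ (fun y => b ('D_v f y) (g y) + b (f y) ('D_v g y))) => //.
  by move=> y Ay; rewrite derive_bil//; [exact: df|exact: dg].
by apply: Ck_onD => //; apply: IH; do ?[exact: Df | exact: Dg | exact: Ck_onS Cf | exact: Ck_onS Cg].
Qed.

Lemma smooth_near_bil (f : V -> U1) (g : V -> U2) x :
  smooth_near x f -> smooth_near x g -> smooth_near x (fun y => b (f y) (g y)).
Proof. by apply: smooth_near2 => k A; exact: Ck_on_bil. Qed.

End Bilinear.

Lemma scale_cont W : continuous (fun p : R * W => p.1 *: p.2).
Proof. by move=> p; apply: cvgZ; [exact: cvg_fst|exact: cvg_snd]. Qed.

Lemma scale_is_bilinear W : bilinear_for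
  (GRing.Scale.Law.clone _ _ *:%R _) (GRing.Scale.Law.clone _ _ *:%R _)
  (fun (a : R) (w : W) => a *: w).
Proof.
split=> [w|a] k x y /=; first by rewrite scalerDl scalerA.
by rewrite scalerDr !scalerA mulrC.
Qed.

(** A constant standing for [*:], on which the bilinear structure can be declared. *)
Definition scaleb W (a : R) (w : W) := a *: w.
HB.instance Definition _ W :=
  bilinear_isBilinear.Build R R W W _ _ (@scaleb W) (@scale_is_bilinear W).

Lemma smooth_nearZ V W (x : V) (f : V -> R) (g : V -> W) :
  smooth_near x f -> smooth_near x g -> smooth_near x (fun y => f y *: g y).
Proof. exact: (@smooth_near_bil V _ _ _ (@scaleb W) (@scale_cont W)). Qed.

Lemma differentiable_scale V W (x : V) (f : V -> R) (g : V -> W) :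
  differentiable f x -> differentiable g x ->
  differentiable (fun y => f y *: g y) x.
Proof. exact: (@differentiable_bil V _ _ _ (@scaleb W) (@scale_cont W)). Qed.

Lemma derive_scale V W (x v : V) (f : V -> R) (g : V -> W) :
  differentiable f x -> differentiable g x ->
  'D_v (fun y => f y *: g y) x = 'D_v f x *: g x + f x *: 'D_v g x.
Proof. exact: (@derive_bil V _ _ _ (@scaleb W) (@scale_cont W)). Qed.

Lemma smooth_nearM V (x : V) (f g : V -> R) :
  smooth_near x f -> smooth_near x g -> smooth_near x (fun y => f y * g y).
Proof. exact: smooth_nearZ. Qed.

Lemma smooth_nearN V W (x : V) (f : V -> W) :
  smooth_near x f -> smooth_near x (fun y => - f y).
Proof.
move=> sf; apply: smooth_near_eq => [y|]; first exact: (esym (scaleN1r _)).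
by apply: smooth_nearZ => //; exact: smooth_near_cst.
Qed.

Lemma smooth_nearB V W (x : V) (f g : V -> W) :
  smooth_near x f -> smooth_near x g -> smooth_near x (fun y => f y - g y).
Proof. by move=> sf sg; apply: smooth_nearD => //; exact: smooth_nearN. Qed.

Lemma smooth_near_coord V m n (x : V) (f : V -> 'M[R]_(m, n)) i j :
  smooth_near x f -> smooth_near x (fun y => f y i j).
Proof.
pose l (M : 'M[R]_(m, n)) := M i j.
have linl : linear l by move=> a u v; rewrite /l !mxE.
pose lM := GRing.isLinear.Build _ _ _ _ _ linl.
pose lL : {linear 'M[R]_(m, n) -> R} := HB.pack l lM.
by apply: (@smooth_near_linc _ _ _ _ lL) => y; exact: coord_continuous.
Qed.

Lemma differentiable_entry V m n (x : V) (f : V -> 'M[R]_(m, n)) i j :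
  differentiable f x -> differentiable (fun y => f y i j) x.
Proof.
move=> df; apply: (@differentiable_comp _ _ _ _ f (fun M => M i j)) => //.
exact: differentiable_coord.
Qed.

Lemma mx_decomp m n (A : 'M[R]_(m, n)) :
  A = \sum_(ij : 'I_m * 'I_n) A ij.1 ij.2 *: delta_mx ij.1 ij.2.
Proof. by rewrite {1}[A]matrix_sum_delta pair_bigA. Qed.

Lemma smooth_near_mx V m n (x : V) (f : V -> 'M[R]_(m, n)) :
  (forall i j, smooth_near x (fun y => f y i j)) -> smooth_near x f.
Proof.
move=> H; apply: smooth_near_eq => [y|]; first exact: mx_decomp.
apply: smooth_near_sum => ij _; apply: smooth_nearZ => //.
exact: smooth_near_cst.
Qed.

Lemma derive_entry V m n (x v : V) (f : V -> 'M[R]_(m, n)) i j :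
  differentiable f x -> 'D_v (fun y => f y i j) x = 'D_v f x i j.
Proof. by move=> df; rewrite (derive_mx (diff_derivable df)) mxE. Qed.

Lemma smooth_near_fst V U W (x : V) (f : V -> U * W) :
  smooth_near x f -> smooth_near x (fun y => (f y).1).
Proof.
by apply: (@smooth_near_linc V _ _ x (@fst U W : {linear _ -> _})) => y; exact: cvg_fst.
Qed.

Lemma smooth_near_snd V U W (x : V) (f : V -> U * W) :
  smooth_near x f -> smooth_near x (fun y => (f y).2).
Proof.
by apply: (@smooth_near_linc V _ _ x (@snd U W : {linear _ -> _})) => y; exact: cvg_snd.
Qed.

Lemma mulmx_cont m n p :
  continuous (fun A : 'M[R]_(m, n) * 'M[R]_(n, p) => A.1 *m A.2).
Proof.
move=> AB; apply: smooth_near_cont; apply: smooth_near_mx => i j.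
apply: smooth_near_eq => [y|]; first exact: mxE.
apply: smooth_near_sum => k _; apply: smooth_nearM; apply: smooth_near_coord.
  by apply: smooth_near_fst; exact: smooth_near_id.
by apply: smooth_near_snd; exact: smooth_near_id.
Qed.

Section MatrixCalc.
Variables (V : normedModType R) (m n p : nat).
Implicit Types (f : V -> 'M[R]_(m, n)) (g : V -> 'M[R]_(n, p)).

Lemma Ck_on_mulmx k (A : set V) f g : open A ->
  Ck_on k A f -> Ck_on k A g -> Ck_on k A (fun y => f y *m g y).
Proof. exact: (@Ck_on_bil V _ _ _ mulmx (@mulmx_cont _ _ _)). Qed.

Lemma smooth_near_mulmx f g x :
  smooth_near x f -> smooth_near x g -> smooth_near x (fun y => f y *m g y).
Proof. exact: (@smooth_near_bil V _ _ _ mulmx (@mulmx_cont _ _ _)). Qed.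

Lemma differentiable_mulmx f g x : differentiable f x -> differentiable g x ->
  differentiable (fun y => f y *m g y) x.
Proof. exact: (@differentiable_bil V _ _ _ mulmx (@mulmx_cont _ _ _)). Qed.

Lemma derive_mulmx f g x v : differentiable f x -> differentiable g x ->
  'D_v (fun y => f y *m g y) x = 'D_v f x *m g x + f x *m 'D_v g x.
Proof. exact: (@derive_bil V _ _ _ mulmx (@mulmx_cont _ _ _)). Qed.

End MatrixCalc.

Lemma Ck_on_pair k V U W (A : set V) (f : V -> U) (g : V -> W) : open A ->
  Ck_on k A f -> Ck_on k A g -> Ck_on k A (fun y => (f y, g y)).
Proof.
move=> oA; elim: k f g => [|k IH] f g /=.
  by move=> cf cg y Ay; apply: cvg_pair; [exact: cf|exact: cg].
move=> [df Df] [dg Dg]; split=> [y Ay|v].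
  by apply: differentiable_pair; [exact: df|exact: dg].
apply: (@Ck_on_ext _ _ _ _ (fun y => ('D_v f y, 'D_v g y))) => //; last exact: IH.
move=> y Ay; have dfy := df _ Ay; have dgy := dg _ Ay.
have dfg : differentiable (fun y => (f y, g y)) y by exact: differentiable_pair.
by rewrite (deriveE _ dfg) diff_pair//= (deriveE _ dfy) (deriveE _ dgy).
Qed.

Lemma smooth_near_pair V U W (x : V) (f : V -> U) (g : V -> W) :
  smooth_near x f -> smooth_near x g -> smooth_near x (fun y => (f y, g y)).
Proof. by apply: smooth_near2 => k A; exact: Ck_on_pair. Qed.

Lemma derive_pair V U W (x v : V) (f : V -> U) (g : V -> W) :
  differentiable f x -> differentiable g x ->
  'D_v (fun y => (f y, g y)) x = ('D_v f x, 'D_v g x).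
Proof.
move=> df dg.
have dfg : differentiable (fun y => (f y, g y)) x by exact: differentiable_pair.
by rewrite (deriveE _ dfg) diff_pair//= (deriveE _ df) (deriveE _ dg).
Qed.

(* The finite basis is what allows differentiating in a varying direction. *)
Class findim V : Prop := Findim {
  findim_ex : exists n (b : 'I_n -> V) (l : 'I_n -> {linear V -> R}),
    (forall i, continuous (l i)) /\ forall v, v = \sum_i l i v *: b i }.

Lemma findimI V (I : finType) (b : I -> V) (l : I -> V -> R) :
  (forall i, linear (l i)) -> (forall i, continuous (l i)) ->
  (forall v, v = \sum_i l i v *: b i) -> findim V.
Proof.
move=> linl cl dec; split; exists #|I|, (fun i => b (enum_val i)).
pose L i : {linear V -> R} := HB.pack (l i) (GRing.isLinear.Build _ _ _ _ _ (linl i)).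
exists (fun i => L (enum_val i)).
split=> [i|v]; first exact: cl.
by rewrite {1}(dec v) [LHS](reindex (@enum_val I predT))//; apply: onW_bij; exact: enum_val_bij.
Qed.

Global Instance findim_R : findim R.
Proof.
apply: (@findimI R unit (fun=> 1) (fun=> id)) => //; first by move=> _ y; exact: cvg_id.
by move=> v; rewrite (big_pred1 tt) ?scaler1//; case.
Qed.

Global Instance findim_mx m n : findim 'M[R]_(m, n).
Proof.
apply: (@findimI _ ('I_m * 'I_n)%type (fun ij => delta_mx ij.1 ij.2)
   (fun ij A => A ij.1 ij.2)).
- by move=> ij a u v; rewrite !mxE.
- by move=> ij; exact: coord_continuous.
- exact: mx_decomp.
Qed.

Global Instance findim_prod V W : findim V -> findim W -> findim (V * W)%type.
Proof.
move=> [[n [b [l [cl dl]]]]] [[n' [b' [l' [cl' dl']]]]].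
apply: (@findimI _ ('I_n + 'I_n')%type
  (fun i => match i with inl i => (b i, 0) | inr j => (0, b' j) end)
  (fun i v => match i with inl i => l i v.1 | inr j => l' j v.2 end)).
- by case=> i a u v; rewrite linearP.
- case=> i y; [apply: (@continuous_comp _ _ _ fst (l i))
              |apply: (@continuous_comp _ _ _ snd (l' i))].
  + exact: cvg_fst.
  + exact: cl.
  + exact: cvg_snd.
  + exact: cl'.
- move=> [v w]; rewrite big_sumType/=.
  have E1 : \sum_i l i v *: (b i, 0 : W) = (v, 0).
    rewrite [in RHS](dl v); elim/big_rec2: _ => // i y1 y2 _ ->.
    by rewrite /GRing.scale/= /scale_pair scaler0 /GRing.add/= /add_pair add0r.
  have E2 : \sum_i l' i w *: (0 : V, b' i) = (0, w).
    rewrite [in RHS](dl' w); elim/big_rec2: _ => // i y1 y2 _ ->.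
    by rewrite /GRing.scale/= /scale_pair scaler0 /GRing.add/= /add_pair add0r.
  by rewrite E1 E2 /GRing.add/= /add_pair addr0 add0r.
Qed.

Lemma derive_basis V W (f : V -> W) x n (b : 'I_n -> V) (l : 'I_n -> {linear V -> R}) v :
  (forall v, v = \sum_i l i v *: b i) -> differentiable f x ->
  'D_v f x = \sum_i l i v *: 'D_(b i) f x.
Proof.
move=> dl df; rewrite deriveE// {1}(dl v) linear_sum; apply: eq_bigr => i _.
by rewrite linearZ deriveE.
Qed.

(** The chain rule differentiates [g] in the moving direction ['D_v f y]. Expanding it in the basis
    leaves derivatives of [g] in fixed directions, to which the induction hypothesis, general in
    [g], applies. *)
Lemma Ck_on_comp k V U W (A : set V) (B : set U) (f : V -> U) (g : U -> W) :
  findim U -> open A -> (forall y, A y -> B (f y)) ->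
  Ck_on k A f -> Ck_on k B g -> Ck_on k A (fun y => g (f y)).
Proof.
move=> [[n [b [l [cl dl]]]]] oA AB; elim: k g => [|k IH] g Cf Cg.
  move=> y Ay; apply: (@continuous_comp _ _ _ f g); first exact: Cf.
  by apply: Cg; exact: AB.
have [df Df] := Cf; have [dg Dg] := Cg; split=> [y Ay|v].
  apply: (@differentiable_comp _ _ _ _ f g); first exact: df.
  by apply: dg; exact: AB.
apply: (@Ck_on_ext _ _ _ _ (fun y => \sum_i l i ('D_v f y) *: 'D_(b i) g (f y))) => //.
  move=> y Ay; rewrite (derive_comp _ (df _ Ay) (dg _ (AB _ Ay))).
  by rewrite -(derive_basis _ dl)//; apply: dg; exact: AB.
elim: (index_enum _) => [|i r IHr].
  rewrite (_ : (fun y => _) = cst 0); last by apply: funext => y; rewrite big_nil.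
  have /(_ k) : smooth_on A (cst (0 : W) : V -> W).
    by apply: smooth_onP => y _; exact: smooth_near_cst.
  exact.
rewrite (_ : (fun y => _) = (fun y => l i ('D_v f y) *: 'D_(b i) g (f y) +
  \sum_(j <- r) l j ('D_v f y) *: 'D_(b j) g (f y))); last first.
  by apply: funext => y; rewrite big_cons.
apply: Ck_onD => //; apply: (@Ck_on_bil V _ _ _ (@scaleb W) (@scale_cont W)) => //.
  by apply: Ck_on_linc => //; exact: Df.
exact: (IH _ (Ck_onS Cf) (Dg (b i))).
Qed.

Lemma smooth_near_comp V U W (x : V) (f : V -> U) (g : U -> W) : findim U ->
  smooth_near x f -> smooth_near (f x) g -> smooth_near x (fun y => g (f y)).
Proof.
move=> fU sf [B [oB Bfx sB]].
have cf := smooth_near_cont sf; case: sf => A [oA Ax sA].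
have : nbhs x (f @^-1` B) by apply: cf; exact: open_nbhs_nbhs.
rewrite nbhsE => -[A' [oA' A'x] A'B]; exists (A `&` A'); split => //.
  exact: openI.
move=> k; apply: (@Ck_on_comp _ _ _ _ _ B) => //; first exact: openI.
  by move=> y [_ /A'B].
by apply: Ck_on_sub (sA k) => y [].
Qed.

Lemma smooth_on_comp V U W (A : set V) (B : set U) (f : V -> U) (g : U -> W) :
  findim U -> open A -> (forall y, A y -> B (f y)) ->
  smooth_on A f -> smooth_on B g -> smooth_on A (fun y => g (f y)).
Proof. by move=> fU oA AB sf sg k; exact: (@Ck_on_comp _ _ _ _ A B). Qed.

Lemma smooth_near_Dvar V W (x : V) (f : V -> W) (v : V -> V) : findim V ->
  smooth_near x f -> smooth_near x v -> smooth_near x (fun y => 'D_(v y) f y).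
Proof.
move=> [[n [b [l [cl dl]]]]] sf sv.
apply: (@smooth_near_ext _ _ _ (fun y => \sum_i l i (v y) *: 'D_(b i) f y)).
  by apply: filterS (smooth_near_nbhs sf) => y /smooth_near_diff dfy; rewrite -(derive_basis _ dl).
apply: smooth_near_sum => i _; apply: smooth_nearZ.
  exact: smooth_near_linc.
exact: smooth_near_D.
Qed.

(** Separates the derivative of the direction from the second derivative of [f], which [schwarz]
    makes symmetric; second-order terms of brackets cancel in this form. *)
Lemma derive_Dvar V W (x u : V) (f : V -> W) (v : V -> V) : findim V ->
  smooth_near x f -> differentiable v x ->
  'D_u (fun y => 'D_(v y) f y) x = 'D_('D_u v x) f x + 'D_u (fun y => 'D_(v x) f y) x.
Proof.
move=> [[n [b [l [cl dl]]]]] sf dv.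
have nf := smooth_near_nbhs sf; have dfx := smooth_near_diff sf.
rewrite (@near_eq_derive _ _ _ _ (fun y => \sum_i l i (v y) *: 'D_(b i) f y)); last first.
  by apply: filterS nf => y /smooth_near_diff dfy; rewrite -(derive_basis _ dl).
rewrite [X in _ + X](@near_eq_derive _ _ _ _ (fun y => \sum_i l i (v x) *: 'D_(b i) f y)); last first.
  by apply: filterS nf => y /smooth_near_diff dfy; rewrite -(derive_basis _ dl).
have dDf i : differentiable (fun y => 'D_(b i) f y) x.
  by apply: smooth_near_diff; exact: smooth_near_D.
have dlv i : differentiable (fun y => l i (v y)) x by exact: differentiable_linc.
have sumE (h : 'I_n -> V -> W) : (fun y => \sum_i h i y) = \sum_i h i.
  by apply: funext => y; rewrite fct_sumE.
have dc i : differentiable (fun _ : V => l i (v x)) x by exact: differentiable_cst.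
have d1 i : derivable (fun y => l i (v x) *: 'D_(b i) f y) x u.
  by apply: diff_derivable; exact: differentiable_scale.
have d2 i : derivable (fun y => l i (v y) *: 'D_(b i) f y) x u.
  by apply: diff_derivable; exact: differentiable_scale.
rewrite !sumE !derive_sum//.
rewrite (derive_basis _ dl)// -big_split/=; apply: eq_bigr => i _.
rewrite !derive_scale// derive_linc//.
by rewrite (derive_cst (l i (v x))) scale0r add0r.
Qed.

Lemma linear_findim_continuous V W (l : V -> W) : findim V -> linear l -> continuous l.
Proof.
move=> [[n [b [c [cc dc]]]]] ll.
pose L : {linear V -> W} := HB.pack l (GRing.isLinear.Build _ _ _ _ _ ll).
have -> : l = (fun v => \sum_i c i v *: l (b i)).
  apply: funext => v; rewrite -[l]/(L : V -> W) {1}(dc v) linear_sum.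
  by apply: eq_bigr => i _; rewrite linearZ.
move=> v; apply: smooth_near_cont; apply: smooth_near_sum => i _.
by apply: smooth_nearZ; [exact: smooth_near_lin|exact: smooth_near_cst].
Qed.

Lemma smooth_near_linear V U W (x : V) (l : U -> W) (f : V -> U) : findim U ->
  linear l -> smooth_near x f -> smooth_near x (fun y => l (f y)).
Proof.
move=> fU ll sf.
pose L : {linear U -> W} := HB.pack l (GRing.isLinear.Build _ _ _ _ _ ll).
exact: (@smooth_near_linc _ _ _ x L f (linear_findim_continuous fU ll)).
Qed.

Lemma derive_linear V U W (x v : V) (l : U -> W) (f : V -> U) : findim U ->
  linear l -> differentiable f x -> 'D_v (fun y => l (f y)) x = l ('D_v f x).
Proof.
move=> fU ll df.
pose L : {linear U -> W} := HB.pack l (GRing.isLinear.Build _ _ _ _ _ ll).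
exact: (@derive_linc _ _ _ x v L f (linear_findim_continuous fU ll)).
Qed.

(** Made for connection matrices applied to a moving vector: with linearity and a finite basis,
    joint smoothness follows from smoothness at each fixed argument. *)
Lemma smooth_near_app V U W (x : V) (G : V -> U -> W) (f : V -> U) : findim U ->
  (\forall y \near x, linear (G y)) ->
  (forall u, smooth_near x (fun y => G y u)) -> smooth_near x f ->
  smooth_near x (fun y => G y (f y)).
Proof.
move=> [[n [b [c [cc dc]]]]] lG sG sf.
apply: (@smooth_near_ext _ _ _ (fun y => \sum_i c i (f y) *: G y (b i))).
  apply: filterS lG => y ly.
  pose L : {linear U -> W} := HB.pack (G y) (GRing.isLinear.Build _ _ _ _ _ ly).
  rewrite -[G y]/(L : U -> W) [in RHS](dc (f y)) linear_sum.
  by apply: eq_bigr => i _; rewrite linearZ.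
by apply: smooth_near_sum => i _; apply: smooth_nearZ => //; exact: smooth_near_linc.
Qed.

Lemma derive_app V U W (x v : V) (G : V -> U -> W) (f : V -> U) : findim U ->
  (\forall y \near x, linear (G y)) ->
  (forall u, differentiable (fun y => G y u) x) -> differentiable f x ->
  'D_v (fun y => G y (f y)) x = 'D_v (fun y => G y (f x)) x + G x ('D_v f x).
Proof.
move=> [[n [b [c [cc dc]]]]] lG dG df.
have GE (g : V -> U) : \forall y \near x, G y (g y) = \sum_i c i (g y) *: G y (b i).
  apply: filterS lG => y ly.
  pose L : {linear U -> W} := HB.pack (G y) (GRing.isLinear.Build _ _ _ _ _ ly).
  rewrite -[G y]/(L : U -> W) [in LHS](dc (g y)) linear_sum.
  by apply: eq_bigr => i _; rewrite linearZ.
rewrite (near_eq_derive _ (GE f)) (near_eq_derive _ (GE (cst (f x)))).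
rewrite (nbhs_singleton (GE (cst ('D_v f x)))) /cst.
have sumE (h : 'I_n -> V -> W) : (fun y => \sum_i h i y) = \sum_i h i.
  by apply: funext => y; rewrite fct_sumE.
have dci i : differentiable (fun _ : V => c i (f x)) x by exact: differentiable_cst.
have dcf i : differentiable (fun y : V => c i (f y)) x by exact: differentiable_linc.
have d1 i : derivable (fun y => c i (f x) *: G y (b i)) x v.
  by apply: diff_derivable; exact: differentiable_scale.
have d2 i : derivable (fun y => c i (f y) *: G y (b i)) x v.
  by apply: diff_derivable; exact: differentiable_scale.
rewrite !sumE !derive_sum// -big_split/=; apply: eq_bigr => i _.
rewrite !derive_scale// derive_linc//.
by rewrite (derive_cst (c i (f x))) scale0r add0r addrC.
Qed.

(** * Symmetry of second derivatives *)

Section Schwarz.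
Variables (V : normedModType R).

Lemma smooth_line (x v : V) (t : R) : smooth_near t (fun t : R => x + t *: v).
Proof.
apply: smooth_nearD; first exact: smooth_near_cst.
by apply: smooth_nearZ; [exact: smooth_near_id|exact: smooth_near_cst].
Qed.

Lemma derive_line (x v : V) (t : R) : 'D_1 (fun t : R => x + t *: v) t = v.
Proof.
have di : differentiable (@id R) t by exact: smooth_near_diff (smooth_near_id _).
have dc : differentiable (fun _ : R => v) t by exact: differentiable_cst.
have dt : differentiable (fun t : R => t *: v) t by exact: (differentiable_scale di dc).
rewrite (@deriveD _ _ _ (cst x) (fun t : R => t *: v)); last 2 first.
- exact: derivable_cst.
- exact: diff_derivable.
rewrite derive_cst add0r (derive_scale (1 : R) di dc).
by rewrite (derive_id t 1) (derive_cst v) scale1r scaler0 addr0.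
Qed.

Lemma MVT_dir (f : V -> R) (x v : V) (h : R) : 0 < h ->
  (forall s, 0 <= s <= h -> differentiable f (x + s *: v)) ->
  exists2 s, 0 < s < h & f (x + h *: v) - f x = h * 'D_v f (x + s *: v).
Proof.
move=> h0 df.
have dl (s : R) : differentiable (fun t : R => x + t *: v) s.
  exact: smooth_near_diff (smooth_line x v s).
have Dl := derive_line x v.
have dd s : 0 <= s <= h -> is_derive s 1 (fun t : R => f (x + t *: v)) ('D_v f (x + s *: v)).
  move=> sh; split.
    apply: diff_derivable.
    by apply: (@differentiable_comp _ _ _ _ (fun t : R => x + t *: v) f) => //; exact: df.
  by rewrite (@derive_comp _ _ _ s 1 (fun t : R => x + t *: v) f)// ?Dl//; exact: df.
have dd' s : s \in `]0, h[ -> is_derive s 1 (fun t : R => f (x + t *: v)) ('D_v f (x + s *: v)).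
  by rewrite in_itv/= => /andP[s0 sh]; apply: dd; rewrite !ltW.
have cc : {within `[0, h], continuous (fun t : R => f (x + t *: v))}.
  apply: derivable_within_continuous => s; rewrite in_itv/= => sh.
  by have [] := dd s sh.
have [s s01 E] := MVT h0 dd' cc.
exists s; first by move: s01; rewrite in_itv.
by move: E; rewrite scale0r addr0 subr0 mulrC.
Qed.

Lemma double_diff (f : V -> R) (x v w : V) (h : R) (A : set V) : 0 < h ->
  smooth_on A f -> (forall s t, 0 <= s <= h -> 0 <= t <= h -> A (x + s *: v + t *: w)) ->
  exists s t, [/\ 0 < s < h, 0 < t < h &
    f (x + h *: v + h *: w) - f (x + h *: v) - (f (x + h *: w) - f x)
    = h * h * 'D_w (fun y => 'D_v f y) (x + s *: v + t *: w)].
Proof.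
move=> h0 sf HA.
have df y : A y -> differentiable f y by have [+ _] := sf 1%N; exact.
have dDf y : A y -> differentiable (fun y => 'D_v f y) y.
  by have [_ /(_ v) [+ _]] := sf 2%N; exact.
have hh : 0 <= h <= h by rewrite lexx ltW.
have h00 : 0 <= (0 : R) <= h by rewrite lexx ltW.
pose u y := f (y + h *: w) - f y.
have A0 s : 0 <= s <= h -> A (x + s *: v).
  by move=> sh; have := HA s 0 sh h00; rewrite scale0r addr0.
have dsh y : differentiable (fun y => y + h *: w) y.
  by apply: (@differentiableD _ _ _ id (cst (h *: w))).
have du s : 0 <= s <= h -> differentiable (fun y => f (y + h *: w)) (x + s *: v).
  move=> sh; apply: (@differentiable_comp _ _ _ _ (fun y => y + h *: w) f) => //.
  by apply: df; exact: HA.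
have Du s : 0 <= s <= h ->
    'D_v u (x + s *: v) = 'D_v f (x + s *: v + h *: w) - 'D_v f (x + s *: v).
  move=> sh; rewrite (@deriveB _ _ _ (fun y => f (y + h *: w)) f); last 2 first.
  - by apply: diff_derivable; exact: du.
  - by apply: diff_derivable; apply: df; exact: A0.
  have dfs : differentiable f (x + s *: v + h *: w) by apply: df; exact: HA.
  rewrite (derive_comp v (dsh (x + s *: v)) dfs).
  rewrite (@deriveD _ _ _ id (cst (h *: w))); last 2 first.
  - exact: derivable_id.
  - exact: derivable_cst.
  by rewrite derive_id derive_cst addr0.
have [|s sh E1] := @MVT_dir u x v h h0.
  move=> s sh; apply: (@differentiableB _ _ _ (fun y => f (y + h *: w)) f); first exact: du.
  by apply: df; exact: A0.
have sh' : 0 <= s <= h by case/andP: sh => /ltW-> /ltW->.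
have [|t th E2] := @MVT_dir (fun y => 'D_v f y) (x + s *: v) w h h0.
  by move=> t th; apply: dDf; exact: HA.
exists s, t; split => //.
by rewrite -/(u (x + h *: v)) -/(u x) E1 Du// E2 mulrA.
Qed.

(** The second difference in [double_diff] is symmetric in [v] and [w], so the two mixed derivatives
    share a value at points near [x]; by continuity both are within [e / 2] of it at [x]. *)
Lemma schwarz_real (f : V -> R) (x v w : V) : smooth_near x f ->
  'D_v (fun y => 'D_w f y) x = 'D_w (fun y => 'D_v f y) x.
Proof.
move=> sf0.
have c1 := smooth_near_cont (smooth_near_D v (smooth_near_D w sf0)).
have c2 := smooth_near_cont (smooth_near_D w (smooth_near_D v sf0)).
have [A [oA Ax sf]] := sf0.
apply/eqP; rewrite eq_sym -subr_eq0 -normr_le0; apply/ler_addgt0Pl => e e0.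
rewrite addr0.
have e20 : 0 < e / 2 by rewrite divr_gt0.
move: c1 => /cvgrPdist_lt /(_ _ e20); move: c2 => /cvgrPdist_lt /(_ _ e20) => c2 c1.
have nA : nbhs x A by exact: open_nbhs_nbhs.
have [d /= d0 Hd] := (nbhs_ballP x _).1 (filterI nA (filterI c1 c2)).
(* The [+ 1] keeps [k] positive when [v] and [w] vanish; for the [h] below the parallelogram spanned
   by [h v] and [h w] at [x] lies in the ball of radius [d]. *)
pose k := `|v| + `|w| + 1.
have k0 : 0 < k by rewrite /k ltr_pwDr// addr_ge0.
pose h := d / 2 / k.
have h0 : 0 < h by rewrite /h !divr_gt0.
have hk : h * k < d.
  by rewrite /h divfK ?gt_eqF// ltr_pdivrMr// ltr_pMr// ltr1n.
have Hb s t : 0 <= s <= h -> 0 <= t <= h -> ball x d (x + s *: v + t *: w).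
  move=> /andP[s0 sh] /andP[t0 th]; rewrite -ball_normE/=.
  rewrite -addrA opprD addrA subrr add0r normrN.
  apply: le_lt_trans hk; apply: (le_trans (ler_normD _ _)).
  rewrite !normrZ !ger0_norm// /k !mulrDr mulr1.
  apply: (@le_trans _ _ (h * `|v| + h * `|w|)); last by rewrite lerDl ltW.
  by apply: lerD; rewrite ler_wpM2r.
have [|s [t [sh th E1]]] := @double_diff f x v w h A h0 sf.
  by move=> s t sh th; have [] := Hd _ (Hb _ _ sh th).
have [|t' [s' [th' sh' E2]]] := @double_diff f x w v h A h0 sf.
  by move=> t1 s1 th' sh'; rewrite addrAC; have [] := Hd _ (Hb _ _ sh' th').
have ww (r : R) : 0 < r < h -> 0 <= r <= h by case/andP => /ltW-> /ltW->.
have [_ [_ D2]] := Hd _ (Hb _ _ (ww _ sh) (ww _ th)).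
have [_ [D1 _]] := Hd _ (Hb _ _ (ww _ sh') (ww _ th')).
have hh0 : h * h != 0 by rewrite mulf_neq0 ?gt_eqF.
rewrite [x + s' *: v + _]addrAC in D1.
move: E1 E2 D1 D2; rewrite [x + h *: w + h *: v]addrAC.
move: ('D_w (fun y => 'D_v f y) (x + s *: v + t *: w)) => a.
move: ('D_v (fun y => 'D_w f y) (x + t' *: w + s' *: v)) => b E1 E2 D1 D2.
have ba : b = a.
  apply: (mulfI hh0); rewrite -E1 -E2; move: (f _) (f _) (f _) (f _) => f1 f2 f3 f4.
  by ring.
rewrite ba in D1; move: D1 D2.
move: ('D_v (fun y => 'D_w f y) x) ('D_w (fun y => 'D_v f y) x) => d1 d2 D1 D2.
apply: (le_trans (ler_distD a _ _)); rewrite [leRHS]splitr lerD//; first exact: ltW.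
by rewrite distrC ltW.
Qed.

Lemma schwarz W (f : V -> W) (x v w : V) : findim W -> smooth_near x f ->
  'D_v (fun y => 'D_w f y) x = 'D_w (fun y => 'D_v f y) x.
Proof.
move=> [[n [b [l [cl dl]]]]] sf.
have D y u i : smooth_near y f -> l i ('D_u f y) = 'D_u (fun y => l i (f y)) y.
  by move=> /smooth_near_diff dfy; rewrite derive_linc.
have E u u' i : l i ('D_u (fun y => 'D_u' f y) x) = 'D_u (fun y => 'D_u' (fun y => l i (f y)) y) x.
  rewrite -derive_linc//; last by apply: smooth_near_diff; exact: smooth_near_D.
  apply: near_eq_derive; apply: filterS (smooth_near_nbhs sf) => y sy.
  exact: D.
have K i : l i ('D_v (fun y => 'D_w f y) x) = l i ('D_w (fun y => 'D_v f y) x).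
  rewrite [LHS]E [RHS]E; apply: schwarz_real; exact: smooth_near_linc.
move: K; move: ('D_v (fun y => 'D_w f y) x) ('D_w (fun y => 'D_v f y) x) => a1 a2 K.
by rewrite (dl a1) (dl a2); apply: eq_bigr => i _; rewrite K.
Qed.

End Schwarz.

End Calculus.

(** * Linear differential equations *)

Section LinearODE.
Context {R : realType}.

(** The integral starts at [a < 0], left of the base point, so that the primitive is differentiable
    on both sides of [0]; subtracting its value there normalizes it. *)
Lemma antiderivative (f : R -> R) (a : R) : continuous f -> a < 0 ->
  exists2 F : R -> R, F 0 = 0 & forall t : R, a < t -> is_derive t 1 F (f t).
Proof.
move=> cf a0.
pose F x := (\int[lebesgue_measure]_(t in `[a, x]) f t)%R.
exists (fun x => F x - F 0); first by rewrite subrr.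
move=> t at_; have [||//||dF EF] := @continuous_FTC1 R f (BLeft a) t (t + 1).
- by rewrite ltrDl.
- apply: continuous_compact_integrable; first exact: segment_compact.
  exact: continuous_subspaceT.
- exact: cf.
have hF : is_derive t 1 F (f t) by apply: DeriveDef; [exact: dF|rewrite -derive1E; exact: EF].
by rewrite -[f t]subr0; exact: (@is_deriveB _ _ _ F (cst (F 0)) t 1).
Qed.

Lemma antiderivative_mx n (f : R -> 'M[R]_n) (a : R) : continuous f -> a < 0 ->
  exists2 F : R -> 'M[R]_n, F 0 = 0 &
    forall t : R, a < t -> forall i j, is_derive t 1 (fun s => F s i j) (f t i j).
Proof.
move=> cf a0.
have H ij : exists F : R -> R, F 0 = 0 /\
    forall t : R, a < t -> is_derive t 1 F (f t ij.1 ij.2).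
  have [|F F0 dF] := @antiderivative (fun t => f t ij.1 ij.2) a _ a0.
    move=> t; apply: (@continuous_comp _ _ _ f (fun A => A ij.1 ij.2)) => //.
      exact: cf.
    exact: coord_continuous.
  by exists F.
have [F HF] := choice H.
exists (fun t => \matrix_(i, j) F (i, j) t).
  by apply/matrixP => i j; rewrite !mxE; have [] := HF (i, j).
move=> t at_ i j; rewrite (_ : (fun s => _) = F (i, j)).
  by have [_] := HF (i, j); exact.
by apply: funext => s; rewrite mxE.
Qed.

Lemma primitive_bound (F f : R -> R) (r C t : R) : F 0 = 0 ->
  (forall s, - r <= s <= r -> is_derive s 1 F (f s)) ->
  (forall s, - r <= s <= r -> `|f s| <= C) -> - r <= t <= r -> `|F t| <= C * r.
Proof.
move=> F0 dF fC /andP[rt tr].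
have C0 : 0 <= C by apply: le_trans (fC t _) => //; rewrite rt tr.
have dFc s : - r <= s <= r -> derivable F s 1 by move=> /dF[].
have [t0|t0] := leP 0 t.
  have [||c] := @MVT_segment R F f 0 t t0.
  - move=> s; rewrite in_itv/= => /andP[s0 st]; apply: dF; apply/andP; split; lra.
  - apply: derivable_within_continuous => s; rewrite in_itv/= => /andP[s0 st].
    by apply: dFc; apply/andP; split; lra.
  - rewrite in_itv/= => /andP[c0 ct]; rewrite F0 !subr0 => ->.
    rewrite normrM ler_pM// ?(ger0_norm t0)//; apply: fC; apply/andP; split; lra.
have [||c] := @MVT_segment R F f t 0 (ltW t0).
- move=> s; rewrite in_itv/= => /andP[s0 st]; apply: dF; apply/andP; split; lra.
- apply: derivable_within_continuous => s; rewrite in_itv/= => /andP[s0 st].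
  by apply: dFc; apply/andP; split; lra.
rewrite in_itv/= => /andP[c0 ct]; rewrite F0 !sub0r => E.
rewrite -normrN E normrM normrN ler_pM//.
- by apply: fC; apply/andP; split; lra.
- by rewrite ltr0_norm//; lra.
Qed.

(** The radius [e k] is the tail of the geometric series, so the intervals around the [x k] are
    nested; the supremum of their left ends is the limit. *)
Lemma geometric_limit (x : nat -> R) :
  (forall k, `|x k.+1 - x k| <= 2^-1 ^+ k) ->
  exists l, forall k, `|x k - l| <= 2 * 2^-1 ^+ k.
Proof.
move=> H; pose e k : R := 2 * 2^-1 ^+ k.
have eS k : e k = e k.+1 + 2^-1 ^+ k by rewrite /e exprS; field.
have e0 k : 0 <= e k by rewrite /e mulr_ge0// exprn_ge0.
have mono k j : x k - e k <= x (k + j)%N - e (k + j)%N.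
  elim: j => [|j IH]; first by rewrite addn0.
  apply: le_trans IH _; rewrite addnS; have := H (k + j)%N; have := eS (k + j)%N.
  by rewrite ler_norml => -> /andP[h1 h2]; lra.
have anti k j : x (k + j)%N + e (k + j)%N <= x k + e k.
  elim: j => [|j IH]; first by rewrite addn0.
  apply: le_trans IH; rewrite addnS; have := H (k + j)%N; have := eS (k + j)%N.
  by rewrite ler_norml => -> /andP[h1 h2]; lra.
have cross k j : x k - e k <= x j + e j.
  apply: le_trans (mono k j) _; apply: le_trans _ (anti j k).
  by rewrite addnC; have := e0 (j + k)%N; lra.
pose E := [set x k - e k | k in [set: nat]].
have ubE k : ubound E (x k + e k) by move=> _ [j _ <-]; exact: cross.
exists (sup E) => k; rewrite ler_distl; apply/andP; split.
  have : sup E <= x k + e k by apply: ge_sup => //; exists (x 0%N - e 0%N), 0%N.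
  by rewrite /e; lra.
have : x k - e k <= sup E by apply: ub_le_sup; [exists (x 0%N + e 0%N)|exists k].
by rewrite /e; lra.
Qed.

(** Freezing the argument outside the interval of radius [r] keeps every function of the iteration
    defined and continuous on the whole line. *)
Definition clamp (r t : R) : R := Num.max (- r) (Num.min r t).

Lemma clamp_cont r : continuous (clamp r).
Proof.
move=> t; apply: (@continuous_max R R (cst (- r)) (fun t => Num.min r t) t).
  exact: cst_continuous.
apply: (@continuous_min R R (cst r) id t); first exact: cst_continuous.
exact: cvg_id.
Qed.

Lemma clampP r t : 0 < r -> - r <= clamp r t <= r.
Proof.
move=> r0; rewrite /clamp le_max lexx/= ge_max ge_min lexx/= andbT; lra.
Qed.

Lemma clamp_id r t : - r <= t <= r -> clamp r t = t.
Proof. by move=> /andP[h1 h2]; rewrite /clamp min_r// max_r. Qed.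

Lemma near_mx T (F : set_system T) {FF : Filter F} m n (P : 'I_m -> 'I_n -> set T) :
  (forall i j, F (P i j)) -> F [set s | forall i j, P i j s].
Proof.
move=> H.
have := @filter_forall T ('I_m * 'I_n)%type (fun ij => P ij.1 ij.2) F FF (fun ij => H ij.1 ij.2).
by apply: filterS => s h i j; exact: (h (i, j)).
Qed.

Lemma mx_continuous m n (f : R -> 'M[R]_(m, n)) t :
  (forall i j, {for t, continuous (fun s => f s i j)}) -> {for t, continuous f}.
Proof.
move=> H; apply/cvgrPdist_lt => e e0.
have : \forall s \near t, forall i j, `|f t i j - f s i j| < e.
  by apply: near_mx => i j; have := H i j; move=> /cvgrPdist_lt/(_ _ e0).
apply: filterS => s K; rewrite [ltLHS]/Num.Def.normr/= mx_normrE; apply/bigmax_ltP.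
by split => // ij _; rewrite !mxE.
Qed.

Lemma le0_geometric (x c : R) : (forall k, x <= c * 2^-1 ^+ k) -> x <= 0.
Proof.
move=> H; apply/ler_addgt0Pl => e e0; rewrite addr0.
have [c0|c0] := leP c 0.
  by apply: le_trans (H 0%N) _; rewrite expr0 mulr1; lra.
have h1 : `|2^-1 : R| < 1 by rewrite ger0_norm ?invr_ge0// invf_lt1// ltr1n.
have ec0 : 0 < e / c by rewrite divr_gt0.
have := cvg_expr h1; move=> /cvgrPdist_lt/(_ _ ec0)[N _ HN].
have := HN N (leqnn N); rewrite /= sub0r normrN ger0_norm ?exprn_ge0 ?invr_ge0// => HN'.
apply: le_trans (H N) _; rewrite mulrC -ler_pdivlMr//; exact: ltW.
Qed.

(** * Picard iteration for linear systems *)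

Section Picard.
Variables (n : nat) (B : R -> 'M[R]_n) (r K : R).
Hypotheses (cB : continuous B) (r0 : 0 < r) (BK : forall t i j, `|B t i j| <= K).
Hypothesis (rK : n%:R * K * r <= 2^-1).

(** [G] is the Picard iterate of [g]: the primitive of [B g] with value [1] at [0], frozen outside
    the interval of radius [r]. The bound [- (r + 1)] leaves a margin that makes the endpoint [- r]
    interior. *)
Definition picard_step (g G : R -> 'M[R]_n) := exists F : R -> 'M[R]_n,
  [/\ F 0 = 1%:M, forall t, G t = F (clamp r t) &
   forall t : R, - (r + 1) < t -> forall i j, is_derive t 1 (fun s => F s i j) ((B t *m g t) i j)].

Lemma picard_step_ex g : continuous g ->
  exists G, picard_step g G /\ continuous G.
Proof.
move=> cg; have ra : - (r + 1) < 0 by rewrite oppr_lt0 addr_gt0.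
have cBg : continuous (fun t => B t *m g t).
  move=> t; apply: (@continuous_comp _ _ _ (fun t => (B t, g t)) (fun p => p.1 *m p.2)).
    by apply: continuous_pair; [exact: cB|exact: cg].
  exact: mulmx_cont.
have [F F0 dF] := antiderivative_mx cBg ra.
have dF1 (t : R) : - (r + 1) < t -> forall i j,
    is_derive t 1 (fun s : R => (F s + 1%:M) i j) ((B t *m g t) i j).
  move=> rt i j; have H := dF t rt i j.
  rewrite (_ : (fun s => _) = (fun s => F s i j) \+ cst ((1%:M : 'M[R]_n) i j)); last first.
    by apply: funext => s; rewrite mxE.
  by rewrite -[(B t *m g t) i j]addr0; exact: is_deriveD.
exists (fun t => F (clamp r t) + 1%:M); split.
  by exists (fun t => F t + 1%:M); split => //; rewrite F0 add0r.
move=> t; apply: mx_continuous => i j.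
apply: (@continuous_comp _ _ _ (clamp r) (fun s => (F s + 1%:M) i j)).
  exact: clamp_cont.
have /andP[rt _] := clampP t r0.
have [|dd _] := dF1 (clamp r t) _ i j; first by lra.
by apply: differentiable_continuous; apply/derivable1_diffP.
Qed.

(** A product of matrices of size [n] multiplies an entrywise bound by [n K], and integration
    multiplies it by [r]; hence [rK] gives a contraction of ratio [1/2]. *)
Lemma picard_step_bound g g' G G' C : picard_step g G -> picard_step g' G' ->
  (forall t i j, `|g t i j - g' t i j| <= C) ->
  forall t i j, `|G t i j - G' t i j| <= C / 2.
Proof.
move=> [F [F0 GF dF]] [F' [F'0 GF' dF']] gC t i j; rewrite GF GF'.
have K0 : 0 <= K by apply: le_trans (BK 0 i j).
have C0 : 0 <= C by apply: le_trans (gC 0 i j).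
apply: (@le_trans _ _ (n%:R * K * C * r)); last first.
  by rewrite mulrAC [leRHS]mulrC; apply: ler_wpM2r.
apply: (@primitive_bound (fun s => F s i j - F' s i j)
  (fun s => (B s *m g s) i j - (B s *m g' s) i j)) (clampP t r0).
- by rewrite F0 F'0 subrr.
- move=> s /andP[rs _]; have rs' : - (r + 1) < s by lra.
  by have := dF s rs' i j; have := dF' s rs' i j => h1 h2; exact: is_deriveB.
- move=> s _; rewrite !mxE -sumrB; apply: (le_trans (ler_norm_sum _ _ _)).
  apply: (@le_trans _ _ (\sum_(k < n) K * C)).
    by apply: ler_sum => k _; rewrite -mulrBr normrM ler_pM.
  by rewrite sumr_const card_ord -[_ *+ n]mulr_natl mulrA.
Qed.

Lemma picard_fixpoint : exists2 g, continuous g & picard_step g g.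
Proof.
have /choice[N HN] : forall g, exists G, continuous g -> picard_step g G /\ continuous G.
  (* A default value off the continuous functions makes the step a total function, which can be
     iterated. *)
  move=> g; have [cg|ncg] := pselect (continuous g); last by exists g.
  by have [G HG] := picard_step_ex cg; exists G.
pose g k := iter k N (cst 0).
have cg k : continuous (g k).
  elim: k => [|k IH]; first exact: cst_continuous.
  by have [] := HN _ IH.
have sg k : picard_step (g k) (g k.+1) by have [] := HN _ (cg k).
(* The zero function is sent to the constant identity; so the first iterate is known and the first
   increment has entries at most [1]. *)
have s01 : picard_step (cst 0) (cst 1%:M).
  exists (cst 1%:M); split => // t _ i j.
  have -> : (B t *m cst 0 t) i j = 0 by rewrite /cst mulmx0 mxE.
  exact: is_derive_cst.
pose I1 : 'M[R]_n := 1%:M.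
have g1 : forall t i j, g 1%N t i j = I1 i j.
  move=> t i j.
  have s00 t1 i1 j1 : `|g 0%N t1 i1 j1 - (cst 0 : R -> 'M[R]_n) t1 i1 j1| <= 0.
    by rewrite /g/= subrr normr0.
  have := picard_step_bound (sg 0%N) s01 s00 t i j.
  by rewrite mul0r normr_le0 subr_eq0 => /eqP.
have gd k t i j : `|g k.+1 t i j - g k t i j| <= 2^-1 ^+ k.
  elim: k t i j => [|k IH] t i j.
    rewrite g1 /g/= /cst [X in _ - X]mxE subr0 expr0 /I1 mxE.
    by case: (i == j); rewrite /= ?mulr1n ?mulr0n ?normr1 ?normr0.
  by rewrite exprSr; apply: (picard_step_bound (sg k.+1) (sg k)).
have /choice[l Hl] : forall p : R * 'I_n * 'I_n, exists l,
    forall k, `|g k p.1.1 p.1.2 p.2 - l| <= 2 * 2^-1 ^+ k.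
  by move=> p; apply: geometric_limit => k; exact: gd.
pose G t := \matrix_(i, j) l (t, i, j).
have HG k t i j : `|g k t i j - G t i j| <= 2 * 2^-1 ^+ k.
  by rewrite mxE; exact: (Hl (t, i, j)).
have cG : continuous G.
  move=> t; apply: mx_continuous => i j; apply/cvgrPdist_le => e e0.
  have [k Hk] : exists k, 2 * 2^-1 ^+ k <= e / 3 :> R.
    apply: contrapT => /forallNP H.
    suff : e / 6 <= 0 by rewrite pmulr_lle0// leNgt e0.
    apply: (@le0_geometric _ 1) => k; have /negP := H k; rewrite -ltNge; lra.
  have cgk : {for t, continuous (fun s => g k s i j)}.
    by apply: (@continuous_comp _ _ _ (g k) (fun A => A i j)); [exact: cg|exact: coord_continuous].
  have e3 : 0 < e / 3 by rewrite divr_gt0.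
  have := cgk; move=> /cvgrPdist_le/(_ _ e3); apply: filterS => s hs.
  have h1 := le_trans (HG k t i j) Hk; have h2 := le_trans (HG k s i j) Hk.
  apply: (le_trans (ler_distD (g k t i j) _ _)); rewrite distrC.
  apply: (@le_trans _ _ (e / 3 + (e / 3 + e / 3))); last by lra.
  rewrite lerD//; apply: (le_trans (ler_distD (g k s i j) _ _)); rewrite lerD//.
have [sG _] := HN _ cG.
(* Both [N G] and [G] are limits of the iterates with geometric error, [N G] by the contraction
   bound. *)
suff E : N G = G by exists G => //; rewrite E in sG.
apply: funext => t; apply/matrixP => i j; apply/eqP; rewrite -subr_eq0 -normr_le0.
apply: (@le0_geometric _ 2) => k.
apply: (le_trans (ler_distD (g k.+1 t i j) _ _)).
have h1 := HG k.+1 t i j; rewrite exprS in h1.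
have h2 := @picard_step_bound _ _ _ _ (2 * 2^-1 ^+ k) (sg k) sG (HG k) t i j.
rewrite distrC in h2; lra.
Qed.

End Picard.

Lemma linear_ode n (B : R -> 'M[R]_n) : smooth_near 0 B ->
  exists (A : set R) (g : R -> 'M[R]_n), [/\ open A, A 0, g 0 = 1%:M, smooth_on A g &
    forall t, A t -> 'D_1 g t = B t *m g t].
Proof.
move=> sB.
(* [K] exceeds the absolute value of every entry of [B 0] by at least one, so it bounds the entries
   near [0] by continuity. *)
pose K := \sum_(ij : 'I_n * 'I_n) (`|B 0 ij.1 ij.2| + 1).
have K0 : 0 <= K by apply: sumr_ge0 => ij _; rewrite addr_ge0.
have [d d0 HB] : exists2 d : R, 0 < d & forall t, `|t| < d ->
    smooth_near t B /\ forall i j, `|B t i j| <= K.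
  have nB : \forall t \near (0 : R), forall i j, `|B t i j| <= K.
    apply: near_mx => i j.
    have := smooth_near_cont (smooth_near_coord i j sB).
    move=> /cvgrPdist_le/(_ _ ltr01); apply: filterS => t h.
    apply: (@le_trans _ _ (`|B 0 i j| + 1)).
      by have := ler_distD (B 0 i j) (B t i j) 0; rewrite !subr0 distrC; lra.
    rewrite /K (bigD1 (i, j))//= lerDl; apply: sumr_ge0 => ij _.
    by rewrite addr_ge0.
  have [d /= d0 Hd] := (nbhs_ballP (0 : R) _).1 (filterI (smooth_near_nbhs sB) nB).
  by exists d => // t td; have [|h1 h2] := Hd t; first by rewrite /ball/= sub0r normrN.
(* The first term stays where [B] is smooth and bounded by [K], the second gives the contraction;
   its [+ 1] avoids a division by zero. *)
pose r := Num.min (d / 2) (2^-1 / (n%:R * K + 1)).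
have nK0 : 0 < n%:R * K + 1 by rewrite ltr_pwDr// mulr_ge0.
have r0 : 0 < r by rewrite lt_min !divr_gt0// invr_gt0.
have rd : r < d by rewrite gt_min ltr_pdivrMr// ltr_pMr// ltr1n.
have rK : n%:R * K * r <= 2^-1.
  have : r <= 2^-1 / (n%:R * K + 1) by rewrite ge_min lexx orbT.
  rewrite ler_pdivlMr// => h; apply: le_trans h; rewrite mulrDr mulr1 mulrC.
  by rewrite lerDl ltW.
pose Bt t := B (clamp r t).
have cl t : `|clamp r t| < d.
  by apply: le_lt_trans rd; rewrite ler_norml; exact: clampP.
have cBt : continuous Bt.
  move=> t; apply: (@continuous_comp _ _ _ (clamp r) B); first exact: clamp_cont.
  by have [/smooth_near_cont] := HB _ (cl t).
have [g cg [F [F0 gF dF]]] := @picard_fixpoint n Bt r K cBt r0 (fun t => (HB _ (cl t)).2) rK.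
pose A : set R := [set t | - r < t < r].
have oA : open A.
  rewrite (_ : A = `]- r, r[%classic); first exact: interval_open.
  by apply/seteqP; split => t /=; rewrite in_itv.
have gFA t : A t -> g t = F t.
  by move=> /andP[h1 h2]; rewrite gF clamp_id// !ltW.
have gFn t : A t -> \forall s \near t, F s = g s.
  by move=> At; apply: filterS (open_nbhs_nbhs (conj oA At)) => s /gFA.
have dFt t : A t -> derivable F t 1.
  move=> /andP[h1 h2]; apply/derivable_mxP => i j.
  by have [] := dF t _ i j => //; lra.
have dg t : A t -> differentiable g t.
  by move=> At; apply: near_eq_differentiable (gFn _ At) _; apply/derivable1_diffP; exact: dFt.
have Dg t : A t -> 'D_1 g t = B t *m g t.
  move=> At; rewrite -(near_eq_derive _ (gFn _ At)) (derive_mx (dFt _ At)).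
  apply/matrixP => i j; rewrite mxE; case/andP: (At) => h1 h2.
  have [|_ ->] := dF t _ i j; first by lra.
  by rewrite /Bt clamp_id// !ltW.
have A0 : A 0 by rewrite /A/= oppr_lt0 r0.
have sBA : smooth_on A B.
  apply: smooth_onP => t /andP[h1 h2]; have [] // := HB t.
  by rewrite ltr_norml; apply/andP; split; lra.
exists A, g; split => //; first by rewrite gFA.
(* Regularity bootstraps: if [g] has order [k], so does its derivative [B g]. *)
elim=> [|k IH]; first by move=> t /dg/differentiable_continuous.
split=> // v; apply: (@Ck_on_ext _ _ _ _ _ (fun t => v *: (B t *m g t))) => //.
  move=> t At; rewrite -Dg// (deriveE _ (dg _ At)) (deriveE _ (dg _ At)).
  by rewrite -linearZ/= scaler1.
apply: (@Ck_on_bil _ _ _ _ _ (@scaleb R 'M[R]_n) (@scale_cont R 'M[R]_n)) => //.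
  have : smooth_on A (cst v : R -> R) by apply: smooth_onP => y _; exact: smooth_near_cst.
  exact.
exact: Ck_on_mulmx.
Qed.

(* A parallel endomorphism is g J h, where g' = - G g and h = g^-1. *)
Lemma parallel_ode n (G : R -> 'M[R]_n) (J : 'M[R]_n) :
  smooth_near 0 G -> J *m J = - 1%:M ->
  exists (A : set R) (j : R -> 'M[R]_n), [/\ open A, A 0, j 0 = J, smooth_on A j &
    forall t, A t -> j t *m j t = - 1%:M /\ 'D_1 j t + (G t *m j t - j t *m G t) = 0].
Proof.
move=> sG JJ.
have [A [g [oA A0 g0 sg Dg]]] := linear_ode (smooth_nearN sG).
(* In [h' = h G] the unknown stands on the left; transposition brings the equation to the form of
   [linear_ode]. *)
have sGT : smooth_near 0 (fun t => (G t)^T).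
  apply: smooth_near_mx => i k; apply: smooth_near_eq => [y|]; first exact: mxE.
  exact: smooth_near_coord.
have [A' [hT [oA' A'0 hT0 shT DhT]]] := linear_ode sGT.
have [A2 [oA2 A20 sG2]] := sG.
pose C := A `&` (A' `&` A2).
have nC t : C t -> [/\ smooth_near t g, smooth_near t hT & smooth_near t G].
  by move=> [At [A't A2t]]; split; [exists A|exists A'|exists A2].
pose h t := (hT t)^T.
have sh t : smooth_near t hT -> smooth_near t h.
  move=> s; apply: smooth_near_mx => i k; apply: smooth_near_eq => [y|]; first exact: mxE.
  exact: smooth_near_coord.
have oC : open C by apply: openI => //; exact: openI.
have Dh t : C t -> 'D_1 h t = h t *m G t.
  move=> Ct; have [_ sht _] := nC _ Ct.
  apply/matrixP => i k; rewrite -derive_entry; last exact: smooth_near_diff (sh _ sht).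
  rewrite (_ : (fun y => _) = (fun y => hT y k i)); last first.
    by apply: funext => y; rewrite mxE.
  rewrite derive_entry; last exact: smooth_near_diff.
  case: Ct => _ [A't _]; rewrite DhT// !mxE.
  by apply: eq_bigr => l _; rewrite !mxE mulrC.
have Dg' t : C t -> 'D_1 g t = - G t *m g t by case => At _; rewrite Dg.
pose j t := g t *m J *m h t.
have dgh t : C t -> differentiable g t /\ differentiable h t.
  by move=> /nC[s1 /sh s2 _]; split; exact: smooth_near_diff.
have [e e0 He] : exists2 e : R, 0 < e & forall t, `|t| < e -> C t.
  have C0 : nbhs (0 : R) C by apply: open_nbhs_nbhs; split.
  have [e /= e0 He] := (nbhs_ballP (0 : R) C).1 C0.
  by exists e => // t te; apply: He; rewrite /ball/= sub0r normrN.
(* The derivative of [h g] is [h G g - h G g = 0], so the value [1] at [0] persists. *)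
have hg1 t : `|t| < e -> h t *m g t = 1%:M.
  move=> te; have h01 : h 0 *m g 0 = 1%:M by rewrite /h hT0 g0 trmx1 mulmx1.
  have D0 s : C s -> 'D_1 (fun s => h s *m g s) s = 0.
    move=> Cs; have [dgs dhs] := dgh _ Cs.
    by rewrite derive_mulmx// Dh// Dg'// mulNmx mulmxN mulmxA subrr.
  rewrite -h01; apply/matrixP => i k; apply/eqP; rewrite -subr_eq0 -normr_le0.
  pose r := `|t|.
  have rC s : - r <= s <= r -> C s.
    by move=> sr; apply: He; apply: le_lt_trans te; rewrite ler_norml.
  rewrite -[leRHS](mul0r r).
  apply: (@primitive_bound (fun s => (h s *m g s) i k - (h 0 *m g 0) i k) (fun=> 0)).
  - by rewrite subrr.
  - move=> s /rC Cs; have [dgs dhs] := dgh _ Cs.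
    have dhg : differentiable (fun s => h s *m g s) s by exact: differentiable_mulmx.
    have d1 : is_derive s 1 (fun s => (h s *m g s) i k) 0.
      split; first by apply: diff_derivable; exact: differentiable_entry.
      by rewrite derive_entry// D0// mxE.
    by rewrite -[X in is_derive _ _ _ X](subr0 0); exact: (@is_deriveB _ _ _ _ (cst _)).
  - by move=> s _; rewrite normr0.
  - by rewrite -ler_norml.
pose I : set R := [set t | `|t| < e].
have oI : open I.
  rewrite (_ : I = `]- e, e[%classic); first exact: interval_open.
  by apply/seteqP; split => t; rewrite /I/= in_itv/= ltr_norml.
exists I, j; split => //.
- by rewrite /I/= normr0.
- by rewrite /j /h hT0 g0 trmx1 mulmx1 mul1mx.
- apply: smooth_onP => t /He/nC[s1 /sh s2 _]; apply: smooth_near_mulmx => //.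
  by apply: smooth_near_mulmx => //; exact: smooth_near_cst.
- move=> t It; have Ct := He _ It; split.
    have := hg1 _ It; rewrite /j => hg; have gh := mulmx1C hg.
    rewrite -!mulmxA [h t *m _]mulmxA hg mul1mx [J *m (J *m _)]mulmxA JJ.
    by rewrite mulNmx mul1mx mulmxN gh.
  have [dgt dht] := dgh _ Ct.
  have dJ : differentiable (fun _ : R => J) t by exact: differentiable_cst.
  rewrite derive_mulmx//; last exact: differentiable_mulmx.
  rewrite derive_mulmx// (derive_cst J) mulmx0 addr0 Dh// Dg'//.
  rewrite /j !mulNmx !mulmxA.
  move: (G t *m g t *m J *m h t) (g t *m J *m h t *m G t) => a b.
  by rewrite [- a + b]addrC -opprB addNr.
Qed.

End LinearODE.

(** * Bump functions *)

Section Bump.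
Context {R : realType}.

(** The powers of [1/t] are carried along because the derivative of a member of the family is a
    combination of two later members. *)
Definition flat (n : nat) (t : R) : R :=
  if 0 < t then t^-1 ^+ n * expR (- t^-1) else 0.

(** Comes from [exp u >= u^(n+2) / (n+2)!] at [u = 1/t]. The two spare powers of [t] make the
    difference quotient at [0] tend to zero. *)
Lemma flat_bound n t : 0 <= t -> 0 <= flat n t <= (n.+2)`!%:R * t ^+ 2.
Proof.
move=> t0; rewrite /flat; case: ifPn => [{}t0|_]; last first.
  by rewrite lexx mulr_ge0// exprn_ge0.
have u0 : 0 < t^-1 by rewrite invr_gt0.
rewrite mulr_ge0 ?exprn_ge0 ?(ltW u0) ?(ltW (expR_gt0 _))//=.
have f0 : 0 < (n.+2)`!%:R :> R by rewrite ltr0n fact_gt0.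
have h : t^-1 ^+ n.+2 <= (n.+2)`!%:R * expR t^-1.
  rewrite mulrC -ler_pdivrMr//; apply: le_trans (expR_ge1Dxn n.+1 (ltW u0)).
  by rewrite lerDr.
rewrite expRN ler_pdivrMr ?expR_gt0// mulrAC.
have -> : t^-1 ^+ n = t^-1 ^+ n.+2 * t ^+ 2.
  rewrite -addn2 exprD -mulrA -exprMn mulVf ?gt_eqF// expr1n mulr1//.
by rewrite ler_pM2r// exprn_gt0.
Qed.

Lemma flat_gt0 n t : 0 < t -> 0 < flat n t.
Proof. by move=> t0; rewrite /flat t0 mulr_gt0 ?exprn_gt0 ?invr_gt0 ?expR_gt0. Qed.

Lemma flat_le0 n t : t <= 0 -> flat n t = 0.
Proof. by move=> t0; rewrite /flat ltNge t0. Qed.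

Lemma flat_ge0 n t : 0 <= flat n t.
Proof.
by have [/flat_le0->|/(flat_gt0 n)/ltW] := leP t 0.
Qed.

Lemma is_derive_flat n (t : R) :
  is_derive t 1 (flat n) (flat n.+2 t - n%:R * flat n.+1 t).
Proof.
have [t0|t0|->] := ltgtP t 0.
- rewrite !flat_le0 ?ltW// mulr0 subr0.
  have H : \forall s \near t, cst 0 s = flat n s.
    by near=> s; rewrite flat_le0// ltW//; near: s; exact: lt_nbhsl.
  exact: near_eq_is_derive H (is_derive_cst _ _ _).
- have tn0 : t != 0 by rewrite gt_eqF.
  have dinv : is_derive t 1 (fun s : R => s^-1) (- t ^- 2).
    split; first exact: derivableV.
    by rewrite deriveV// derive_id scaler1.
  have dphi (u : R) : is_derive u 1 (fun u => u ^+ n * expR (- u))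
      (u ^+ n * - expR (- u) + n%:R * u ^+ n.-1 * expR (- u)).
    have d1 : is_derive u 1 (fun u : R => u ^+ n) (n%:R * u ^+ n.-1).
      by split; [exact: exprn_derivable|rewrite exp_derive /GRing.scale/= mulr1].
    have d2 : is_derive u 1 (fun u : R => expR (- u)) (- expR (- u)).
      rewrite -mulrN1; exact: (is_derive1_comp (is_derive_expR (- u)) (is_deriveNid u 1)).
    have := is_deriveM d1 d2.
    by rewrite /GRing.scale/= [X in is_derive _ _ _ (_ + X)]mulrC.
  have := is_derive1_comp (dphi t^-1) dinv.
  rewrite (_ : _ * - t ^- 2 = flat n.+2 t - n%:R * flat n.+1 t); last first.
    rewrite /flat t0 -exprVn; case: n {dphi} => [|n] /=.
      by rewrite !expr0 !mul0r addr0; ring.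
    by rewrite !exprS; ring.
  apply: near_eq_is_derive.
  near=> s; rewrite /flat/= ifT//; near: s; exact: lt_nbhsr.
- rewrite !flat_le0// mulr0 subr0.
  have H : (h^-1 *: ((flat n \o shift 0) (h *: 1) - flat n 0)) @[h --> 0^'] --> (0 : R).
    apply/cvgrPdist_le => e e0.
    have C0 : 0 < (n.+2)`!%:R :> R by rewrite ltr0n fact_gt0.
    near=> h; have h0 : h != 0 by near: h; exact: nbhs_dnbhs_neq.
    rewrite sub0r normrN /= addr0 [flat n 0]flat_le0// subr0 /GRing.scale/= mulr1.
    have [hle|hgt] := leP h 0; first by rewrite flat_le0// mulr0 normr0 ltW.
    have /andP[f0 fle] := flat_bound n (ltW hgt).
    rewrite normrM (ger0_norm f0) gtr0_norm ?invr_gt0// ler_pdivrMl//.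
    apply: (le_trans fle); rewrite expr2 mulrCA ler_pM2l// mulrC -ler_pdivlMr//.
    rewrite -(gtr0_norm hgt); near: h; apply: dnbhs0_le; exact: divr_gt0.
  by split; [apply/cvg_ex; exists 0|exact/cvg_lim].
Unshelve. all: by end_near. Qed.

Lemma smooth_near_flat n t : smooth_near t (flat n).
Proof.
exists setT; split => //; first exact: openT.
move=> k; elim: k n => [|k IH] n.
  move=> s _; apply: differentiable_continuous; apply/derivable1_diffP.
  by have [] := is_derive_flat n s.
have df (s : R) : differentiable (flat n) s.
  by apply/derivable1_diffP; have [] := is_derive_flat n s.
split=> // v.
have C (c : R) : Ck_on k setT (cst c : R -> R).
  have : smooth_on setT (cst c : R -> R) by apply: smooth_onP => y _; exact: smooth_near_cst.
  exact.
apply: (@Ck_on_ext _ _ _ _ _ (fun s => v *: (flat n.+2 s + (- n%:R) *: flat n.+1 s))).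
- exact: openT.
- move=> s _; rewrite (deriveE _ (df s)) -[X in 'd _ _ X]mulr1 -[v * 1]/(v *: 1).
  rewrite linearZ/= -(deriveE _ (df s)); congr (_ *: _).
  by have [_ ->] := is_derive_flat n s; rewrite scaleNr.
apply: (@Ck_on_bil _ _ _ _ _ (@scaleb R R) (@scale_cont R R)) => //; first exact: openT.
  exact: C.
apply: Ck_onD; [exact: openT|exact: IH|].
apply: (@Ck_on_bil _ _ _ _ _ (@scaleb R R) (@scale_cont R R)) => //; first exact: openT.
exact: C.
Qed.

Lemma Ck_on_inv k (V : normedModType R) (A : set V) (f : V -> R) : open A ->
  (forall y, A y -> f y != 0) -> Ck_on k A f -> Ck_on k A (fun y => (f y)^-1).
Proof.
move=> oA f0; elim: k => [|k IH].
  by move=> cf y Ay; apply: continuousV; [exact: f0|exact: cf].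
move=> Cf; have [df Df] := Cf; have Ck := IH (Ck_onS Cf).
split=> [y Ay|v]; first by apply: differentiableV; [exact: df|exact: f0].
apply: (@Ck_on_ext _ _ _ _ _ (fun y => (- 1 : R) *: ((f y)^-1 *: ((f y)^-1 *: 'D_v f y)))) => //.
  move=> y Ay; rewrite (@deriveV _ _ f)//; last 2 first.
  - exact: f0.
  - by apply: diff_derivable; exact: df.
  by rewrite /GRing.scale/= -exprVn mulN1r mulNr expr2 mulrA.
have C1 : Ck_on k A (cst (- 1 : R) : V -> R).
  have : smooth_on A (cst (- 1 : R) : V -> R) by apply: smooth_onP => y _; exact: smooth_near_cst.
  exact.
have Z g h := @Ck_on_bil _ V _ _ _ (@scaleb R R) (@scale_cont R R) k A g h oA.
exact: (Z _ _ C1 (Z _ _ Ck (Z _ _ Ck (Df v)))).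
Qed.

Lemma smooth_near_inv (V : normedModType R) (x : V) (f : V -> R) :
  f x != 0 -> smooth_near x f -> smooth_near x (fun y => (f y)^-1).
Proof.
move=> fx0 sf; have cf := smooth_near_cont sf; have [A [oA Ax sA]] := sf.
have : nbhs x [set y | f y != 0].
  have := cf; move=> /cvgrPdist_lt/(_ `|f x|); rewrite normr_gt0 => /(_ fx0).
  by apply: filterS => y; apply: contraTneq => ->; rewrite subr0 ltxx.
rewrite nbhsE /= => -[B [oB Bx] B0]; exists (A `&` B); split => //.
  exact: openI.
move=> k; apply: Ck_on_inv; first exact: openI.
  by move=> y [_ /B0].
by apply: Ck_on_sub (sA k) => y [].
Qed.

Definition smooth_step (t : R) : R := flat 0 t / (flat 0 t + flat 0 (1 - t)).

Lemma smooth_step_den t : flat 0 t + flat 0 (1 - t) != 0.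
Proof.
apply: lt0r_neq0; have [t0|t0] := leP t 0.
  by apply: ltr_wpDl; [exact: flat_ge0|apply: flat_gt0; lra].
by apply: ltr_pwDl; [exact: flat_gt0|exact: flat_ge0].
Qed.

Lemma smooth_step_smooth t : smooth_near t smooth_step.
Proof.
apply: smooth_nearM; first exact: smooth_near_flat.
apply: smooth_near_inv; first exact: smooth_step_den.
apply: smooth_nearD; first exact: smooth_near_flat.
apply: (@smooth_near_comp _ _ _ _ t (fun t => 1 - t) (flat 0)).
  by apply: smooth_nearB; [exact: smooth_near_cst|exact: smooth_near_id].
exact: smooth_near_flat.
Qed.

Lemma smooth_step_le0 t : t <= 0 -> smooth_step t = 0.
Proof. by move=> t0; rewrite /smooth_step (flat_le0 0 t0) mul0r. Qed.

Lemma smooth_step_ge1 t : 1 <= t -> smooth_step t = 1.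
Proof.
move=> t1; have t0 : 1 - t <= 0 by lra.
have := smooth_step_den t; rewrite /smooth_step (flat_le0 0 t0) addr0 => h.
exact: divff.
Qed.

Lemma bump m n (a : 'M[R]_(m, n)) (d : R) : 0 < d ->
  exists b : 'M[R]_(m, n) -> R, [/\ forall z, smooth_near z b,
    exists2 V, open V /\ V a & forall z, V z -> b z = 1 &
    forall z, b z != 0 -> forall i j, `|z i j - a i j| <= d].
Proof.
move=> d0.
(* A sum of squares replaces the norm, which is not smooth. With [c = 2 / d^2] the argument
   [2 - c q] is at least [1] for [q <= d^2 / 2] and at most [0] for [q >= d^2]. *)
pose q (z : 'M[R]_(m, n)) := \sum_(ij : 'I_m * 'I_n) (z ij.1 ij.2 - a ij.1 ij.2) ^+ 2.
pose c : R := 2 / d ^+ 2.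
have c0 : 0 < c by rewrite divr_gt0// exprn_gt0.
have sq z : smooth_near z (fun z => c * q z).
  apply: smooth_nearM; first exact: smooth_near_cst.
  apply: smooth_near_sum => ij _.
  apply: smooth_near_eq => [y|]; first exact: expr2.
  apply: smooth_nearM; apply: smooth_nearB; try exact: smooth_near_cst;
    by apply: smooth_near_coord; exact: smooth_near_id.
exists (fun z => smooth_step (2 - c * q z)); split.
- move=> z; apply: (@smooth_near_comp _ _ _ _ z (fun z => 2 - c * q z) smooth_step).
    by apply: smooth_nearB => //; exact: smooth_near_cst.
  exact: smooth_step_smooth.
- exists [set z | c * q z < 1]; last first.
    by move=> z /= qz; apply: smooth_step_ge1; lra.
  split; last by rewrite /= /q big1 ?mulr0// => ij _; rewrite subrr expr0n.
  rewrite openE => z /= qz; have := smooth_near_cont (sq z).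
  have e0 : 0 < 1 - c * q z by lra.
  move=> /cvgrPdist_lt/(_ _ e0); rewrite /interior; apply: filterS => y /=.
  by rewrite ltr_distl => /andP[h1 h2]; lra.
- move=> z; have [h|h _ i j] := leP 2 (c * q z).
    by rewrite smooth_step_le0 ?eqxx//; lra.
  have h2 : (z i j - a i j) ^+ 2 <= q z.
    rewrite /q (bigD1 (i, j))//= lerDl; apply: sumr_ge0 => ij _; exact: sqr_ge0.
  have h3 : q z < d ^+ 2.
    by move: h; rewrite /c mulrAC ltr_pdivrMr ?exprn_gt0// ltr_pM2l.
  have := le_lt_trans h2 h3; rewrite -real_normK ?num_real// ltr_pXn2r ?nnegrE//; last exact: ltW.
  exact: ltW.
Qed.

Lemma compact_box n (a : 'cV[R]_n) (d : R) :
  compact [set z : 'cV[R]_n | forall i j, `|z i j - a i j| <= d].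
Proof.
pose A (i : 'I_n) := `[a i 0 - d, a i 0 + d]%classic.
have cA : compact [set v : 'rV[R]_n | forall i, A i (v ord0 i)].
  by apply: rV_compact => i; exact: segment_compact.
have ct : continuous (fun v : 'rV[R]_n => v^T : 'cV[R]_n).
  apply: linear_findim_continuous => u x y; exact: linearP.
rewrite (_ : [set z | _] = (fun v : 'rV[R]_n => v^T) @` [set v : 'rV[R]_n | forall i, A i (v ord0 i)]).
  apply: continuous_compact => //; exact: continuous_subspaceT.
apply/seteqP; split => z /=.
  move=> H; exists z^T; last by rewrite trmxK.
  by move=> i; rewrite /A/= in_itv/= mxE -ler_distl.
move=> [v Hv <-] i j; rewrite mxE ord1.
by have := Hv i; rewrite /A/= in_itv/= -ler_distl.
Qed.

End Bump.

(** * Charts and vector fields *)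

Section Atlas.
Context {R : realType} {V : normedModType R} {fV : findim V} (X : charted V).
Implicit Types (c : chart X V) (x : X) (W : set X) (Y Z : X -> V).
Notation coord := (coord (X := X)).
Notation vect := (vect (X := X)).
Notation field_rep := (field_rep (X := X)).

(** What the calculus of fields and brackets needs of an atlas. It is verified for the manifold and
    for the total space of End(N), which is used through its charts only. *)
Record good_atlas : Prop := GoodAtlas {
  ga_can : forall c, catlas c -> forall x, cdom c x -> cof c (c x) = x;
  ga_open : forall c c', catlas c -> catlas c' ->
    open (c @` (cdom c `&` cdom c'));
  ga_smooth : forall c c', catlas c -> catlas c' ->
    smooth_on (c @` (cdom c `&` cdom c')) (c' \o cof c);
  ga_pchart : forall x, catlas (pchart x) /\ cdom (pchart x) x }.

Definition transition c c' : V -> V := c' \o cof c.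
Notation tr := transition.

Hypothesis hX : good_atlas.

Lemma catlas_pchart x : catlas (pchart x). Proof. by have [] := ga_pchart hX x. Qed.
Lemma cdom_pchart x : cdom (pchart x) x. Proof. by have [] := ga_pchart hX x. Qed.

Lemma near_chart c c' x : catlas c -> catlas c' -> cdom c x -> cdom c' x ->
  \forall z \near c x, [/\ cdom c (cof c z), cdom c' (cof c z) & c (cof c z) = z].
Proof.
move=> hc hc' cx c'x.
have D : nbhs (c x) (c @` (cdom c `&` cdom c')).
  by apply: open_nbhs_nbhs; split; [exact: ga_open|exists x].
by apply: filterS D => _ [y [cy c'y] <-]; rewrite (ga_can hX hc cy).
Qed.

Lemma near_chart_open W c x : chart_open W -> catlas c -> W x -> cdom c x ->
  \forall z \near c x, [/\ W (cof c z), cdom c (cof c z) & c (cof c z) = z].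
Proof.
move=> oW hc Wx cx.
have D : nbhs (c x) (c @` (W `&` cdom c)).
  by apply: open_nbhs_nbhs; split; [exact: oW|exists x].
by apply: filterS D => _ [y [Wy cy] <-]; rewrite (ga_can hX hc cy).
Qed.

Lemma tr_smooth c c' x : catlas c -> catlas c' -> cdom c x -> cdom c' x ->
  smooth_near (c x) (tr c c').
Proof.
move=> hc hc' cx c'x; exists (c @` (cdom c `&` cdom c')); split.
- exact: ga_open.
- by exists x.
- exact: ga_smooth.
Qed.

Lemma tr_diff c c' x : catlas c -> catlas c' -> cdom c x -> cdom c' x ->
  differentiable (tr c c') (c x).
Proof. by move=> hc hc' cx c'x; apply: smooth_near_diff; exact: tr_smooth. Qed.

Lemma tr_at c c' x : catlas c -> cdom c x -> tr c c' (c x) = c' x.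
Proof. by move=> hc cx; rewrite /tr/= (ga_can hX hc cx). Qed.

Lemma tr_comp c c' c'' x v : catlas c -> catlas c' -> catlas c'' ->
  cdom c x -> cdom c' x -> cdom c'' x ->
  'D_v (tr c c'') (c x) = 'D_('D_v (tr c c') (c x)) (tr c' c'') (c' x).
Proof.
move=> h h' h'' cx c'x c''x.
rewrite -(tr_at c' h cx) -(derive_comp v (tr_diff h h' cx c'x)); last first.
  by rewrite tr_at//; exact: tr_diff.
apply: near_eq_derive; apply: filterS (near_chart h h' cx c'x) => z [c1 c2 c3].
by rewrite /tr/= (ga_can hX h' c2).
Qed.

Lemma tr_id c x v : catlas c -> cdom c x -> 'D_v (tr c c) (c x) = v.
Proof.
move=> h cx; rewrite -[RHS](derive_id (c x) v); apply: near_eq_derive.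
by apply: filterS (near_chart h h cx cx) => z [_ _].
Qed.

Lemma coordE c x v : catlas c -> cdom c x ->
  coord c x v = 'D_v (tr (pchart x) c) (pchart x x).
Proof.
move=> h cx; rewrite deriveE//.
by apply: tr_diff => //; [exact: catlas_pchart|exact: cdom_pchart].
Qed.

Lemma vectE c x a : catlas c -> cdom c x ->
  vect c x a = 'D_a (tr c (pchart x)) (c x).
Proof.
move=> h cx; rewrite deriveE//.
by apply: tr_diff => //; [exact: catlas_pchart|exact: cdom_pchart].
Qed.

Lemma coord_linear c x : linear (coord c x).
Proof. by move=> a u v; rewrite /Defs.coord linearP. Qed.

Lemma vect_linear c x : linear (vect c x).
Proof. by move=> a u v; rewrite /Defs.vect linearP. Qed.

Lemma coord_chg c c' x v : catlas c -> catlas c' -> cdom c x -> cdom c' x ->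
  coord c' x v = 'D_(coord c x v) (tr c c') (c x).
Proof.
move=> h h' cx c'x; rewrite !coordE//.
by apply: tr_comp => //; [exact: catlas_pchart|exact: cdom_pchart].
Qed.

Lemma coord_pchart x v : coord (pchart x) x v = v.
Proof.
have [h hx] := ga_pchart hX x; rewrite coordE//; exact: tr_id.
Qed.

Lemma coordK c x v : catlas c -> cdom c x -> vect c x (coord c x v) = v.
Proof.
move=> h cx; have [hp px] := ga_pchart hX x.
by rewrite vectE// coordE// -tr_comp// tr_id.
Qed.

Lemma vectK c x a : catlas c -> cdom c x -> coord c x (vect c x a) = a.
Proof.
move=> h cx; have [hp px] := ga_pchart hX x.
by rewrite vectE// coordE// -tr_comp// tr_id.
Qed.

Lemma field_rep_at c Y x : catlas c -> cdom c x ->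
  field_rep c Y (c x) = coord c x (Y x).
Proof. by move=> h cx; rewrite /Defs.field_rep (ga_can hX h cx). Qed.

Lemma field_rep_chg c c' Y x : catlas c -> catlas c' -> cdom c x -> cdom c' x ->
  \forall z \near c' x,
    field_rep c' Y z = 'D_(field_rep c Y (tr c' c z)) (tr c c') (tr c' c z).
Proof.
move=> h h' cx c'x; apply: filterS (near_chart h' h c'x cx) => z [c1 c2 c3].
by rewrite /tr/= field_rep_at// -coord_chg.
Qed.

Lemma smooth_rep_chg c c' Y x : catlas c -> catlas c' -> cdom c x -> cdom c' x ->
  smooth_near (c x) (field_rep c Y) -> smooth_near (c' x) (field_rep c' Y).
Proof.
move=> h h' cx c'x sY.
have st := tr_smooth h' h c'x cx; have ta := tr_at c h' c'x.
apply: (@smooth_near_ext _ _ _ _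
    (fun z => 'D_(field_rep c Y (tr c' c z)) (tr c c') (tr c' c z))).
  by apply: filterS (field_rep_chg Y h h' cx c'x) => z ->.
apply: (@smooth_near_comp _ _ _ _ _ (tr c' c) (fun z => 'D_(field_rep c Y z) (tr c c') z)) => //.
rewrite ta; apply: smooth_near_Dvar => //; exact: tr_smooth.
Qed.

Lemma smooth_fieldI W Y :
  (forall x, W x -> exists c, [/\ catlas c, cdom c x & smooth_near (c x) (field_rep c Y)]) ->
  smooth_field W Y.
Proof.
move=> H c' h'; apply: smooth_onP => _ [x [Wx c'x] <-].
by have [c [h cx sc]] := H _ Wx; exact: (smooth_rep_chg h h' cx c'x).
Qed.

Lemma smooth_field_near W Y c x : chart_open W -> smooth_field W Y ->
  catlas c -> W x -> cdom c x -> smooth_near (c x) (field_rep c Y).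
Proof.
move=> oW sY h Wx cx; exists (c @` (W `&` cdom c)); split.
- exact: oW.
- by exists x.
- exact: sY.
Qed.

Lemma smooth_mapI (U : normedModType R) W (f : X -> U) :
  (forall x, W x -> exists c, [/\ catlas c, cdom c x & smooth_near (c x) (f \o cof c)]) ->
  smooth_map W f.
Proof.
move=> H c' h'; apply: smooth_onP => _ [x [Wx c'x] <-].
have [c [h cx sc]] := H _ Wx.
apply: (@smooth_near_ext _ _ _ _ (fun z => (f \o cof c) (tr c' c z))).
  apply: filterS (near_chart h' h c'x cx) => z [c1 c2 c3].
  by rewrite /tr/= (ga_can hX h c2).
apply: (@smooth_near_comp _ _ _ _ _ (tr c' c) (f \o cof c)) => //.
  exact: tr_smooth.
by rewrite tr_at.
Qed.

Lemma smooth_map_near (U : normedModType R) W (f : X -> U) c x :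
  chart_open W -> smooth_map W f ->
  catlas c -> W x -> cdom c x -> smooth_near (c x) (f \o cof c).
Proof.
move=> oW sY h Wx cx; exists (c @` (W `&` cdom c)); split.
- exact: oW.
- by exists x.
- exact: sY.
Qed.

Lemma derive_rep_chg c c' (U : normedModType R) (f : V -> U) x v :
  catlas c -> catlas c' -> cdom c x -> cdom c' x -> differentiable f (c x) ->
  'D_v (fun z => f (tr c' c z)) (c' x) = 'D_('D_v (tr c' c) (c' x)) f (c x).
Proof.
move=> h h' cx c'x df; rewrite -(tr_at c h' c'x).
by apply: derive_comp; [exact: tr_diff|rewrite tr_at].
Qed.

Lemma dmap_coord (U : normedModType R) (f : X -> U) c x v : catlas c -> cdom c x ->
  smooth_near (c x) (f \o cof c) -> dmap f x v = 'D_(coord c x v) (f \o cof c) (c x).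
Proof.
move=> h cx sf; have [hp px] := ga_pchart hX x; rewrite /dmap.
have N : \forall z \near pchart x x, (f \o cof c) (tr (pchart x) c z) = (f \o cof (pchart x)) z.
  apply: filterS (near_chart hp h px cx) => z [c1 c2 c3].
  by rewrite /tr/= (ga_can hX h c2).
have sfc : smooth_near (tr (pchart x) c (pchart x x)) (f \o cof c) by rewrite tr_at.
have sfp : smooth_near (pchart x x) (fun z => (f \o cof c) (tr (pchart x) c z)).
  by apply: (@smooth_near_comp _ _ _ _ _ (tr (pchart x) c)) => //; exact: tr_smooth.
have dfp : differentiable (f \o cof (pchart x)) (pchart x x).
  by apply: near_eq_differentiable N _; exact: smooth_near_diff.
rewrite -(deriveE _ dfp) -(near_eq_derive _ N) coordE//.
by rewrite derive_rep_chg//; exact: smooth_near_diff.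
Qed.

(** The bracket is defined through preferred charts, which vary with the point. In another chart the
    additional terms are second derivatives of the transition map, and cancel by symmetry; so one
    chart computes the bracket on a whole neighborhood. *)
Lemma lie_coord c Y Z x : catlas c -> cdom c x ->
  smooth_near (c x) (field_rep c Y) -> smooth_near (c x) (field_rep c Z) ->
  coord c x (lie Y Z x) =
    'D_(field_rep c Y (c x)) (field_rep c Z) (c x) -
    'D_(field_rep c Z (c x)) (field_rep c Y) (c x).
Proof.
move=> h cx sY sZ; have [hp px] := ga_pchart hX x.
set p := pchart x in hp px *.
(* The representatives in the preferred chart, pushed to c. *)
have D Y1 Z1 : smooth_near (c x) (field_rep c Y1) -> smooth_near (c x) (field_rep c Z1) ->
    'D_('D_(field_rep p Y1 (p x)) (field_rep p Z1) (p x)) (tr p c) (p x)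
    = 'D_(field_rep c Y1 (c x)) (field_rep c Z1) (c x)
      - 'D_(field_rep p Y1 (p x)) (fun y => 'D_(field_rep p Z1 (p x)) (tr p c) y) (p x).
  move=> s1 s2.
  have s2p := smooth_rep_chg h hp cx px s2.
  have E := derive_Dvar (field_rep p Y1 (p x)) fV (tr_smooth hp h px cx) (smooth_near_diff s2p).
  rewrite -[LHS](addrK ('D_(field_rep p Y1 (p x)) (fun y => 'D_(field_rep p Z1 (p x)) (tr p c) y) (p x))).
  rewrite -E; congr (_ - _).
  have N : \forall z \near p x,
      'D_(field_rep p Z1 z) (tr p c) z = field_rep c Z1 (tr p c z).
    apply: filterS (near_chart hp h px cx) => z [c1 c2 c3].
    by rewrite -{1 2}c3 field_rep_at// -coord_chg// /tr/= field_rep_at.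
  rewrite (near_eq_derive _ N) derive_rep_chg//; last exact: smooth_near_diff.
  have <- : 'D_(field_rep p Y1 (p x)) (tr p c) (p x) = field_rep c Y1 (c x).
    by rewrite field_rep_at// field_rep_at// -coord_chg.
  by [].
rewrite (coord_chg _ hp h)// coord_pchart /lie -/p.
have dt := tr_diff hp h px cx.
rewrite (deriveE _ dt) linearB/= -!(deriveE _ dt) !D//.
rewrite (schwarz _ _ fV (tr_smooth hp h px cx)).
by rewrite opprB addrA subrK.
Qed.

Lemma smooth_lie W Y Z : chart_open W -> smooth_field W Y -> smooth_field W Z ->
  smooth_field W (lie Y Z).
Proof.
move=> oW sY sZ; apply: smooth_fieldI => x Wx; have [h cx] := ga_pchart hX x.
exists (pchart x); split => //; set c := pchart x in h cx *.
have rY y : W y -> cdom c y -> smooth_near (c y) (field_rep c Y).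
  by move=> *; apply: smooth_field_near sY _ _ _.
have rZ y : W y -> cdom c y -> smooth_near (c y) (field_rep c Z).
  by move=> *; apply: smooth_field_near sZ _ _ _.
apply: (@smooth_near_ext _ _ _ _ (fun z => 'D_(field_rep c Y z) (field_rep c Z) z -
    'D_(field_rep c Z z) (field_rep c Y) z)).
  apply: filterS (near_chart_open oW h Wx cx) => z [W1 c1 c2].
  by rewrite -[in RHS]c2 field_rep_at// lie_coord ?c2// -[in smooth_near _ _]c2; auto.
by apply: smooth_nearB; apply: smooth_near_Dvar => //; auto.
Qed.

Lemma chart_openI W W' : chart_open W -> chart_open W' -> chart_open (W `&` W').
Proof.
move=> oW oW' c h.
rewrite (_ : _ @` _ = (c @` (W `&` cdom c)) `&` (c @` (W' `&` cdom c))).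
  by apply: openI; [exact: oW|exact: oW'].
apply/seteqP; split=> [_ [x [[Wx W'x] cx] <-]|z [[x [Wx cx] <-] [y [W'y cy] E]]].
  by split; exists x.
have xy : y = x by rewrite -(ga_can hX h cx) -E (ga_can hX h cy).
by exists x => //; split => //; split => //; rewrite -xy.
Qed.

Lemma chart_open_pre c (B : set V) : catlas c -> open B ->
  chart_open [set x | cdom c x /\ B (c x)].
Proof.
move=> h oB c' h'; rewrite openE => _ [x [[cx Bx] c'x] <-].
have := smooth_near_cont (tr_smooth h' h c'x cx).
rewrite /interior => ct; near=> z.
have [c1 c2 c3] : [/\ cdom c' (cof c' z), cdom c (cof c' z) & c' (cof c' z) = z].
  by near: z; exact: (near_chart h' h c'x cx).
exists (cof c' z) => //; split => //; split => //.
rewrite -[c _]/(tr c' c z); near: z.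
by apply: ct; apply: open_nbhs_nbhs; split => //; rewrite tr_at.
Unshelve. all: by end_near. Qed.

Lemma chart_open_cdom c : catlas c -> chart_open (cdom c).
Proof.
move=> h c' h'; rewrite setIC; exact: ga_open.
Qed.

(** Source of test fields, mostly with constant components: through them the abstract conditions
    become equations between components. *)
Definition mkfield c (f : V -> V) x : V := vect c x (f (c x)).

Lemma field_rep_mkfield c f x : catlas c -> cdom c x ->
  \forall z \near c x, field_rep c (mkfield c f) z = f z.
Proof.
move=> h cx; apply: filterS (near_chart h h cx cx) => z [c1 _ c3].
by rewrite -c3 field_rep_at// vectK.
Qed.

Lemma smooth_mkfield_near c f x : catlas c -> cdom c x -> smooth_near (c x) f ->
  smooth_near (c x) (field_rep c (mkfield c f)).
Proof.
move=> h cx; apply: smooth_near_ext.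
by apply: filterS (field_rep_mkfield f h cx) => z ->.
Qed.

Lemma smooth_mkfield c f W : catlas c -> W `<=` cdom c ->
  (forall x, W x -> smooth_near (c x) f) -> smooth_field W (mkfield c f).
Proof.
move=> h Wc sf; apply: smooth_fieldI => x Wx; exists c; split => //; first exact: Wc.
by apply: smooth_mkfield_near => //; [exact: Wc|exact: sf].
Qed.

End Atlas.

(** * Normal components in adapted charts *)

Section Foliated.
Context {R : realType} {p m : nat} (M : foliated_manifold R p m).
Notation E := 'cV[R]_(p + m).
Notation N := 'cV[R]_m.
Notation X := (manifold M).
Notation coord := (coord (X := X)).
Notation vect := (vect (X := X)).
Notation field_rep := (field_rep (X := X)).
Notation tr := (@transition R E X).
Implicit Types (c : chart M E) (x : M) (U : set M) (s t : M -> N).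

Lemma open_chart_open U : open U -> chart_open (X := X) U.
Proof.
move=> oU c hc; have [od oim cc _ cof_c] := fm_chart hc.
rewrite openE => _ [x [Ux cx] <-].
have := open_nbhs_nbhs (conj oim (ex_intro2 _ _ x cx erefl : (c @` cdom c) (c x))).
have cU := cof_c (c x) (ex_intro2 _ _ x cx erefl).
have : nbhs (cof c (c x)) U by rewrite cc//; exact: open_nbhs_nbhs.
move=> /cU; rewrite /interior => H1 H2; near=> z.
have [y cy yz] : (c @` cdom c) z by near: z.
exists y => //; split => //; rewrite -(cc _ cy) yz; near: z; exact: H1.
Unshelve. all: by end_near. Qed.

Lemma manifold_good : good_atlas X.
Proof.
split.
- by move=> c /fm_chart[].
- move=> c c' hc hc'; rewrite setIC.
  by have [od _ _ _ _] := fm_chart hc'; exact: (open_chart_open od hc).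
- by move=> c c' hc hc'; have [] := fm_transition hc hc'.
- by move=> x; have [h1 h2] := projT2 (cid (fm_cover x)).
Qed.

Let hX := manifold_good.

Lemma open_cdom c : fm_atlas c -> open (cdom c).
Proof. by move=> /fm_chart[]. Qed.

Lemma open_pre c (B : set E) : fm_atlas c -> open B ->
  open [set x | cdom c x /\ B (c x)].
Proof.
move=> hc oB; have [od _ _ cc _] := fm_chart hc.
rewrite openE => x [cx Bx]; rewrite /interior /=.
have h1 : nbhs x (cdom c) by exact: open_nbhs_nbhs.
have h2 : nbhs x (c @^-1` B) by apply: (cc x cx); exact: open_nbhs_nbhs.
by apply: filterS2 h1 h2.
Qed.

Lemma near_open c x U : fm_atlas c -> open U -> U x -> cdom c x ->
  \forall z \near c x, [/\ U (cof c z), cdom c (cof c z) & c (cof c z) = z].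
Proof. by move=> hc oU Ux cx; exact: (near_chart_open hX (open_chart_open oU) hc Ux cx). Qed.

Lemma pi_N_linear : linear (@pi_N R p m).
Proof. by move=> a u v; rewrite /pi_N linearP. Qed.

Lemma pi_NB u v : pi_N (u - v) = @pi_N R p m u - pi_N v.
Proof. by rewrite /pi_N linearB. Qed.

Lemma pi_NN u : pi_N (- u) = - @pi_N R p m u.
Proof. by rewrite /pi_N linearN. Qed.

Lemma pi_ND u v : pi_N (u + v) = @pi_N R p m u + pi_N v.
Proof. by rewrite /pi_N linearD. Qed.

(** A linear section of [pi_N]; its choice is immaterial for linear maps that vanish in leaf
    directions, see [linear_nE]. *)
Definition normal_lift (w : N) : E := col_mx 0 w.
Notation nE := normal_lift.

Lemma nE_linear : linear nE.
Proof. by move=> a u v; rewrite /nE scale_col_mx add_col_mx scaler0 addr0. Qed.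

Lemma pi_nE w : pi_N (nE w) = w. Proof. by rewrite /pi_N /nE col_mxKd. Qed.

Lemma pi_sub_nE v : pi_N (v - nE (pi_N v)) = 0.
Proof. by rewrite pi_NB pi_nE subrr. Qed.

Lemma tr_F c c' x v : fm_atlas c -> fm_atlas c' -> cdom c x -> cdom c' x ->
  pi_N v = 0 -> pi_N ('D_v (tr c c') (c x)) = 0.
Proof.
move=> h h' cx c'x v0; have [_ /(_ (c x) v) H] := fm_transition h h'.
rewrite deriveE; last exact: (tr_diff hX).
by apply: H => //; exists x.
Qed.

Lemma pi_lin_eq (l : E -> E) u v : linear l ->
  (forall a, pi_N a = 0 -> pi_N (l a) = 0) -> pi_N u = pi_N v -> pi_N (l u) = pi_N (l v).
Proof.
move=> ll lF uv; pose L : {linear E -> E} := HB.pack l (GRing.isLinear.Build _ _ _ _ _ ll).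
have : pi_N (l (u - v)) = 0.
  by apply: lF; rewrite pi_NB uv subrr.
rewrite -[l _]/(L _) linearB /pi_N linearB/= => /eqP; rewrite subr_eq0 => /eqP; exact.
Qed.

Lemma coord_F c x v : fm_atlas c -> cdom c x -> pi_N v = 0 -> pi_N (coord c x v) = 0.
Proof.
move=> h cx; have [hp px] := ga_pchart hX x.
by rewrite (coordE hX)//; exact: tr_F.
Qed.

Lemma vect_F c x v : fm_atlas c -> cdom c x -> pi_N v = 0 -> pi_N (vect c x v) = 0.
Proof.
move=> h cx; have [hp px] := ga_pchart hX x.
by rewrite (vectE hX)//; exact: tr_F.
Qed.

(* Sealed versions: unification must not unfold the differentials. *)
Fact ncd_sig : {f : chart M E -> M -> N -> N | f = @ncoord R p m M}.
Proof. by exists (@ncoord R p m M). Qed.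
Definition ncd := sval ncd_sig.
Lemma ncdE : @ncoord R p m M = ncd. Proof. by rewrite /ncd (svalP ncd_sig). Qed.

Lemma pi_coord c x v : fm_atlas c -> cdom c x -> pi_N (coord c x v) = ncd c x (pi_N v).
Proof.
move=> h cx; rewrite -ncdE; apply: pi_lin_eq; first exact: coord_linear.
  by move=> a; exact: coord_F.
by rewrite -/(nE _) pi_nE.
Qed.

Fact nvect_sig : {f : chart M E -> M -> N -> N | f = fun c x w => pi_N (vect c x (nE w))}.
Proof. by exists (fun c x w => pi_N (vect c x (nE w))). Qed.
Definition nvect := sval nvect_sig.
Lemma nvectE c x w : nvect c x w = pi_N (vect c x (nE w)).
Proof. by rewrite /nvect (svalP nvect_sig). Qed.

Lemma pi_vect c x v : fm_atlas c -> cdom c x -> pi_N (vect c x v) = nvect c x (pi_N v).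
Proof.
move=> h cx; rewrite nvectE; apply: pi_lin_eq; first exact: vect_linear.
  by move=> a; exact: vect_F.
by rewrite pi_nE.
Qed.

Lemma ncd_linear c x : linear (ncd c x).
Proof.
move=> a u v; rewrite -ncdE /ncoord -!/(nE _) nE_linear.
by rewrite (@coord_linear R E X c x) pi_N_linear.
Qed.

Lemma nvect_linear c x : linear (nvect c x).
Proof.
move=> a u v; rewrite !nvectE nE_linear.
by rewrite (@vect_linear R E X c x) pi_N_linear.
Qed.

Lemma ncdK c x w : fm_atlas c -> cdom c x -> nvect c x (ncd c x w) = w.
Proof.
move=> h cx; rewrite -ncdE /ncoord -/(nE _) -pi_vect//.
by rewrite (coordK hX)// pi_nE.
Qed.

Lemma nvectK c x w : fm_atlas c -> cdom c x -> ncd c x (nvect c x w) = w.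
Proof.
move=> h cx; rewrite nvectE -pi_coord//.
by rewrite (vectK hX)// pi_nE.
Qed.

Lemma ncd_pchart x w : ncd (pchart (c := X) x) x w = w.
Proof. by rewrite -ncdE /ncoord -/(nE _) (coord_pchart hX) pi_nE. Qed.

Lemma linear_mx (l : N -> N) w : linear l -> \matrix_(i, j) l (delta_mx j 0) i 0 *m w = l w.
Proof.
move=> ll; pose L : {linear N -> N} := HB.pack l (GRing.isLinear.Build _ _ _ _ _ ll).
have wE : w = \sum_j w j 0 *: delta_mx j 0.
  rewrite {1}[w]matrix_sum_delta; apply: eq_bigr => j _.
  by rewrite big_ord1.
rewrite -[RHS]/(L w) [in RHS]wE linear_sum; apply/colP => i.
rewrite mxE summxE; apply: eq_bigr => j _.
by rewrite linearZ/= !mxE mulrC.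
Qed.

Lemma mx_eq (A B : 'M[R]_m) : (forall w : N, A *m w = B *m w) -> A = B.
Proof.
move=> H; apply/matrixP => i j; have := H (delta_mx j 0); rewrite -!colE.
by move=> /matrixP/(_ i 0); rewrite !mxE.
Qed.

Fact nfr_sig : {f : chart M E -> M -> 'M[R]_m | f = @nframe R p m M}.
Proof. by exists (@nframe R p m M). Qed.
Definition nfr := sval nfr_sig.
Lemma nfrE : @nframe R p m M = nfr. Proof. by rewrite /nfr (svalP nfr_sig). Qed.

Lemma nfr_mul c x w : nfr c x *m w = ncd c x w.
Proof. by rewrite -nfrE /nframe ncdE; apply: linear_mx; exact: ncd_linear. Qed.

(** The inverse frame, written through [nvect] so that it can be computed with; on the domain of the
    chart it agrees with [invmx]. *)
Fact nfrV_sig : {f : chart M E -> M -> 'M[R]_m |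
  f = fun c x => \matrix_(i, j) nvect c x (delta_mx j 0) i 0}.
Proof. by eexists. Qed.
Definition nfrV := sval nfrV_sig.

Lemma nfrV_mul c x w : nfrV c x *m w = nvect c x w.
Proof. by rewrite /nfrV (svalP nfrV_sig); apply: linear_mx; exact: nvect_linear. Qed.

Lemma nfrK c x : fm_atlas c -> cdom c x -> nfrV c x *m nfr c x = 1%:M.
Proof.
by move=> h cx; apply: mx_eq => w; rewrite -mulmxA nfr_mul nfrV_mul ncdK// mul1mx.
Qed.

Lemma nfrVK c x : fm_atlas c -> cdom c x -> nfr c x *m nfrV c x = 1%:M.
Proof. by move=> h cx; apply: mulmx1C; exact: nfrK. Qed.

Lemma invmx_nfr c x : fm_atlas c -> cdom c x -> invmx (nfr c x) = nfrV c x.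
Proof.
move=> h cx; have [_ u] := mulmx1_unit (nfrK h cx).
by rewrite -[RHS](mulmxK u) nfrK// mul1mx.
Qed.

Lemma nfr_pchart x : nfr (pchart (c := X) x) x = 1%:M.
Proof. by apply: mx_eq => w; rewrite nfr_mul ncd_pchart mul1mx. Qed.

(** The normal block of the Jacobian of a transition map, that is, the transition matrix of the
    normal bundle. *)
Fact ntr_sig : {f : chart M E -> chart M E -> E -> 'M[R]_m |
  f = fun c c' z => \matrix_(i, j) pi_N ('D_(nE (delta_mx j 0)) (tr c c') z) i 0}.
Proof. by eexists. Qed.
Definition ntr := sval ntr_sig.
Lemma ntrE c c' z : ntr c c' z =
  \matrix_(i, j) pi_N ('D_(nE (delta_mx j 0)) (tr c c') z) i 0.
Proof. by rewrite /ntr (svalP ntr_sig). Qed.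

Section Transition.
Variables (c c' : chart M E) (x : M).
Hypotheses (h : fm_atlas c) (h' : fm_atlas c') (cx : cdom c x) (c'x : cdom c' x).

Lemma pi_D v : pi_N ('D_v (tr c c') (c x)) = ntr c c' (c x) *m pi_N v.
Proof.
have dt := tr_diff hX h h' cx c'x.
pose l w := pi_N ('D_(nE w) (tr c c') (c x)).
have ll : linear l.
  by move=> a u w; rewrite /l nE_linear !deriveE// linearP pi_N_linear.
rewrite ntrE (linear_mx _ ll) /l; apply: (@pi_lin_eq (fun v => 'D_v (tr c c') (c x))).
- by move=> a u w; rewrite !deriveE// linearP.
- by move=> a; exact: tr_F.
- by rewrite pi_nE.
Qed.

Lemma ncd_chg w : ncd c' x w = ntr c c' (c x) *m ncd c x w.
Proof.
by rewrite -[in LHS](pi_nE w) -pi_coord// (coord_chg hX _ h h')// pi_D pi_coord// pi_nE.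
Qed.

Lemma nfr_chg : nfr c' x = ntr c c' (c x) *m nfr c x.
Proof. by apply: mx_eq => w; rewrite -mulmxA !nfr_mul ncd_chg. Qed.

Lemma ntr_smooth : smooth_near (c x) (ntr c c').
Proof.
apply: smooth_near_mx => i j.
apply: (@smooth_near_eq _ _ _ _
  (fun z => pi_N ('D_(nE (delta_mx j 0)) (tr c c') z) i 0)) => [y|].
  by rewrite ntrE mxE.
apply: smooth_near_coord; apply: smooth_near_linear; first exact: pi_N_linear.
by apply: smooth_near_D; exact: (tr_smooth hX).
Qed.

End Transition.

Lemma ntr_near c c' x : fm_atlas c -> fm_atlas c' -> cdom c x -> cdom c' x -> forall v,
  \forall z \near c x, pi_N ('D_v (tr c c') z) = ntr c c' z *m pi_N v.
Proof.
move=> h h' cx c'x v; apply: filterS (near_chart hX h h' cx c'x) => z [c1 c2 c3].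
by rewrite -c3; exact: pi_D.
Qed.

Lemma ntr_inv c c' x : fm_atlas c -> fm_atlas c' -> cdom c x -> cdom c' x ->
  ntr c' c (c' x) *m ntr c c' (c x) = 1%:M.
Proof.
move=> h h' cx c'x; apply: mx_eq => w; rewrite -mulmxA.
rewrite -[w]pi_nE -pi_D// -pi_D// -(tr_comp hX)//.
by rewrite (tr_id hX)// pi_nE mul1mx.
Qed.

(** Differentiating a Jacobian gives second derivatives, which are symmetric. This symmetry is what
    makes the torsion of a connection a tensor. *)
Lemma ntr_sym c c' x v w : fm_atlas c -> fm_atlas c' -> cdom c x -> cdom c' x ->
  'D_v (ntr c c') (c x) *m pi_N w = 'D_w (ntr c c') (c x) *m pi_N v.
Proof.
move=> h h' cx c'x.
have H u u' : 'D_u (ntr c c') (c x) *m pi_N u' = pi_N ('D_u (fun z => 'D_u' (tr c c') z) (c x)).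
  rewrite -derive_linear; last 2 first.
  - exact: pi_N_linear.
  - by apply: smooth_near_diff; apply: smooth_near_D; exact: (tr_smooth hX).
  rewrite (near_eq_derive _ (ntr_near h h' cx c'x u')).
  rewrite derive_mulmx; last 2 first.
  - by apply: smooth_near_diff; exact: ntr_smooth.
  - exact: differentiable_cst.
  by rewrite (derive_cst (pi_N u')) mulmx0 addr0.
have S := @schwarz R E E (tr c c') (c x) v w _ (tr_smooth hX h h' cx c'x).
by rewrite (H v w) (H w v); apply: congr1; exact: S.
Qed.

Definition section_rep c s (z : E) : N := ncd c (cof c z) (s (cof c z)).
Notation sec_rep := section_rep.

Lemma sec_rep_at c s x : fm_atlas c -> cdom c x -> sec_rep c s (c x) = ncd c x (s x).
Proof. by move=> h cx; rewrite /sec_rep (ga_can hX h cx). Qed.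

Lemma sec_rep_chg c c' s x : fm_atlas c -> fm_atlas c' -> cdom c x -> cdom c' x ->
  \forall z \near c' x, sec_rep c' s z = ntr c c' (tr c' c z) *m sec_rep c s (tr c' c z).
Proof.
move=> h h' cx c'x; apply: filterS (near_chart hX h' h c'x cx) => z [c1 c2 c3].
by rewrite /tr/= sec_rep_at// -ncd_chg.
Qed.

Lemma smooth_sec_chg c c' s x : fm_atlas c -> fm_atlas c' -> cdom c x -> cdom c' x ->
  smooth_near (c x) (sec_rep c s) -> smooth_near (c' x) (sec_rep c' s).
Proof.
move=> h h' cx c'x ss.
have st := tr_smooth hX h' h c'x cx; have ta := tr_at hX c h' c'x.
apply: (@smooth_near_ext _ _ _ _
    (fun z => ntr c c' (tr c' c z) *m sec_rep c s (tr c' c z))).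
  by apply: filterS (sec_rep_chg s h h' cx c'x) => z ->.
apply: (@smooth_near_comp _ _ _ _ _ (tr c' c) (fun z => ntr c c' z *m sec_rep c s z)) => //.
by rewrite ta; apply: smooth_near_mulmx => //; exact: ntr_smooth.
Qed.

Lemma smooth_sectionI U s :
  (forall x, U x -> exists c, [/\ fm_atlas c, cdom c x & smooth_near (c x) (sec_rep c s)]) ->
  smooth_section U s.
Proof.
move=> H c' h'; apply: smooth_onP => _ [x [Ux c'x] <-].
have [c [h cx sc]] := H _ Ux.
by have := smooth_sec_chg h h' cx c'x sc; rewrite /sec_rep -ncdE.
Qed.

Lemma smooth_section_near U s c x : open U -> smooth_section U s ->
  fm_atlas c -> U x -> cdom c x -> smooth_near (c x) (sec_rep c s).
Proof.
move=> oU ss h Ux cx; exists (c @` (U `&` cdom c)); split.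
- exact: open_chart_open.
- by exists x.
- by rewrite /sec_rep -ncdE; exact: ss.
Qed.

Lemma smooth_section_sub U U' s : U' `<=` U -> smooth_section U s -> smooth_section U' s.
Proof.
move=> UU ss c h k; apply: Ck_on_sub (ss c h k) => _ [x [/UU Ux cx] <-].
by exists x.
Qed.

Lemma vfield_sub U U' Y : U' `<=` U -> vfield U Y -> vfield (M := M) U' Y.
Proof.
move=> UU ss c h k; apply: Ck_on_sub (ss c h k) => _ [x [/UU Ux cx] <-].
by exists x.
Qed.

Lemma sec_rep_pi c Y x : fm_atlas c -> cdom c x ->
  \forall z \near c x, sec_rep c (fun y => pi_N (Y y)) z = pi_N (field_rep c Y z).
Proof.
move=> h cx; apply: filterS (near_chart hX h h cx cx) => z [c1 _ c3].
by rewrite -c3 sec_rep_at// (field_rep_at hX)// pi_coord.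
Qed.

Lemma smooth_section_pi U Y : open U -> vfield U Y -> smooth_section U (fun y => pi_N (Y y)).
Proof.
move=> oU sY; apply: smooth_sectionI => x Ux; have [h cx] := ga_pchart hX x.
exists (pchart (c := X) x); split => //.
apply: (@smooth_near_ext _ _ _ _ (fun z => pi_N (field_rep (pchart (c := X) x) Y z))).
  by apply: filterS (sec_rep_pi Y h cx) => z ->.
apply: smooth_near_linear; first exact: pi_N_linear.
by apply: (smooth_field_near _ sY) => //; exact: open_chart_open.
Qed.

(** If [Z] is tangent to the leaves, the normal part of [[Y, Z]] is, up to sign, the derivative
    along [Z] of the normal components of [Y]: the normal components of [Z] vanish identically. *)
Lemma foliated_fieldI c U Y : fm_atlas c -> open U -> U `<=` cdom c -> vfield U Y ->
  (forall x a, U x -> pi_N a = 0 -> pi_N ('D_a (field_rep c Y) (c x)) = 0) ->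
  foliated_field U Y.
Proof.
move=> h oU Uc sY HY; split => // U' Z oU' UU' [sZ FZ].
have co' := open_chart_open oU'.
have sY' := vfield_sub UU' sY; split; first exact: (smooth_lie hX).
move=> x U'x; have Ux := UU' _ U'x; have cx := Uc _ Ux.
have sYc := smooth_field_near co' sY' h U'x cx.
have sZc := smooth_field_near co' sZ h U'x cx.
rewrite /in_F -(ncdK (pi_N _) h cx) -pi_coord// (lie_coord hX)//.
have Zc0 : pi_N (field_rep c Z (c x)) = 0.
  by rewrite (field_rep_at hX)// coord_F//; exact: FZ.
have H1 : pi_N ('D_(field_rep c Y (c x)) (field_rep c Z) (c x)) = 0.
  rewrite -derive_linear; last 2 first.
  - exact: pi_N_linear.
  - exact: smooth_near_diff.
  rewrite (@near_eq_derive _ _ _ _ (cst 0)) ?derive_cst//.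
  apply: filterS (near_open h oU' U'x cx) => z [u1 c1 c2].
  by rewrite -c2 (field_rep_at hX)// coord_F//; exact: FZ.
rewrite pi_NB H1 HY// subr0.
by rewrite -nfrV_mul mulmx0.
Qed.

(** Tested on the leaf field with constant components [a], whose own derivative drops out of the
    bracket. *)
Lemma foliated_fieldE c U Y x a : fm_atlas c -> open U -> foliated_field U Y ->
  U x -> cdom c x -> pi_N a = 0 -> pi_N ('D_a (field_rep c Y) (c x)) = 0.
Proof.
move=> h oU [sY HY] Ux cx a0.
pose Z := mkfield (X := X) c (cst a).
have oU' : open (U `&` cdom c) by apply: openI => //; exact: open_cdom.
have sZ : vfield (U `&` cdom c) Z.
  by apply: (smooth_mkfield hX h) => [y []//|y _]; exact: smooth_near_cst.
have FZ : leaf_field (U `&` cdom c) Z.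
  by split => // y [Uy cy]; apply: vect_F.
have [_ /(_ x (conj Ux cx))] := HY _ _ oU' (@subIsetl _ _ _) FZ.
have co := open_chart_open oU; have co' := open_chart_open oU'.
have sYc := smooth_field_near co sY h Ux cx.
have sZc := smooth_field_near co' sZ h (conj Ux cx) cx.
move=> /(coord_F h cx); rewrite (lie_coord hX)//.
have rZ := field_rep_mkfield hX (cst a) h cx.
rewrite (near_eq_derive _ rZ) derive_cst (nbhs_singleton rZ) sub0r.
by rewrite pi_NN => /eqP; rewrite oppr_eq0 => /eqP.
Qed.

Lemma foliated_sectionI U s : open U ->
  (forall x, U x -> exists c, [/\ fm_atlas c, cdom c x, smooth_near (c x) (sec_rep c s) &
     \forall z \near c x, forall a, pi_N a = 0 -> 'D_a (sec_rep c s) z = 0]) ->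
  foliated_section U s.
Proof.
move=> oU H x Ux; have [c [h cx sc Fc]] := H _ Ux.
pose Q z := smooth_near z (sec_rep c s) /\ forall a, pi_N a = 0 -> 'D_a (sec_rep c s) z = 0.
have : nbhs (c x) Q by apply: filterS2 (smooth_near_nbhs sc) Fc.
rewrite nbhsE /= => -[B [oB Bx] BQ].
pose U' := U `&` [set y | cdom c y /\ B (c y)].
have oU' : open U' by apply: openI => //; exact: open_pre.
(* The lift of [s] without leaf components in [c]: its normal components are those of [s], hence
   constant along the leaves. *)
pose Y := mkfield (X := X) c (fun z => nE (sec_rep c s z)).
have sY : vfield U' Y.
  apply: (smooth_mkfield hX h) => [y [_ []]//|y [_ [cy /BQ[sy _]]]].
  by apply: smooth_near_linear => //; exact: nE_linear.
exists U', Y; split => //; first by move=> y [].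
  apply: (@foliated_fieldI c _ _ h oU') => // [y [_ []]//|y a [Uy [cy By]] a0].
  rewrite (near_eq_derive _ (field_rep_mkfield hX _ h cy)).
  have [sy Hy] := BQ _ By.
  rewrite derive_linear ?Hy//; last 2 first.
  - exact: nE_linear.
  - exact: smooth_near_diff.
  by rewrite pi_nE.
move=> y [Uy [cy _]]; rewrite /Y /mkfield pi_vect// pi_nE sec_rep_at//.
by rewrite ncdK.
Qed.

Lemma foliated_sectionE U s c x : open U -> foliated_section U s -> fm_atlas c ->
  U x -> cdom c x -> smooth_near (c x) (sec_rep c s) /\
  forall a, pi_N a = 0 -> 'D_a (sec_rep c s) (c x) = 0.
Proof.
move=> oU Hs h Ux cx; have [U' [Y [oU' U'x UU' FY sE]]] := Hs _ Ux.
have sY : vfield U' Y by case: FY.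
have N : \forall z \near c x, pi_N (field_rep c Y z) = sec_rep c s z.
  apply: filterS (near_open h oU' U'x cx) => z [u1 c1 c2].
  by rewrite -c2 sec_rep_at// sE// (field_rep_at hX)// pi_coord.
have sYc := smooth_field_near (open_chart_open oU') sY h U'x cx.
split=> [|a a0].
  by apply: smooth_near_ext N _; apply: smooth_near_linear => //; exact: pi_N_linear.
rewrite -(near_eq_derive _ N) derive_linear; last 2 first.
- exact: pi_N_linear.
- exact: smooth_near_diff.
by rewrite (foliated_fieldE h oU' FY).
Qed.

End Foliated.

(** * Connections on the normal bundle *)

Section Connection.
Context {R : realType} {p m : nat} (M : foliated_manifold R p m).
Notation E := 'cV[R]_(p + m).
Notation N := 'cV[R]_m.
Notation X := (manifold M).
Notation coord := (coord (X := X)).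
Notation vect := (vect (X := X)).
Notation field_rep := (field_rep (X := X)).
Notation tr := (@transition R E X).
Notation ncd := (@ncd R p m M).
Notation nvect := (@nvect R p m M).
Notation nfr := (@nfr R p m M).
Notation nfrV := (@nfrV R p m M).
Notation ntr := (@ntr R p m M).
Notation nE := (@normal_lift R p m).
Notation sec_rep := (@section_rep R p m M).
Implicit Types (c : chart M E) (x : M) (U : set M) (s t : M -> N) (D : connection_op M).

Let hX := manifold_good M.

Definition frame c (j : 'I_m) (y : M) : N := pi_N (vect c y (nE (delta_mx j 0))).

Lemma frameE c j y : frame c j y = nvect c y (delta_mx j 0).
Proof. by rewrite nvectE. Qed.

Lemma sec_rep_frame c j x : fm_atlas c -> cdom c x ->
  \forall z \near c x, sec_rep c (frame c j) z = delta_mx j 0.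
Proof.
move=> h cx; apply: filterS (near_chart hX h h cx cx) => z [c1 _ c3].
by rewrite -c3 sec_rep_at// frameE nvectK.
Qed.

Lemma smooth_frame c j U : fm_atlas c -> U `<=` cdom c -> smooth_section U (frame c j).
Proof.
move=> h Uc; apply: smooth_sectionI => x Ux; exists c; split => //; first exact: Uc.
apply: (@smooth_near_ext _ _ _ _ (cst (delta_mx j 0))); last exact: smooth_near_cst.
by apply: filterS (sec_rep_frame j h (Uc _ Ux)) => z ->.
Qed.

Lemma christoffel_col D c x a (j : 'I_m) :
  christoffel D c x a *m delta_mx j 0 = ncd c x (D (frame c j) x (vect c x a)).
Proof.
apply/colP => i; rewrite -colE mxE mxE ncdE.
by [].
Qed.

Section Ops.
Variables (U : set M) (D : connection_op M).
Hypotheses (oU : open U) (hD : is_connection U D).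

Lemma conn_linear U' s x : open U' -> U' `<=` U -> smooth_section U' s -> U' x ->
  linear (D s x).
Proof. by move=> oU' UU'; have [H _ _ _] := hD oU' UU'; exact: H. Qed.

Lemma conn_add U' s t x v : open U' -> U' `<=` U -> smooth_section U' s ->
  smooth_section U' t -> U' x -> D (fun y => s y + t y) x v = D s x v + D t x v.
Proof. by move=> oU' UU'; have [_ H _ _] := hD oU' UU'; exact: H. Qed.

Lemma conn_leibniz U' (f : M -> R) s x v : open U' -> U' `<=` U ->
  smooth_map (X := X) U' f -> smooth_section U' s -> U' x ->
  D (fun y => f y *: s y) x v = dmap (X := X) f x v *: s x + f x *: D s x v.
Proof. by move=> oU' UU'; have [_ _ H _] := hD oU' UU'; exact: H. Qed.

Lemma conn_smooth U' s Y : open U' -> U' `<=` U -> smooth_section U' s ->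
  vfield U' Y -> smooth_section U' (fun x => D s x (Y x)).
Proof. by move=> oU' UU'; have [_ _ _ H] := hD oU' UU'; exact: H. Qed.

Lemma smooth_section_zero U' : smooth_section U' (fun _ : M => 0 : N).
Proof.
apply: smooth_sectionI => x _; have [h cx] := ga_pchart hX x.
exists (pchart (c := X) x); split => //.
apply: (@smooth_near_eq _ _ _ _ (cst 0)); last exact: smooth_near_cst.
by move=> y; rewrite /section_rep -nfr_mul mulmx0.
Qed.

Lemma smooth_map_cst U' (a : R) : smooth_map (X := X) U' (cst a).
Proof.
apply: (smooth_mapI hX) => x _; have [h cx] := ga_pchart hX x.
by exists (pchart (c := X) x); split => //; exact: smooth_near_cst.
Qed.

Lemma smooth_section_ext U' s t : open U' -> (forall y, U' y -> s y = t y) ->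
  smooth_section U' s -> smooth_section U' t.
Proof.
move=> oU' st ss; apply: smooth_sectionI => x U'x; have [h cx] := ga_pchart hX x.
exists (pchart (c := X) x); split => //.
apply: smooth_near_ext (smooth_section_near oU' ss h U'x cx).
by apply: filterS (near_open h oU' U'x cx) => z [u1 _ _]; rewrite /section_rep st.
Qed.

Lemma smooth_sectionZ U' (f : M -> R) s : open U' -> smooth_map (X := X) U' f ->
  smooth_section U' s -> smooth_section U' (fun y => f y *: s y).
Proof.
move=> oU' sf ss; apply: smooth_sectionI => x U'x; have [h cx] := ga_pchart hX x.
exists (pchart (c := X) x); split => //; set c := pchart (c := X) x in h cx *.
apply: (@smooth_near_eq _ _ _ _ (fun z => (f \o cof c) z *: sec_rep c s z)).
  by move=> z; rewrite /section_rep -!nfr_mul -scalemxAr.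
apply: smooth_nearZ; last exact: (smooth_section_near oU').
exact: (smooth_map_near (open_chart_open oU') sf).
Qed.

Lemma smooth_sectionD U' s t : open U' -> smooth_section U' s ->
  smooth_section U' t -> smooth_section U' (fun y => s y + t y).
Proof.
move=> oU' ss st; apply: smooth_sectionI => x U'x; have [h cx] := ga_pchart hX x.
exists (pchart (c := X) x); split => //; set c := pchart (c := X) x in h cx *.
apply: (@smooth_near_eq _ _ _ _ (fun z => sec_rep c s z + sec_rep c t z)).
  by move=> z; rewrite /section_rep -!nfr_mul -mulmxDr.
by apply: smooth_nearD; exact: (smooth_section_near oU').
Qed.

Lemma conn_zero U' x v : open U' -> U' `<=` U -> U' x -> D (fun=> 0) x v = 0.
Proof.
move=> oU' UU' U'x.
have E1 : (fun _ : M => 0 : N) = (fun y => (cst (0 : R) y) *: (0 : N)).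
  by apply: funext => y; rewrite scaler0.
rewrite [in LHS]E1 (conn_leibniz (f := cst 0) _ oU' UU')//.
- by rewrite scaler0 add0r /cst scale0r.
- exact: smooth_map_cst.
- exact: smooth_section_zero.
Qed.

(* Multiplying by the indicator of the complement shows that D is local. *)
Lemma conn_local U' s t x v : open U' -> U' `<=` U -> smooth_section U' s ->
  smooth_section U' t -> (forall y, U' y -> s y = t y) -> U' x -> D s x v = D t x v.
Proof.
move=> oU' UU' ss st E1 U'x.
pose f y : R := if `[< U' y >] then 0 else 1.
pose u y := s y - t y.
have fu : u = (fun y => f y *: u y).
  apply: funext => y; rewrite /f; case: asboolP => [Uy|_]; last by rewrite scale1r.
  by rewrite /u E1// subrr scaler0.
have f0 y : U' y -> f y = 0 by move=> Uy; rewrite /f asboolT.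
have sf : smooth_map (X := X) U' f.
  apply: (smooth_mapI hX) => y U'y; have [h cy] := ga_pchart hX y.
  exists (pchart (c := X) y); split => //.
  apply: (@smooth_near_ext _ _ _ _ (cst 0)); last exact: smooth_near_cst.
  by apply: filterS (near_open h oU' U'y cy) => z [u1 _ _]; rewrite /= f0.
have su : smooth_section U' u.
  apply: (@smooth_section_ext _ (fun=> 0)) => //; last exact: smooth_section_zero.
  by move=> y Uy; rewrite /u E1// subrr.
have -> : s = (fun y => t y + u y) by apply: funext => y; rewrite /u addrC subrK.
rewrite (conn_add _ oU' UU')// fu (conn_leibniz _ oU' UU')// f0// scale0r addr0.
by rewrite /u E1// subrr scaler0 addr0.
Qed.

Lemma smooth_section_sum U' (I : Type) (r : seq I) (s : I -> M -> N) : open U' ->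
  (forall i, smooth_section U' (s i)) -> smooth_section U' (fun y => \sum_(i <- r) s i y).
Proof.
move=> oU' ss; elim: r => [|i r IH].
  rewrite (_ : (fun y => _) = (fun=> 0)); first exact: smooth_section_zero.
  by apply: funext => y; rewrite big_nil.
rewrite (_ : (fun y => _) = (fun y => s i y + \sum_(j <- r) s j y)).
  exact: smooth_sectionD.
by apply: funext => y; rewrite big_cons.
Qed.

Lemma conn_sum U' (I : Type) (r : seq I) (s : I -> M -> N) x v : open U' -> U' `<=` U ->
  (forall i, smooth_section U' (s i)) -> U' x ->
  D (fun y => \sum_(i <- r) s i y) x v = \sum_(i <- r) D (s i) x v.
Proof.
move=> oU' UU' ss U'x; elim: r => [|i r IH].
  rewrite big_nil (_ : (fun y => _) = (fun=> 0)).
    exact: (@conn_zero U' x v oU' UU' U'x).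
  by apply: funext => y; rewrite big_nil.
rewrite big_cons -IH (_ : (fun y => _) = (fun y => s i y + \sum_(j <- r) s j y)).
  by apply: (conn_add _ oU' UU') => //; exact: smooth_section_sum.
by apply: funext => y; rewrite big_cons.
Qed.

Lemma delta_decomp (w : N) : w = \sum_j w j 0 *: delta_mx j 0.
Proof.
rewrite {1}[w]matrix_sum_delta; apply: eq_bigr => j _.
by rewrite big_ord1.
Qed.

(** Derivative of the components plus connection matrix. The expansion of [s] in the frame holds on
    the chart only, and locality ([conn_local]) is what allows its use. *)
Lemma conn_rep U' s c x v : open U' -> U' `<=` U -> smooth_section U' s -> U' x ->
  fm_atlas c -> cdom c x ->
  ncd c x (D s x v) = 'D_(coord c x v) (sec_rep c s) (c x)
    + christoffel D c x (coord c x v) *m sec_rep c s (c x).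
Proof.
move=> oU' UU' ss U'x h cx.
pose U2 := U' `&` cdom c.
have oU2 : open U2 by apply: openI => //; exact: open_cdom.
have UU2 : U2 `<=` U by move=> y [/UU'].
have ss2 : smooth_section U2 s by apply: smooth_section_sub ss => y [].
have U2x : U2 x by [].
have ssc := smooth_section_near oU' ss h U'x cx.
pose f j y : R := (ncd c y (s y)) j 0.
have fE y : (fun j => f j y) = fun j => (ncd c y (s y)) j 0 by [].
have sfn j y : U2 y -> smooth_near (c y) (f j \o cof c).
  move=> [Uy cy]; apply: (@smooth_near_coord _ _ _ _ _ (sec_rep c s)).
  exact: (smooth_section_near oU').
have sf j : smooth_map (X := X) U2 (f j).
  by apply: (smooth_mapI hX) => y U2y; exists c; split => //; [case: U2y|exact: sfn].
have sfr j : smooth_section U2 (frame c j) by apply: smooth_frame => // y [].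
have sE y : U2 y -> s y = \sum_j f j y *: frame c j y.
  move=> [Uy cy]; rewrite -[LHS](ncdK _ h cy) -nfrV_mul [X in _ *m X]delta_decomp mulmx_sumr.
  by apply: eq_bigr => j _; rewrite -scalemxAr frameE nfrV_mul.
have sfs j : smooth_section U2 (fun y => f j y *: frame c j y) by exact: smooth_sectionZ.
rewrite (@conn_local U2 s (fun y => \sum_j f j y *: frame c j y))//; last exact: smooth_section_sum.
rewrite (@conn_sum U2)// -nfr_mul mulmx_sumr.
rewrite [X in _ + _ *m X](delta_decomp _) mulmx_sumr [X in X + _](delta_decomp _) -big_split/=.
apply: eq_bigr => j _; rewrite (conn_leibniz _ oU2 UU2)// mulmxDr -!scalemxAr !nfr_mul.
rewrite frameE nvectK// christoffel_col (coordK hX)// sec_rep_at//.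
rewrite (dmap_coord hX _ h cx); last exact: sfn.
by rewrite -derive_entry//; exact: smooth_near_diff.
Qed.

Lemma christoffel_linear c x : fm_atlas c -> U x -> cdom c x -> linear (christoffel D c x).
Proof.
move=> h Ux cx a u v; apply: mx_eq => w; rewrite (delta_decomp w) !mulmx_sumr.
apply: eq_bigr => j _; rewrite -!scalemxAr; congr (_ *: _).
rewrite mulmxDl -scalemxAl !christoffel_col -!nfr_mul scalemxAr -mulmxDr; congr (_ *m _).
rewrite vect_linear; apply: (@conn_linear (U `&` cdom c)) => //.
- by apply: openI => //; exact: open_cdom.
- by apply: smooth_frame => // y [].
Qed.

Lemma christoffel_smooth c x a : fm_atlas c -> U x -> cdom c x ->
  smooth_near (c x) (fun z => christoffel D c (cof c z) a).
Proof.
move=> h Ux cx; pose U2 := U `&` cdom c.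
have oU2 : open U2 by apply: openI => //; exact: open_cdom.
have UU2 : U2 `<=` U by move=> y [].
have sfr j : smooth_section U2 (frame c j) by apply: smooth_frame => // y [].
have sY : vfield U2 (mkfield (X := X) c (cst a)).
  by apply: (smooth_mkfield hX h) => [y []//|y _]; exact: smooth_near_cst.
apply: smooth_near_mx => i j.
have := smooth_section_near oU2 (conn_smooth oU2 UU2 (sfr j) sY) h (conj Ux cx) cx.
move=> /(smooth_near_coord i 0); apply: smooth_near_eq => z.
have -> : christoffel D c (cof c z) a i j = (christoffel D c (cof c z) a *m (delta_mx j 0 : N)) i 0.
  by rewrite -colE [RHS]mxE.
by rewrite christoffel_col.
Qed.

(** The transformation law of connection matrices, read off from [conn_rep] in [c'] for the frame of
    [c]. *)
Lemma christoffel_chg c c' x a : fm_atlas c -> fm_atlas c' -> U x -> cdom c x -> cdom c' x ->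
  christoffel D c' x ('D_a (tr c c') (c x)) *m ntr c c' (c x)
  = ntr c c' (c x) *m christoffel D c x a - 'D_a (ntr c c') (c x).
Proof.
move=> h h' Ux cx c'x; apply: mx_eq => w; rewrite (delta_decomp w) !mulmx_sumr.
apply: eq_bigr => j _; rewrite -!scalemxAr; congr (_ *: _).
pose U2 := U `&` (cdom c `&` cdom c').
have oU2 : open U2 by apply: openI => //; apply: openI; exact: open_cdom.
have UU2 : U2 `<=` U by move=> y [].
have sfr : smooth_section U2 (frame c j) by apply: smooth_frame => // y [_ []].
have U2x : U2 x by [].
have := conn_rep (vect c x a) oU2 UU2 sfr U2x h' c'x.
rewrite (coord_chg hX _ h h')// (vectK hX)// (ncd_chg h h')// -christoffel_col mulmxA.
rewrite (near_eq_derive _ (sec_rep_chg (frame c j) h h' cx c'x)).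
rewrite (nbhs_singleton (sec_rep_chg (frame c j) h h' cx c'x)) (tr_at hX)//.
rewrite (nbhs_singleton (sec_rep_frame j h cx)).
have NE : \forall z \near c' x, ntr c c' (tr c' c z) *m sec_rep c (frame c j) (tr c' c z)
    = ntr c c' (tr c' c z) *m delta_mx j 0.
  apply: filterS (near_chart hX h' h c'x cx) => z [c1 c2 c3].
  by rewrite /tr/= sec_rep_at// frameE nvectK.
rewrite (near_eq_derive _ NE).
have sn := smooth_near_diff (ntr_smooth h h' cx c'x).
rewrite (derive_rep_chg hX (f := fun z => ntr c c' z *m delta_mx j 0) _ h h')//; last first.
  by apply: differentiable_mulmx => //; exact: differentiable_cst.
have dd : differentiable (fun _ : E => delta_mx j 0 : N) (c x) by exact: differentiable_cst.
rewrite -(tr_comp hX a h h' h cx c'x cx) (tr_id hX)// (derive_mulmx _ sn dd).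
rewrite (derive_cst (delta_mx j 0 : N)) mulmx0 addr0 mulmxA mulmxBl => ->.
by rewrite addrC addKr.
Qed.

End Ops.

(** Coordinate fields commute, so an adapted connection makes the coordinate frame parallel along
    the leaves. *)
Lemma christoffel_F U D c x a : open U -> adapted_connection U D -> fm_atlas c -> U x ->
  cdom c x -> pi_N a = 0 -> christoffel D c x a = 0.
Proof.
move=> oU [hD aD] h Ux cx a0; apply: mx_eq => w; rewrite (delta_decomp w) !mulmx_sumr.
apply: eq_bigr => j _; rewrite -!scalemxAr mul0mx; congr (_ *: _).
pose U2 := U `&` cdom c.
have oU2 : open U2 by apply: openI => //; exact: open_cdom.
have UU2 : U2 `<=` U by move=> y [].
pose Y b := mkfield (X := X) c (cst b).
have sY b : vfield U2 (Y b).
  by apply: (smooth_mkfield hX h) => [y []//|y _]; exact: smooth_near_cst.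
have FY : leaf_field U2 (Y a) by split => // y [Uy cy]; exact: vect_F.
have := aD _ (Y (nE (delta_mx j 0))) (Y a) x oU2 UU2 (sY _) FY (conj Ux cx).
rewrite christoffel_col => ->; rewrite -pi_coord// (lie_coord hX h cx); last 2 first.
- exact: (smooth_field_near (open_chart_open oU2) (sY _)).
- exact: (smooth_field_near (open_chart_open oU2) (sY _)).
rewrite !(near_eq_derive _ (field_rep_mkfield hX (cst _) h cx)) !derive_cst subrr.
by rewrite -(subrr a) pi_NB subrr.
Qed.

(** Coordinate fields and the coordinate frame are foliated; [D] sends them to foliated sections,
    whose components are the columns of the connection matrix. *)
Lemma foliated_christoffel U D c x a v : open U -> foliated_connection U D ->
  fm_atlas c -> U x -> cdom c x -> pi_N a = 0 ->
  'D_a (fun z => christoffel D c (cof c z) v) (c x) = 0.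
Proof.
move=> oU [[hD aD] FD] h Ux cx a0.
have sG := christoffel_smooth oU hD v h Ux cx.
apply: mx_eq => w; rewrite (delta_decomp w) !mulmx_sumr.
apply: eq_bigr => j _; rewrite -!scalemxAr mul0mx; congr (_ *: _).
pose U2 := U `&` cdom c.
have oU2 : open U2 by apply: openI => //; exact: open_cdom.
have UU2 : U2 `<=` U by move=> y [].
have sY : vfield U2 (mkfield (X := X) c (cst v)).
  by apply: (smooth_mkfield hX h) => [y []//|y _]; exact: smooth_near_cst.
have FY : foliated_field U2 (mkfield (X := X) c (cst v)).
  apply: (foliated_fieldI h oU2) => // [y []//|y b [Uy cy] b0].
  rewrite (near_eq_derive _ (field_rep_mkfield hX (cst v) h cy)) derive_cst.
  by rewrite -(subrr v) pi_NB subrr.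
have Fe : foliated_section U2 (frame c j).
  apply: foliated_sectionI => // y [Uy cy]; exists c; split => //.
    apply: (@smooth_near_ext _ _ _ _ (cst (delta_mx j 0))); last exact: smooth_near_cst.
    by apply: filterS (sec_rep_frame j h cy) => z ->.
  apply: filterS (near_open h (open_cdom h) cy cy) => z [_ c1 c2] b b0.
  by rewrite -c2 (near_eq_derive _ (sec_rep_frame j h c1)) (derive_cst (delta_mx j 0 : N)).
have [_ /(_ a a0)] := foliated_sectionE oU2 (FD _ _ _ oU2 UU2 FY Fe) h (conj Ux cx) cx.
have NE : \forall z \near c x, christoffel D c (cof c z) v *m delta_mx j 0
    = sec_rep c (fun x => D (frame c j) x (mkfield (X := X) c (cst v) x)) z.
  by near=> z; rewrite christoffel_col.
rewrite -(near_eq_derive _ NE) derive_mulmx; last 2 first.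
- exact: smooth_near_diff.
- exact: differentiable_cst.
by rewrite (derive_cst (delta_mx j 0 : N)) mulmx0 addr0.
Unshelve. all: by end_near. Qed.

(** In components [D_Y s] is the derivative of [s] along [Y] plus [Gamma(Y) s]. Differentiated along
    a leaf, after exchanging second derivatives, every term contains a leaf derivative of [s] or of
    [Gamma], or [Gamma] in a leaf direction. *)
Lemma foliated_connectionI U D : open U -> adapted_connection U D ->
  (forall x, U x -> exists c, [/\ fm_atlas c, cdom c x &
    forall y a v, U y -> cdom c y -> pi_N a = 0 ->
      'D_a (fun z => christoffel D c (cof c z) v) (c y) = 0]) ->
  foliated_connection U D.
Proof.
move=> oU aD HF; split => // U' Y s oU' UU' FY Fs; have [hD _] := aD.
apply: foliated_sectionI => // x U'x; have [c [h cx HFc]] := HF _ (UU' _ U'x).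
exists c; have ss : smooth_section U' s.
  apply: smooth_sectionI => y U'y; have [h1 cy] := ga_pchart hX y.
  by exists (pchart (c := X) y); split => //; have [] := foliated_sectionE oU' Fs h1 U'y cy.
have sY : vfield U' Y by case: FY.
have sDs := conn_smooth hD oU' UU' ss sY.
split => //; first exact: (smooth_section_near oU').
apply: filterS (near_open h oU' U'x cx) => z [Uy cy zE] a a0.
rewrite -zE; set y := cof c z in Uy cy *.
have Uy' := UU' _ Uy.
have NE : \forall z \near c y, sec_rep c (fun x => D s x (Y x)) z =
    'D_(field_rep c Y z) (sec_rep c s) z +
    christoffel D c (cof c z) (field_rep c Y z) *m sec_rep c s z.
  apply: filterS (near_open h oU' Uy cy) => w [Uw cw wE].
  rewrite -wE; move: (cof c w) Uw cw => y1 Uy1 cy1.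
  rewrite (sec_rep_at _ h cy1) (conn_rep hD (Y y1) oU' UU' ss Uy1 h cy1).
  by rewrite (ga_can hX h cy1) (field_rep_at hX Y h cy1).
have sYc := smooth_field_near (open_chart_open oU') sY h Uy cy.
have ssc := smooth_section_near oU' ss h Uy cy.
have sG v := christoffel_smooth oU hD v h Uy' cy.
have lG : \forall z \near c y, linear (christoffel D c (cof c z)).
  apply: filterS (near_open h oU' Uy cy) => w [Uw cw _].
  by apply: (christoffel_linear oU hD h) => //; exact: UU'.
have sGY : smooth_near (c y) (fun z => christoffel D c (cof c z) (field_rep c Y z)).
  exact: (smooth_near_app _ lG).
have dY := smooth_near_diff sYc; have ds := smooth_near_diff ssc.
have sDY : smooth_near (c y) (fun z => 'D_(field_rep c Y z) (sec_rep c s) z).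
  exact: smooth_near_Dvar.
have dF b : pi_N b = 0 -> \forall z \near c y, 'D_b (sec_rep c s) z = 0.
  move=> b0; apply: filterS (near_open h oU' Uy cy) => w [Uw cw wE].
  by rewrite -wE; have [_ H] := foliated_sectionE oU' Fs h Uw cw; exact: H.
(* The leaf derivative of a foliated field is tangent to the leaves, a direction killed by [Gamma]
   and by the differential of [s]. *)
have FYa : pi_N ('D_a (field_rep c Y) (c y)) = 0 by exact: (foliated_fieldE h oU' FY).
rewrite (near_eq_derive _ NE).
rewrite (@deriveD _ _ _ (fun z => 'D_(field_rep c Y z) (sec_rep c s) z)
   (fun z => christoffel D c (cof c z) (field_rep c Y z) *m sec_rep c s z)); last 2 first.
- exact: smooth_near_derivable.
- by apply: smooth_near_derivable; exact: smooth_near_mulmx.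
rewrite derive_mulmx; last 2 first.
- exact: smooth_near_diff.
- by [].
rewrite (nbhs_singleton (dF a a0)) mulmx0 addr0.
rewrite derive_Dvar// (nbhs_singleton (dF _ FYa)) add0r.
rewrite schwarz// (near_eq_derive _ (dF a a0)) (derive_cst (0 : N)) add0r.
rewrite (derive_app _ _ lG)//; last by move=> u; exact: smooth_near_diff.
rewrite (HFc y _ _ Uy' cy a0) add0r /y.
by rewrite (ga_can hX)// (christoffel_F oU aD)// mul0mx.
Qed.

(** The derivatives of components in [D_Y Z - D_Z Y] form the normal part of the bracket, and what
    remains is the antisymmetric part of the connection matrix. *)
Lemma torsionlessI U D : open U -> is_connection U D ->
  (forall x, U x -> exists c, [/\ fm_atlas c, cdom c x &
     forall v w, christoffel D c x v *m pi_N w = christoffel D c x w *m pi_N v]) ->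
  torsionless U D.
Proof.
move=> oU hD H U' Y Z x oU' UU' sY sZ U'x.
have [c [h cx sym]] := H _ (UU' _ U'x).
have co := open_chart_open oU'.
have sYc := smooth_field_near co sY h U'x cx.
have sZc := smooth_field_near co sZ h U'x cx.
rewrite -[LHS](ncdK _ h cx) /torsion.
have -> : ncd c x (D (fun y => pi_N (Z y)) x (Y x) - D (fun y => pi_N (Y y)) x (Z x)
    - pi_N (bracket Y Z x)) = 0; last by rewrite -nfrV_mul mulmx0.
rewrite -nfr_mul !mulmxBr !nfr_mul.
rewrite !(conn_rep hD _ oU' UU')//; try exact: smooth_section_pi.
rewrite -pi_coord// (lie_coord hX h cx)// pi_NB.
rewrite !(near_eq_derive _ (sec_rep_pi _ h cx)) !(nbhs_singleton (sec_rep_pi _ h cx)).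
rewrite !derive_linear; try exact: smooth_near_diff; try exact: pi_N_linear.
rewrite !(field_rep_at hX)// (sym (coord c x (Y x))).
move: (pi_N _) (pi_N ('D_ _ _ _)) (christoffel _ _ _ _ *m _) => b1 b2 b3.
by rewrite opprD addrACA subrr addr0 subrr.
Qed.

(** The difference tensor of two connections, read at [x] in the preferred chart of [x]. There the
    frame is the identity, so no conjugation appears. *)
Definition diffc D D' x v : 'M[R]_m :=
  christoffel D' (pchart (c := X) x) x v - christoffel D (pchart (c := X) x) x v.

Section Difference.
Variables (U : set M) (D D' : connection_op M).
Hypotheses (oU : open U) (hD : is_connection U D) (hD' : is_connection U D').

Lemma diffcE U' s x v : open U' -> U' `<=` U -> smooth_section U' s -> U' x ->
  D' s x v - D s x v = diffc D D' x v *m s x.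
Proof.
move=> oU' UU' ss U'x; have [h cx] := ga_pchart hX x.
have H D1 : is_connection U D1 -> D1 s x v =
    'D_v (sec_rep (pchart (c := X) x) s) (pchart (c := X) x x) +
    christoffel D1 (pchart (c := X) x) x v *m s x.
  move=> hD1; have := conn_rep hD1 v oU' UU' ss U'x h cx.
  by rewrite (coord_pchart hX) (sec_rep_at s h cx) !ncd_pchart.
rewrite (H D' hD') (H D hD) /diffc mulmxBl; move: ('D_v _ _) => b.
by rewrite opprD addrACA subrr add0r.
Qed.

Lemma diffc_chart c x v : fm_atlas c -> U x -> cdom c x ->
  christoffel D' c x (coord c x v) - christoffel D c x (coord c x v)
  = nfr c x *m diffc D D' x v *m nfrV c x.
Proof.
move=> h Ux cx; apply: mx_eq => w; rewrite (delta_decomp w) !mulmx_sumr.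
apply: eq_bigr => j _; rewrite -!scalemxAr; congr (_ *: _).
rewrite mulmxBl !christoffel_col (coordK hX)// -!nfr_mul -mulmxBr.
rewrite (@diffcE (U `&` cdom c)); last 4 first.
- by apply: openI => //; exact: open_cdom.
- by move=> y [].
- by apply: smooth_frame => // y [].
- by [].
by rewrite frameE -nfrV_mul !mulmxA.
Qed.

Lemma diffc_linear x : U x -> linear (diffc D D' x).
Proof.
move=> Ux a u v; have [h cx] := ga_pchart hX x; rewrite /diffc.
rewrite (christoffel_linear oU hD h Ux cx) (christoffel_linear oU hD' h Ux cx).
by rewrite opprD addrACA scalerBr.
Qed.

(** Both sides are tensorial, so a vector [w] may be extended by constant components and the
    condition tested pointwise. *)
Lemma projective_changeP phi : projective_change U D D' phi <->
  forall x v w, U x -> diffc D D' x v *m pi_N w = odot phi x v w.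
Proof.
split=> [H x v w Ux|H U' Y x v oU' UU' sY U'x]; last first.
  rewrite (diffcE _ oU' UU')//; last exact: smooth_section_pi.
  by rewrite H//; exact: UU'.
have [h cx] := ga_pchart hX x; set c := pchart (c := X) x in h cx *.
pose U2 := U `&` cdom c.
have oU2 : open U2 by apply: openI => //; exact: open_cdom.
have UU2 : U2 `<=` U by move=> y [].
have sY : vfield U2 (mkfield (X := X) c (cst w)).
  by apply: (smooth_mkfield hX h) => [y []//|y _]; exact: smooth_near_cst.
have wE : mkfield (X := X) c (cst w) x = w.
  by rewrite /mkfield -[RHS](coordK hX (c := c) (x := x))// (coord_pchart hX).
have := H U2 _ x v oU2 UU2 sY (conj Ux cx).
rewrite (diffcE _ oU2 UU2)//; last exact: smooth_section_pi.
by rewrite wE.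
Qed.

End Difference.

Definition addc D (B : M -> E -> 'M[R]_m) : connection_op M :=
  fun s x v => D s x v + B x v *m s x.

(** The components of [B] in [c]: frame change on the values, components in [c] as argument. *)
Definition crep c (B : M -> E -> 'M[R]_m) (z a : E) : 'M[R]_m :=
  nfr c (cof c z) *m B (cof c z) (vect c (cof c z) a) *m nfrV c (cof c z).

Definition smooth_tensor U B :=
  (forall x, U x -> linear (B x)) /\
  forall x, U x -> exists c, [/\ fm_atlas c, cdom c x &
    forall a, smooth_near (c x) (fun z => crep c B z a)].

Lemma christoffel_addc D B c x a : fm_atlas c -> cdom c x ->
  christoffel (addc D B) c x a = christoffel D c x a + crep c B (c x) a.
Proof.
move=> h cx; apply: mx_eq => w; rewrite (delta_decomp w) !mulmx_sumr.
apply: eq_bigr => j _; rewrite -!scalemxAr; congr (_ *: _).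
rewrite mulmxDl !christoffel_col /addc -nfr_mul mulmxDr nfr_mul /crep (ga_can hX)//.
by rewrite frameE -nfrV_mul !mulmxA.
Qed.

Lemma crep_linear U B c x : smooth_tensor U B -> U x -> fm_atlas c -> cdom c x ->
  linear (crep c B (c x)).
Proof.
move=> [lB _] Ux h cx a u v; rewrite /crep (ga_can hX)// vect_linear lB//.
by rewrite mulmxDr mulmxDl -scalemxAr -scalemxAl.
Qed.

Lemma is_connection_addc U D B : open U -> is_connection U D -> smooth_tensor U B ->
  is_connection U (addc D B).
Proof.
move=> oU hD [lB sB] U' oU' UU'; split.
- move=> s x ss U'x a u v; rewrite /addc (conn_linear hD oU' UU')// lB; last exact: UU'.
  by rewrite mulmxDl -scalemxAl scalerDr addrACA.
- move=> s t x v ss st U'x; rewrite /addc (conn_add hD _ oU' UU')// mulmxDr.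
  by rewrite addrACA.
- move=> f s x v sf ss U'x; rewrite /addc (conn_leibniz hD _ oU' UU')//.
  by rewrite -scalemxAr scalerDr addrA.
- move=> s Y ss sY; apply: smooth_sectionD => //; first exact: (conn_smooth hD oU' UU').
  apply: smooth_sectionI => x U'x; have [c [h cx sc]] := sB _ (UU' _ U'x).
  exists c; split => //.
  apply: (@smooth_near_ext _ _ _ _ (fun z => crep c B z (field_rep c Y z) *m sec_rep c s z)).
    apply: filterS (near_open h oU' U'x cx) => z [Uz cz zE].
    rewrite -zE (field_rep_at hX)// !sec_rep_at// /crep (ga_can hX)// (coordK hX)//.
    by rewrite -mulmxA nfrV_mul ncdK// -mulmxA nfr_mul.
  apply: smooth_near_mulmx; last exact: (smooth_section_near oU').
  apply: smooth_near_app => //; last exact: (smooth_field_near (open_chart_open oU') sY).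
  apply: filterS (near_open h oU' U'x cx) => z [Uz cz <-].
  by apply: (@crep_linear U) => //; exact: UU'.
Qed.

Lemma adapted_addc U D B : open U -> adapted_connection U D -> smooth_tensor U B ->
  (forall x v, U x -> pi_N v = 0 -> B x v = 0) -> adapted_connection U (addc D B).
Proof.
move=> oU [hD aD] sB BF; split; first exact: is_connection_addc.
move=> U' Y Z x oU' UU' sY FZ U'x; rewrite /addc BF ?mul0mx ?addr0.
- exact: (aD U').
- exact: UU'.
- by case: FZ => _; exact.
Qed.

End Connection.

(** * The transversal twistor space *)

Section PairCalculus.
Context {R : realType}.
Implicit Types V U W : normedModType R.

Lemma differentiable_fst V U (z : V * U) : differentiable (fun z : V * U => z.1) z.
Proof. by apply: smooth_near_diff; apply: smooth_near_fst; exact: smooth_near_id. Qed.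

Lemma differentiable_snd V U (z : V * U) : differentiable (fun z : V * U => z.2) z.
Proof. by apply: smooth_near_diff; apply: smooth_near_snd; exact: smooth_near_id. Qed.

Lemma derive_fst V U W (f : W -> V * U) x v : differentiable f x ->
  'D_v (fun y => (f y).1) x = ('D_v f x).1.
Proof. by apply: (@derive_linc R W _ _ x v (@fst V U : {linear _ -> _})) => y; exact: cvg_fst. Qed.

Lemma derive_snd V U W (f : W -> V * U) x v : differentiable f x ->
  'D_v (fun y => (f y).2) x = ('D_v f x).2.
Proof. by apply: (@derive_linc R W _ _ x v (@snd V U : {linear _ -> _})) => y; exact: cvg_snd. Qed.

Lemma derive_on_fst V U W (f : V -> W) (z w : V * U) : differentiable f z.1 ->
  'D_w (fun z => f z.1) z = 'D_(w.1) f z.1.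
Proof.
move=> df; rewrite (@derive_comp R _ _ _ z w (fun z : V * U => z.1) f)//; last first.
  exact: differentiable_fst.
by rewrite (@derive_fst V U _ id)// derive_id.
Qed.

Lemma derive_is_snd V U (z w : V * U) : 'D_w (fun z => z.2) z = w.2.
Proof. by rewrite (@derive_snd V U _ id)// derive_id. Qed.

End PairCalculus.

(** * Charts of the total space of End(N) *)

Section TwistorSpace.
Context {R : realType} {p m : nat} (M : foliated_manifold R p m).
Notation E := 'cV[R]_(p + m).
Notation EndN := 'M[R]_m.
Notation X := (manifold M).
Notation ES := (end_space M).
Notation coord := (coord (X := X)).
Notation tr := (@transition R E X).
Notation nfr := (@nfr R p m M).
Notation nfrV := (@nfrV R p m M).
Notation ntr := (@ntr R p m M).
Notation ec := (@end_chart R p m M).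
Notation etr := (@transition R (E * EndN)%type ES).
Notation ecoord := (Defs.coord (X := ES)).
Implicit Types (c : chart M E) (x : M) (e : ES).

Let hX := manifold_good M.

Lemma ec_to c e : fm_atlas c -> cdom c e.1 ->
  ec c e = (c e.1, nfr c e.1 *m e.2 *m nfrV c e.1).
Proof. by move=> h cx; rewrite /= nfrE invmx_nfr. Qed.

Lemma ec_of c (z : E * EndN) : fm_atlas c -> cdom c (cof c z.1) ->
  cof (ec c) z = (cof c z.1, nfrV c (cof c z.1) *m z.2 *m nfr c (cof c z.1)).
Proof. by move=> h cx; rewrite /= nfrE invmx_nfr. Qed.

Lemma ec_can c e : fm_atlas c -> cdom c e.1 -> cof (ec c) (ec c e) = e.
Proof.
case: e => x J h /= cx; have E1 := ga_can hX h cx; rewrite nfrE /= E1 invmx_nfr//.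
by rewrite !mulmxA nfrK// mul1mx -mulmxA nfrK// mulmx1.
Qed.

Lemma ec_ofK c (z : E) (J : EndN) : fm_atlas c -> cdom c (cof c z) ->
  c (cof c z) = z -> ec c (cof (ec c) (z, J)) = (z, J).
Proof.
move=> h cz zE; apply: (etrans (congr1 (ec c) (@ec_of c (z, J) h cz))).
apply: (etrans (@ec_to c (_, _) h cz)); rewrite /= zE.
by rewrite !mulmxA nfrVK// mul1mx -mulmxA nfrVK// mulmx1.
Qed.

Lemma open_fst (O : set E) : open O -> open [set z : E * EndN | O z.1].
Proof.
move=> oO; rewrite (_ : [set _ | _] = fst @^-1` O)//; apply: open_comp => // z _.
exact: cvg_fst.
Qed.

Lemma ec_image c U : fm_atlas c -> U `<=` cdom c ->
  ec c @` [set e | U e.1] = [set z : E * EndN | (c @` U) z.1].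
Proof.
move=> h Uc; apply/seteqP; split=> [_ [e Ue <-]|[z K] [x Ux /= xz]].
  by exists e.1 => //.
have cx := Uc _ Ux; exists (x, nfrV c x *m K *m nfr c x) => //.
apply: (etrans (@ec_to c (x, _) h cx)); rewrite /= xz.
by rewrite !mulmxA nfrVK// mul1mx -mulmxA nfrVK// mulmx1.
Qed.

Lemma etr_near c c' e : fm_atlas c -> fm_atlas c' -> cdom c e.1 -> cdom c' e.1 ->
  \forall z \near ec c e,
    etr (ec c) (ec c') z = (tr c c' z.1, ntr c c' z.1 *m z.2 *m ntr c' c (tr c c' z.1)).
Proof.
move=> h h' cx c'x.
have D : nbhs (ec c e) [set z : E * EndN | (c @` (cdom c `&` cdom c')) z.1].
  apply: open_nbhs_nbhs; split; last by exists e.1.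
  by apply: open_fst; exact: (ga_open hX).
apply: filterS D => -[z K] [y [cy c'y] /= yz].
have zE : cof c z = y by rewrite -yz (ga_can hX h cy).
have cz : cdom c (cof c z) by rewrite zE.
have T : ec c' (cof (ec c) (z, K)) =
    (c' y, nfr c' y *m (nfrV c y *m K *m nfr c y) *m nfrV c' y).
  apply: (etrans (congr1 (ec c') (@ec_of c (z, K) h cz))) => /=; rewrite zE.
  exact: (@ec_to c' (y, _) h' c'y).
apply: (etrans T); rewrite /transition/= zE.
congr (_, _); rewrite -yz (nfr_chg h h' cy c'y).
have VE : nfrV c' y = nfrV c y *m ntr c' c (c' y).
  rewrite -[RHS](mulmx1 _) -(nfrVK h' c'y) mulmxA (nfr_chg h h' cy c'y).
  rewrite -[_ *m ntr c' c _ *m (_ *m _)]mulmxA [ntr c' c _ *m (_ *m _)]mulmxA.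
  by rewrite (ntr_inv h h' cy c'y) mul1mx nfrK// mul1mx.
rewrite VE !mulmxA -[ntr c c' _ *m nfr c y *m nfrV c y]mulmxA nfrVK// mulmx1.
by rewrite -[_ *m nfr c y *m nfrV c y]mulmxA nfrVK// mulmx1.
Qed.

Lemma etr_smooth_near c c' e : fm_atlas c -> fm_atlas c' -> cdom c e.1 -> cdom c' e.1 ->
  smooth_near (ec c e) (fun z : E * EndN =>
     (tr c c' z.1, ntr c c' z.1 *m z.2 *m ntr c' c (tr c c' z.1))).
Proof.
move=> h h' cx c'x.
have s1 : smooth_near (ec c e) (fun z : E * EndN => z.1).
  by apply: smooth_near_fst; exact: smooth_near_id.
have s2 : smooth_near (ec c e) (fun z : E * EndN => z.2).
  by apply: smooth_near_snd; exact: smooth_near_id.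
have st : smooth_near (ec c e) (fun z : E * EndN => tr c c' z.1).
  apply: (@smooth_near_comp _ _ _ _ _ fst (tr c c')) => //; exact: (tr_smooth hX).
apply: smooth_near_pair => //; apply: smooth_near_mulmx.
  apply: smooth_near_mulmx => //.
  by apply: (@smooth_near_comp _ _ _ _ _ fst (ntr c c')) => //; exact: ntr_smooth.
apply: (@smooth_near_comp _ _ _ _ _ (fun z : E * EndN => tr c c' z.1) (ntr c' c)) => //=.
by rewrite (tr_at hX)//; exact: ntr_smooth.
Qed.

Lemma end_good : good_atlas ES.
Proof.
split.
- by move=> _ [c h ->] e cx; exact: ec_can.
- move=> _ _ [c h ->] [c' h' ->].
  rewrite (_ : cdom (ec c) `&` cdom (ec c') = [set e | (cdom c `&` cdom c') e.1])//.
  rewrite (@ec_image c _ h (@subIsetl _ _ _)).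
  by apply: open_fst; exact: (ga_open hX).
- move=> _ _ [c h ->] [c' h' ->]; apply: smooth_onP => _ [e [cx c'x] <-].
  apply: smooth_near_ext (etr_smooth_near h h' cx c'x).
  by apply: filterS (etr_near h h' cx c'x) => z /esym.
- move=> e; have [h cx] := ga_pchart hX e.1; split => //.
  by exists (pchart (c := X) e.1).
Qed.

Let hES := end_good.

Lemma ec_atlas c : fm_atlas c -> catlas (c := ES) (ec c).
Proof. by exists c. Qed.

(** Differentiating the conjugation by the frame adds the commutator of [K] with the logarithmic
    derivative [P *m n'] of the transition matrix; this term later meets the inhomogeneous term of
    the connection matrix. *)
Lemma ecoordE c e xi : fm_atlas c -> cdom c e.1 ->
  let P := 'D_(xi.1) (ntr (pchart (c := X) e.1) c) (pchart (c := X) e.1 e.1) in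
  let n := nfr c e.1 in let n' := nfrV c e.1 in let K := (ec c e).2 in
  ecoord (ec c) e xi =
    (coord c e.1 xi.1, P *m n' *m K - K *m (P *m n') + n *m xi.2 *m n').
Proof.
case: e xi => x J [v A] h /= cx.
have [hp px] := ga_pchart hX x; set q := pchart (c := X) x in hp px *.
set P := 'D_v (ntr q c) (q x).
have KE : nframe c x *m J *m invmx (nframe c x) = nfr c x *m J *m nfrV c x.
  by rewrite nfrE invmx_nfr.
rewrite {}KE; pose e : ES := (x, J).
have qe : ec q e = (q x, J) by rewrite ec_to//= nfr_pchart mul1mx -[nfrV q x]mul1mx -[1%:M](nfr_pchart x) nfrVK// mulmx1.
have nq : ntr q c (q x) = nfr c x by rewrite (nfr_chg hp h px cx) nfr_pchart mulmx1.
have n'q : ntr c q (c x) = nfrV c x.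
  by rewrite -[LHS]mulmx1 -(nfrVK h cx) mulmxA -nq (ntr_inv hp h px cx) mul1mx.
have ecx : cdom (ec c) e by exact: cx.
apply: (etrans (coordE hES (v, A) (ec_atlas h) ecx)).
have nb := etr_near (e := e) hp h px cx.
rewrite qe in nb.
have se := etr_smooth_near (e := e) hp h px cx.
rewrite [X in smooth_near X _]qe in se.
have -> : 'D_(v, A) (etr (pchart e) (ec c)) (pchart e e) =
    'D_(v, A) (fun z : E * EndN =>
      (tr q c z.1, ntr q c z.1 *m z.2 *m ntr c q (tr q c z.1))) (q x, J).
  by rewrite -[pchart e e]/(ec q e) qe; exact: near_eq_derive.
have dn : differentiable (ntr q c) (q x).
  by apply: smooth_near_diff; exact: (ntr_smooth hp h px cx).
have dt : differentiable (tr q c) (q x) by exact: (tr_diff hX hp h px cx).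
have dn' : differentiable (fun z => ntr c q (tr q c z)) (q x).
  apply: smooth_near_diff; apply: smooth_near_comp; first exact: (tr_smooth hX).
  by rewrite (tr_at hX)//; exact: ntr_smooth.
(* The derivative of an inverse: the product of the two transition matrices is constant. *)
have Dn' : 'D_v (fun z => ntr c q (tr q c z)) (q x) = - (nfrV c x *m P *m nfrV c x).
  have I1 : \forall z \near q x, ntr c q (tr q c z) *m ntr q c z = 1%:M.
    apply: filterS (near_chart hX hp h px cx) => z [c1 c2 c3].
    by rewrite -c3 (tr_at hX c hp c1) (ntr_inv hp h c1 c2).
  have := near_eq_derive v I1.
  rewrite (derive_cst (1%:M : EndN)) (derive_mulmx _ dn' dn) (tr_at hX c hp px) n'q nq -/P.
  move=> /eqP; rewrite addr_eq0 => /eqP D1.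
  move: D1; move: ('D_v _ _) => T D1.
  by rewrite -[T]mulmx1 -(nfrVK h cx) mulmxA D1 mulNmx.
have d1 : differentiable (fun z : E * EndN => ntr q c z.1) (q x, J).
  by apply: (differentiable_comp (differentiable_fst _)).
have d3 : differentiable (fun z : E * EndN => ntr c q (tr q c z.1)) (q x, J).
  by apply: (@differentiable_comp _ _ _ _ fst (fun z => ntr c q (tr q c z)) _ (differentiable_fst _)).
have d2 := differentiable_snd (q x, J).
have d4 : differentiable (fun z : E * EndN => tr q c z.1) (q x, J).
  by apply: (differentiable_comp (differentiable_fst _)).
have d12 := differentiable_mulmx d1 d2.
rewrite (derive_pair _ d4 (differentiable_mulmx d12 d3)) (derive_mulmx _ d12 d3).
rewrite (derive_mulmx _ d1 d2) derive_is_snd/=.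
rewrite (@derive_on_fst R E EndN _ (tr q c) (q x, J) (v, A))//.
rewrite (@derive_on_fst R E EndN _ (ntr q c) (q x, J) (v, A))//.
rewrite (@derive_on_fst R E EndN _ (fun z => ntr c q (tr q c z)) (q x, J) (v, A))//=.
rewrite Dn' (tr_at hX c hp px) n'q nq -/P -(coordE hX)//.
congr (_, _); have JE : J = nfrV c x *m (nfr c x *m J *m nfrV c x) *m nfr c x.
  by rewrite !mulmxA nfrK// mul1mx -mulmxA nfrK// mulmx1.
rewrite mulmxDl mulmxN addrAC; congr (_ - _ + _); last by rewrite !mulmxA.
by rewrite !mulmxA -[P *m nfrV c x *m nfr c x]mulmxA nfrK// mulmx1.
Qed.

End TwistorSpace.

(** * Horizontal and vertical vectors in adapted charts *)

Section Horizontal.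
Context {R : realType} {p m : nat} (M : foliated_manifold R p m).
Notation E := 'cV[R]_(p + m).
Notation EndN := 'M[R]_m.
Notation X := (manifold M).
Notation ES := (end_space M).
Notation coord := (coord (X := X)).
Notation ncd := (@ncd R p m M).
Notation nfr := (@nfr R p m M).
Notation nfrV := (@nfrV R p m M).
Notation ntr := (@ntr R p m M).
Notation ec := (@end_chart R p m M).
Notation ecoord := (Defs.coord (X := ES)).
Notation field_rep := (Defs.field_rep (X := ES)).
Notation pch x := (pchart (c := X) x).
Implicit Types (c : chart M E) (x : M) (e : ES).

Let hX := manifold_good M.
Let hES := end_good M.

Definition lbr (A B : EndN) : EndN := A *m B - B *m A.

Definition chJ c e : EndN := (ec c e).2.

Lemma chJE c e : fm_atlas c -> cdom c e.1 -> chJ c e = nfr c e.1 *m e.2 *m nfrV c e.1.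
Proof. by move=> h cx; rewrite /chJ (ec_to h cx). Qed.

Lemma conj_mul c x (A B : EndN) : fm_atlas c -> cdom c x ->
  (nfr c x *m A *m nfrV c x) *m (nfr c x *m B *m nfrV c x) = nfr c x *m (A *m B) *m nfrV c x.
Proof.
move=> h cx.
by rewrite !mulmxA -[_ *m nfrV c x *m nfr c x]mulmxA (nfrK h cx) mulmx1.
Qed.

Lemma conj_inj c x (A B : EndN) : fm_atlas c -> cdom c x ->
  nfr c x *m A *m nfrV c x = nfr c x *m B *m nfrV c x -> A = B.
Proof.
move=> h cx H.
have : nfrV c x *m (nfr c x *m A *m nfrV c x) *m nfr c x =
    nfrV c x *m (nfr c x *m B *m nfrV c x) *m nfr c x by rewrite H.
by rewrite !mulmxA nfrK// !mul1mx -!mulmxA nfrK// !mulmx1.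
Qed.

Lemma twistor_chart c e : fm_atlas c -> cdom c e.1 -> twistor e ->
  chJ c e *m chJ c e = - 1%:M.
Proof.
move=> h cx; rewrite /twistor /= => t; rewrite chJE// conj_mul// t.
by rewrite mulmxN mulNmx mulmx1 nfrVK.
Qed.

Lemma pch_coord e xi : ecoord (ec (pch e.1)) e xi = xi.
Proof. exact: (coord_pchart hES). Qed.

Lemma chJ_pch e : chJ (pch e.1) e = e.2.
Proof.
have [h cx] := ga_pchart hX e.1.
by rewrite chJE// nfr_pchart mul1mx -[nfrV _ _]mul1mx -[1%:M](nfr_pchart e.1) nfrVK// mulmx1.
Qed.

Lemma ecoord1 c e xi : fm_atlas c -> cdom c e.1 ->
  (ecoord (ec c) e xi).1 = coord c e.1 xi.1.
Proof. by move=> h cx; rewrite ecoordE. Qed.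

(** The commutator in [ecoordE] anticommutes with [K] because [K^2 = -1]; hence the tangency
    condition has the same form in every chart. *)
Lemma tangent_chart c e xi : fm_atlas c -> cdom c e.1 -> twistor e ->
  (twistor_tangent e xi <->
   (ecoord (ec c) e xi).2 *m chJ c e + chJ c e *m (ecoord (ec c) e xi).2 = 0).
Proof.
move=> h cx te; have KK := twistor_chart h cx te.
have -> : (ecoord (ec c) e xi).2 *m chJ c e + chJ c e *m (ecoord (ec c) e xi).2
    = nfr c e.1 *m (xi.2 *m e.2 + e.2 *m xi.2) *m nfrV c e.1.
  rewrite (ecoordE xi h cx) -/(chJ c e)/=.
  move: ('D_ _ _ _ *m _) => Q.
  rewrite [in RHS]mulmxDr [in RHS]mulmxDl -!(conj_mul _ _ h cx) -(chJE h cx).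
  move: (nfr c e.1 *m xi.2 *m nfrV c e.1) (chJ c e) KK => a K KK.
  have QKK : Q *m K *m K = - Q by rewrite -mulmxA KK mulmxN mulmx1.
  have KKQ : K *m (K *m Q) = - Q by rewrite mulmxA KK mulNmx mul1mx.
  rewrite mulmxDl mulmxBl QKK [in LHS]mulmxDr mulmxBr KKQ [K *m (Q *m K)]mulmxA.
  move: (K *m Q *m K) (a *m K) (K *m a) => b1 b2 b3.
  by apply/matrixP => i j; rewrite !mxE; ring.
split=> [->|H]; first by rewrite mulmx0 mul0mx.
by apply: (conj_inj h cx); rewrite H mulmx0 mul0mx.
Qed.

Section WithConnection.
Variable D : connection_op M.
Hypothesis aD : adapted_connection [set: M] D.

Let hD : is_connection [set: M] D. Proof. by case: aD. Qed.

(** The vertical component, for the splitting defined by [D], of the vector with components [cc]. It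
    vanishes on velocities of parallel curves, where [J' = - [Gamma(x'), J]]. *)
Definition ver c e (cc : E * EndN) : EndN :=
  cc.2 + lbr (christoffel D c e.1 cc.1) (chJ c e).

(** The inhomogeneous terms of [ecoordE] and of [christoffel_chg] cancel, so the vertical component
    is an endomorphism and changes charts by conjugation. *)
Lemma ver_chart c e xi : fm_atlas c -> cdom c e.1 ->
  ver c e (ecoord (ec c) e xi)
  = nfr c e.1 *m (ver (pch e.1) e xi) *m nfrV c e.1.
Proof.
move=> h cx; have [hp px] := ga_pchart hX e.1; rewrite /ver chJ_pch ecoord1//.
rewrite (ecoordE xi h cx) -/(chJ c e)/=.
have := christoffel_chg openT hD xi.1 hp h I px cx.
rewrite -(coordE hX)//.
have -> : ntr (pch e.1) c (pch e.1 e.1) = nfr c e.1.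
  by rewrite (nfr_chg hp h px cx) nfr_pchart mulmx1.
set P := 'D_ _ _ _; set G' := christoffel D c e.1 _.
set G := christoffel D (pch e.1) e.1 _ => H; clearbody P G' G.
have -> : G' = (nfr c e.1 *m G - P) *m nfrV c e.1.
  by rewrite -H -mulmxA nfrVK// mulmx1.
rewrite /lbr [in RHS]mulmxDr [in RHS]mulmxDl [in RHS]mulmxBr [in RHS]mulmxBl.
rewrite -!(conj_mul _ _ h cx) -(chJE h cx) mulmxBl.
move: (P *m nfrV c e.1) (nfr c e.1 *m G *m nfrV c e.1) (chJ c e) => Q T K.
rewrite mulmxBl mulmxBr.
move: (nfr c e.1 *m xi.2 *m nfrV c e.1) (Q *m K) (K *m Q) (T *m K) (K *m T) => a b1 b2 b3 b4.
by apply/matrixP => i j; rewrite !mxE; ring.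
Qed.

Lemma ver_pch e xi : ver (pch e.1) e xi =
  xi.2 + lbr (christoffel D (pch e.1) e.1 xi.1) e.2.
Proof. by rewrite /ver chJ_pch. Qed.

(** Velocities of parallel curves satisfy the linear equation by definition. Conversely, the
    parallel equation is solved over the straight line through the base point with direction [xi.1]
    in the chart; its solution keeps [J^2 = -1]. *)
Lemma horizontal_pch e xi :
  horizontal D e xi <-> twistor e /\ ver (pch e.1) e xi = 0.
Proof.
have [h cx] := ga_pchart hX e.1; set c := pch e.1 in h cx *.
split=> [[A [g [oA A0 g0 [sg Hg] dg]]]|[te ve]].
  have [c1 tg H0] := Hg 0 A0; rewrite g0 in c1 tg H0; split => //.
  move: H0; rewrite /= -/c -/(ec c) -[derive1 _ _]/(derive1 (pchart e \o g) 0) dg.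
  by rewrite /ver.
move: ve; case: xi => v B ve; rewrite /ver /= chJ_pch in ve.
pose line (t : R) : E := c e.1 + t *: v.
have dlin t : smooth_near t line by exact: smooth_line.
have line0 : line 0 = c e.1 by rewrite /line scale0r addr0.
have Dline t : 'D_1 line t = v by exact: derive_line.
pose G (t : R) := christoffel D c (cof c (line t)) v.
have sG : smooth_near 0 G.
  apply: (@smooth_near_comp _ _ _ _ 0 line (fun z => christoffel D c (cof c z) v)) => //.
  by rewrite line0; exact: (christoffel_smooth openT hD v h I cx).
have [A [j [oA A0 j0 sj Hj]]] := parallel_ode sG te.
have nl : \forall t \near (0 : R), cdom c (cof c (line t)) /\ c (cof c (line t)) = line t.
  have := smooth_near_cont (dlin 0); rewrite /prop_for /continuous_at line0 => ct.
  have K : nbhs (c e.1) [set z | cdom c (cof c z) /\ c (cof c z) = z].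
    by apply: filterS (near_chart hX h h cx cx) => z [].
  exact: (ct _ K).
have : nbhs (0 : R) [set t | cdom c (cof c (line t)) /\ c (cof c (line t)) = line t] by exact: nl.
rewrite nbhsE /= => -[A' [oA' A'0] A'l].
pose A2 := A `&` A'; have oA2 : open A2 by exact: openI.
pose g t : ES := cof (ec c) (line t, j t).
have gE t : A2 t -> ec c (g t) = (line t, j t).
  by move=> [At /A'l[c1 c2]]; exact: (ec_ofK _ h c1 c2).
have sjt t : A2 t -> smooth_near t j by move=> [At _]; exists A.
have dj t : A2 t -> differentiable j t by move=> /sjt/smooth_near_diff.
have dg t : A2 t -> derive1 (ec c \o g) t = (v, 'D_1 j t).
  move=> A2t; rewrite derive1E (@near_eq_derive _ _ _ _ (fun t => (line t, j t))).
    by rewrite (derive_pair _ (smooth_near_diff (dlin t)) (dj _ A2t)) Dline.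
  by apply: filterS (open_nbhs_nbhs (conj oA2 A2t)) => s /gE.
exists A2, g; split => //.
- by rewrite /g line0 j0 -[RHS](ec_can h cx) (ec_to h cx) -chJE// chJ_pch.
- split=> [k|t A2t].
    apply: (@Ck_on_ext _ _ _ _ _ (fun t => (line t, j t))) => //.
      by move=> t /gE.
    suff : smooth_on A2 (fun t => (line t, j t)) by exact.
    by apply: smooth_onP => t A2t; apply: smooth_near_pair => //; exact: sjt.
  have [At /A'l[c1 c2]] := A2t; have [jj Dj] := Hj t At.
  have g1 : (g t).1 = cof c (line t) by [].
  split; first by rewrite g1.
    have g2 : (g t).2 = nfrV c (cof c (line t)) *m j t *m nfr c (cof c (line t)).
      exact: (congr1 snd (@ec_of _ _ _ M c (line t, j t) h c1)).
    rewrite /twistor /mkset g2.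
    rewrite !mulmxA -[_ *m nfr c _ *m nfrV c _]mulmxA nfrVK// mulmx1.
    by rewrite -[_ *m j t *m j t]mulmxA jj mulmxN mulmx1 mulNmx nfrK.
  have H : let d := derive1 (ec c \o g) t in let J := (ec c (g t)).2 in
      let G := christoffel D c (g t).1 d.1 in d.2 + (G *m J - J *m G) = 0.
    by rewrite (dg t A2t) (gE t A2t).
  exact: H.
- have D0 : 'D_1 j 0 = B.
    have [_] := Hj 0 A0; rewrite j0 /G line0 (ga_can hX h cx).
    move=> /eqP; rewrite addr_eq0 => /eqP ->; move: ve; rewrite /lbr.
    by move=> /eqP; rewrite addr_eq0 => /eqP ->.
  by have := dg 0 (conj A0 A'0); rewrite D0.
Qed.

Lemma horizontal_chart c e xi : fm_atlas c -> cdom c e.1 ->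
  horizontal D e xi <-> twistor e /\ ver c e (ecoord (ec c) e xi) = 0.
Proof.
move=> h cx; apply: (iff_trans (horizontal_pch e xi)); rewrite (ver_chart xi h cx).
split=> -[te ve]; split => //; first by rewrite ve mulmx0 mul0mx.
by apply: (conj_inj h cx); rewrite ve mulmx0 mul0mx.
Qed.

Lemma ver_F c e (cc : E * EndN) : fm_atlas c -> cdom c e.1 -> pi_N cc.1 = 0 -> ver c e cc = cc.2.
Proof.
move=> h cx F0; rewrite /ver (christoffel_F openT aD h I cx F0) /lbr mul0mx mulmx0.
by rewrite subrr addr0.
Qed.

(** The connection matrix vanishes in leaf directions, so the charts of End(N) are adapted to the
    lifted foliation, whatever adapted connection is used. *)
Lemma in_Fhat_chart c e xi : fm_atlas c -> cdom c e.1 -> twistor e ->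
  in_Fhat D e xi <->
  pi_N (ecoord (ec c) e xi).1 = 0 /\ (ecoord (ec c) e xi).2 = 0.
Proof.
move=> h cx te; rewrite /in_Fhat.
have F1 : in_F xi.1 <-> pi_N (ecoord (ec c) e xi).1 = 0.
  rewrite ecoord1// /in_F; split=> [|H]; first exact: coord_F.
  by rewrite -(coordK hX xi.1 h cx); exact: vect_F.
split=> [[/(horizontal_chart _ h cx)[_ v0] /F1 F0]|[F0 v0]].
  by split => //; rewrite -(ver_F h cx F0).
split; last exact/F1.
by apply/(horizontal_chart _ h cx); split => //; rewrite ver_F.
Qed.

Lemma lbr_anti (A J : EndN) : J *m J = - 1%:M -> lbr A J *m J + J *m lbr A J = 0.
Proof.
move=> JJ; rewrite /lbr mulmxBl mulmxBr -mulmxA JJ [J *m (J *m A)]mulmxA JJ.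
rewrite [J *m (A *m J)]mulmxA mulmxN mulmx1 mulNmx mul1mx.
by move: (J *m A *m J) => b; apply/matrixP => i j; rewrite !mxE; ring.
Qed.

(** The vertical part of a tangent vector anticommutes with [J], the commutator doing so by itself;
    two equations therefore replace the three conditions of [Nhat_proj]. *)
Lemma Nhat_chart c e xi s : fm_atlas c -> cdom c e.1 -> twistor e -> twistor_tangent e xi ->
  Nhat_proj D e xi s <->
  ncd c e.1 s.1 = pi_N (ecoord (ec c) e xi).1 /\
  nfr c e.1 *m s.2 *m nfrV c e.1 = ver c e (ecoord (ec c) e xi).
Proof.
move=> h cx te ta; rewrite ecoord1// pi_coord// ver_chart//.
have H1 : s.1 = pi_N xi.1 <-> ncd c e.1 s.1 = ncd c e.1 (pi_N xi.1).
  split=> [->//|H]; by rewrite -(ncdK s.1 h cx) H ncdK.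
have H2 : horizontal D e (xi.1, xi.2 - s.2) <-> s.2 = ver (pch e.1) e xi.
  apply: (iff_trans (horizontal_pch _ _)); rewrite /ver /=.
  split=> [[_ H]|->].
    by apply/eqP; rewrite -subr_eq0 -oppr_eq0 opprB addrAC H.
  by split => //; move: (lbr _ _) => b; rewrite opprD addNKr addNr.
have H3 : nfr c e.1 *m s.2 *m nfrV c e.1 = nfr c e.1 *m ver (pch e.1) e xi *m nfrV c e.1 <->
    s.2 = ver (pch e.1) e xi.
  by split=> [/(conj_inj h cx)|->].
split=> [[/H1 ? _ /H2/H3 ?]//|[/H1 s1 /H3 s2]].
split => //; last exact/H2.
rewrite s2 ver_pch mulmxDl mulmxDr addrACA ta add0r; exact: lbr_anti.
Qed.

(** Fields are controlled on the twistor space only, inside the larger space End(N). A tangent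
    vector is realized as the velocity of a curve with [J^2 = -1], along which [f] vanishes. *)
Lemma twistor_vanish (W : normedModType R) (f : E * EndN -> W) (z : E) (K : EndN) (v : E) (A : EndN) :
  K *m K = - 1%:M -> A *m K + K *m A = 0 -> differentiable f (z, K) ->
  (\forall w \near ((z, K) : E * EndN), w.2 *m w.2 = - 1%:M -> f w = 0) ->
  'D_(v, A) f (z, K) = 0.
Proof.
move=> KK AK df f0.
(* For a constant matrix [G] the parallel equation starts with velocity [K G - G K]; this is [A] for
   [G = A K / 2], since [A] anticommutes with [K]. *)
have sB : smooth_near 0 (cst (2^-1 *: (A *m K)) : R -> EndN) by exact: smooth_near_cst.
have [T [j [oT T0 j0 sj Hj]]] := parallel_ode sB KK.
have KAK : K *m A *m K = A.
  move/eqP: AK; rewrite addr_eq0 => /eqP AK.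
  by rewrite -[K *m A]opprK -AK mulNmx -mulmxA KK mulmxN mulmx1 opprK.
have Dj : 'D_1 j 0 = A.
  have [_] := Hj 0 T0; rewrite j0 /cst -scalemxAl -scalemxAr -mulmxA KK.
  rewrite [K *m (A *m K)]mulmxA KAK mulmxN mulmx1.
  move=> /eqP; rewrite addr_eq0 => /eqP ->.
  by rewrite -scalerBr; apply/matrixP => a b; rewrite !mxE; field.
pose g t : E * EndN := (z + t *: v, j t).
have dz : differentiable (fun t : R => z + t *: v) 0.
  exact: smooth_near_diff (smooth_line z v 0).
have dj : differentiable j 0 by apply: smooth_near_diff; exists T.
have dg : differentiable g 0 by exact: differentiable_pair.
have g0 : g 0 = (z, K) by rewrite /g scale0r addr0 j0.
have Dg : 'D_1 g 0 = (v, A) by rewrite derive_pair// derive_line Dj.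
have dfg : differentiable f (g 0) by rewrite g0.
have := derive_comp (1 : R) dg dfg; rewrite Dg g0 => <-.
rewrite (@near_eq_derive _ _ _ _ (cst 0)) ?derive_cst//.
have cg := differentiable_continuous dg; rewrite /prop_for /continuous_at g0 in cg.
have nT : nbhs (0 : R) T by apply: open_nbhs_nbhs.
have nf : nbhs (0 : R) [set t | (g t).2 *m (g t).2 = - 1%:M -> f (g t) = 0] by exact: (cg _ f0).
by apply: filterS2 nT nf => t /Hj[jj _] ->.
Qed.

(** As for fields on the base, except that the leaf field [Z] has prescribed components on the
    twistor space only: since [Y] is tangent to that space, [twistor_vanish] handles the derivative
    of [Z] along [Y]. *)
Lemma FT_I c (W : set ES) (Y : ES -> E * EndN) : fm_atlas c -> chart_open W -> W `<=` cdom (ec c) ->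
  twistor_field W Y ->
  (forall e (a : E), W e -> twistor e -> pi_N a = 0 ->
    let d := 'D_(a, 0 : EndN) (field_rep (ec c) Y) (ec c e) in pi_N d.1 = 0 /\ d.2 = 0) ->
  foliated_twistor_field D W Y.
Proof.
move=> h oW Wc [sY tY] HY; split => // W' Z oW' WW' [[sZ tZ] FZ].
have hc := ec_atlas h.
have sY' : smooth_field W' Y.
  by move=> d hd k; apply: Ck_on_sub (sY d hd k) => _ [e [/WW' We de] <-]; exists e.
have sl : smooth_field W' (lie Y Z) by exact: (smooth_lie hES).
have Fl e : W' e -> twistor e -> in_Fhat D e (lie Y Z e).
  move=> W'e te; have We := WW' _ W'e; have ce := Wc _ We.
  have sYc := smooth_field_near oW' sY' hc W'e ce.
  have sZc := smooth_field_near oW' sZ hc W'e ce.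
  apply/(in_Fhat_chart _ h ce te); rewrite (lie_coord hES hc ce sYc sZc).
  have [Z1 Z2] := (in_Fhat_chart (Z e) h ce te).1 (FZ e W'e te).
  have Zc : field_rep (ec c) Z (ec c e) = ((ecoord (ec c) e (Z e)).1, 0).
    by rewrite (field_rep_at hES Z hc ce) -Z2; case: (ecoord _ _ _).
  rewrite Zc.
  set d1 := 'D_ _ (field_rep (ec c) Z) _; set d2 := 'D_ _ (field_rep (ec c) Y) _.
  have [H1 H2] : pi_N d2.1 = 0 /\ d2.2 = 0 by exact: (HY e _ We te Z1).
  suff [G1 G2] : pi_N d1.1 = 0 /\ d1.2 = 0.
    move: d1 d2 H1 H2 G1 G2 => d1 d2 H1 H2 G1 G2.
    by rewrite /= pi_NB G1 H1 subr0 G2 H2 subr0.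
  have Yc : field_rep (ec c) Y (ec c e) = ecoord (ec c) e (Y e).
    exact: (field_rep_at hES Y hc ce).
  have eE : ec c e = (c e.1, chJ c e) by rewrite (ec_to h ce) chJE.
  have tYc := (tangent_chart (Y e) h ce te).1 (tY _ We te).
  have KK := twistor_chart h ce te.
  have dZ := smooth_near_diff sZc.
  have nZ : \forall w \near ec c e, w.2 *m w.2 = - 1%:M ->
      pi_N (field_rep (ec c) Z w).1 = 0 /\ (field_rep (ec c) Z w).2 = 0.
    apply: filterS (near_chart_open hES oW' hc W'e ce) => w [Ww cw wE] ww.
    rewrite -wE (field_rep_at hES Z hc cw).
    have tw : twistor (cof (ec c) w).
      have e2 : w.2 = chJ c (cof (ec c) w) by rewrite -{1}wE.
      rewrite /twistor /mkset; apply: (conj_inj h cw); rewrite -(conj_mul _ _ h cw).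
      by rewrite -(chJE h cw) -e2 ww mulmxN mulNmx mulmx1 nfrVK.
    by have := (in_Fhat_chart _ h cw tw).1 (FZ _ Ww tw).
  rewrite /d1 Yc; case: (ecoord (ec c) e (Y e)) tYc => v A /= tYc.
  have dZ1 : differentiable (fun w => (field_rep (ec c) Z w).1) (ec c e).
    by apply: smooth_near_diff; exact: smooth_near_fst.
  split.
    rewrite -(derive_fst _ dZ) -(derive_linear _ _ (@pi_N_linear R p m) dZ1) eE.
    apply: (twistor_vanish v KK tYc); rewrite -eE.
      apply: smooth_near_diff; apply: smooth_near_linear; first exact: pi_N_linear.
      exact: smooth_near_fst.
    by apply: filterS nZ => w H /H[].
  rewrite -(derive_snd _ dZ) eE; apply: (twistor_vanish v KK tYc); rewrite -eE.
    by apply: smooth_near_diff; exact: smooth_near_snd.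
  by apply: filterS nZ => w H /H[].
split => //; split => // e W'e te; have ce := Wc _ (WW' _ W'e).
have [_ l2] := (in_Fhat_chart _ h ce te).1 (Fl e W'e te).
by apply/(tangent_chart _ h ce te); rewrite l2 mul0mx mulmx0 addr0.
Qed.

Lemma mkfield_coord c e (f : E * EndN -> E * EndN) : fm_atlas c -> cdom c e.1 ->
  ecoord (ec c) e (mkfield (X := ES) (ec c) f e) = f (ec c e).
Proof. by move=> h ce; exact: (vectK hES _ (ec_atlas h) ce). Qed.

Lemma FT_E c (W : set ES) (Y : ES -> E * EndN) e (a : E) : fm_atlas c -> chart_open W ->
  foliated_twistor_field D W Y -> W e -> cdom c e.1 -> twistor e -> pi_N a = 0 ->
  let d := 'D_(a, 0 : EndN) (field_rep (ec c) Y) (ec c e) in pi_N d.1 = 0 /\ d.2 = 0.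
Proof.
move=> h oW [[sY tY] HY] We ce te a0 d; have hc := ec_atlas h.
pose Z := mkfield (X := ES) (ec c) (cst (a, 0 : EndN)).
pose W' := W `&` cdom (ec c).
have oW' : chart_open W' by apply: (chart_openI hES) => //; exact: (chart_open_cdom hES).
have sZ : smooth_field W' Z.
  by apply: (smooth_mkfield hES hc) => [y []//|y _]; exact: smooth_near_cst.
have FZ : Fhat_field D W' Z.
  have FZ e' : W' e' -> twistor e' -> in_Fhat D e' (Z e').
    move=> [_ ce'] te'; apply/(in_Fhat_chart _ h ce' te').
    by rewrite (mkfield_coord _ h ce').
  split => //; split => // e' W'e' te'; have [_ ce'] := W'e'.
  apply/(tangent_chart _ h ce' te'); rewrite (mkfield_coord _ h ce').
  by rewrite mul0mx mulmx0 addr0.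
have W'e : W' e by [].
have [_ Fl] := HY W' Z oW' (@subIsetl _ _ _) FZ.
have := (in_Fhat_chart _ h ce te).1 (Fl e W'e te).
have sYc := smooth_field_near oW sY hc We ce.
have sZc := smooth_field_near oW' sZ hc W'e ce.
rewrite (lie_coord hES hc ce sYc sZc).
have rZ := field_rep_mkfield hES (cst (a, 0 : EndN)) hc ce.
rewrite (near_eq_derive _ rZ) derive_cst (nbhs_singleton rZ) sub0r -/d /=.
by rewrite pi_NN => -[/eqP + /eqP]; rewrite !oppr_eq0 => /eqP-> /eqP->.
Qed.

End WithConnection.

End Horizontal.

(** * Projectability and commutators *)

Section Criterion.
Context {R : realType} {p m : nat} (M : foliated_manifold R p m).
Notation E := 'cV[R]_(p + m).
Notation N := 'cV[R]_m.
Notation EndN := 'M[R]_m.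
Notation X := (manifold M).
Notation ES := (end_space M).
Notation coord := (coord (X := X)).
Notation nfr := (@nfr R p m M).
Notation nfrV := (@nfrV R p m M).
Notation nE := (@normal_lift R p m).
Notation ec := (@end_chart R p m M).
Notation ecoord := (Defs.coord (X := ES)).
Notation field_rep := (Defs.field_rep (X := ES)).
Notation pch x := (pchart (c := X) x).
Implicit Types (c : chart M E) (x : M) (e : ES).

Let hX := manifold_good M.
Let hES := end_good M.

Lemma nE0 : nE 0 = 0.
Proof. by rewrite /normal_lift col_mx0. Qed.

Lemma pi_N0 : @pi_N R p m 0 = 0.
Proof. by rewrite -(subrr 0) pi_NB subrr. Qed.

Lemma smooth_near_lbr (V : normedModType R) (A B : V -> EndN) z :
  smooth_near z A -> smooth_near z B -> smooth_near z (fun y => lbr (A y) (B y)).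
Proof. by move=> sA sB; apply: smooth_nearB; exact: smooth_near_mulmx. Qed.

Lemma derive_lbr (V : normedModType R) (A B : V -> EndN) z v :
  differentiable A z -> differentiable B z ->
  'D_v (fun y => lbr (A y) (B y)) z = lbr ('D_v A z) (B z) + lbr (A z) ('D_v B z).
Proof.
move=> dA dB; rewrite (@deriveB _ _ _ (fun y => A y *m B y) (fun y => B y *m A y)); last 2 first.
- by apply: diff_derivable; exact: differentiable_mulmx.
- by apply: diff_derivable; exact: differentiable_mulmx.
rewrite (derive_mulmx _ dA dB) (derive_mulmx _ dB dA) /lbr.
by rewrite [X in _ - X]addrC opprD addrACA.
Qed.

Lemma lbr_scalar (A B : EndN) (a : R) : lbr (A + a%:M) B = lbr A B.
Proof.
by rewrite /lbr mulmxDl mulmxDr mul_scalar_mx mul_mx_scalar opprD addrACA subrr addr0.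
Qed.

Variable D : connection_op M.
Hypothesis aD : adapted_connection [set: M] D.

Let hD : is_connection [set: M] D. Proof. by case: aD. Qed.

Definition Gam c (z v : E) : EndN := christoffel D c (cof c z) v.

Section Chart.
Variables (c : chart M E) (e : ES).
Hypotheses (h : fm_atlas c) (cx : cdom c e.1) (te : twistor e).

Let w0 : E * EndN := ec c e.

Lemma w0E : ec c e = (c e.1, chJ c e).
Proof. by rewrite (ec_to h cx) chJE. Qed.

Lemma Gam_linear_near : \forall w \near (ec c e : E * EndN), linear (Gam c w.1).
Proof.
have nx : \forall z \near c e.1, linear (Gam c z).
  apply: filterS (near_chart hX h h cx cx) => z [c1 _ _].
  exact: (christoffel_linear openT hD h I c1).
have cf : {for (ec c e : E * EndN), continuous (fun w : E * EndN => w.1)} by exact: cvg_fst.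
by rewrite w0E in cf *; exact: (cf _ nx).
Qed.

Lemma Gam_smooth v : smooth_near (ec c e : E * EndN) (fun w => Gam c w.1 v).
Proof.
rewrite w0E; apply: (@smooth_near_comp _ _ _ _ _ (fun w : E * EndN => w.1) (fun z => Gam c z v)).
  by apply: smooth_near_fst; exact: smooth_near_id.
exact: (christoffel_smooth openT hD v h I cx).
Qed.

Lemma smooth_Gam (f : E * EndN -> E) : smooth_near (ec c e : E * EndN) f ->
  smooth_near (ec c e : E * EndN) (fun w => lbr (Gam c w.1 (f w)) w.2).
Proof.
move=> sf; apply: smooth_near_lbr; last by apply: smooth_near_snd; exact: smooth_near_id.
exact: (smooth_near_app _ Gam_linear_near Gam_smooth sf).
Qed.

(** Along a leaf three things could vary: the argument [f], whose change is a leaf direction killed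
    by [Gam]; the endomorphism, which stays fixed; and the matrix inside the commutator, excluded by
    assumption. *)
Lemma derive_Gam (f : E * EndN -> E) (a : E) : smooth_near (ec c e : E * EndN) f ->
  pi_N ('D_(a, 0 : EndN) f (ec c e)) = 0 ->
  (forall v, 'D_a (fun z => lbr (Gam c z v) (chJ c e)) (c e.1) = 0) ->
  'D_(a, 0 : EndN) (fun w => lbr (Gam c w.1 (f w)) w.2) (ec c e) = 0.
Proof.
move=> sf F0 HG.
have dGf : differentiable (fun w : E * EndN => Gam c w.1 (f w)) (ec c e).
  apply: smooth_near_diff; exact: (smooth_near_app _ Gam_linear_near Gam_smooth sf).
have dG u : differentiable (fun w : E * EndN => Gam c w.1 u) (ec c e).
  by apply: smooth_near_diff; exact: Gam_smooth.
have df : differentiable f (ec c e) by exact: smooth_near_diff.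
have dv v : differentiable (fun z => Gam c z v) (c e.1).
  exact: smooth_near_diff (christoffel_smooth openT hD v h I cx).
rewrite (derive_lbr _ dGf (differentiable_snd _)).
rewrite derive_is_snd/= {2}/lbr mulmx0 mul0mx subrr addr0.
rewrite (derive_app _ _ Gam_linear_near dG df).
have -> : Gam c (ec c e).1 ('D_(a, 0 : EndN) f (ec c e)) = 0.
  by rewrite /Gam /= (ga_can hX h cx) (christoffel_F openT aD h I cx F0).
rewrite addr0; move: (f (ec c e)) => v.
have -> : 'D_(a, 0 : EndN) (fun w : E * EndN => Gam c w.1 v) (ec c e) =
    'D_a (fun z => Gam c z v) (c e.1).
  by rewrite (@derive_on_fst R E EndN _ (fun z => Gam c z v) (ec c e) (a, 0)).
have dK : differentiable (fun _ : E => chJ c e) (c e.1) by exact: differentiable_cst.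
have := HG v; rewrite (derive_lbr _ (dv v) dK).
by rewrite (derive_cst (chJ c e)) [lbr (Gam _ _ _) _]/lbr mulmx0 mul0mx subrr addr0.
Qed.

End Chart.

(* [I1] and [I2] are the cases [eps = 1] and [eps = -1]. *)
Lemma commutator_projectable (eps : R) :
  (forall x, exists c, [/\ fm_atlas c, cdom c x & \forall z \near c x, forall a v K,
     pi_N a = 0 -> K *m K = - 1%:M -> 'D_a (fun z => lbr (Gam c z v) K) z = 0]) ->
  projectable D (fun e s => (e.2 *m s.1, eps *: (e.2 *m s.2))).
Proof.
move=> HG W s oW Fs e We te.
have [W' [Y [oW' W'e W'W FY NY]]] := Fs e We te.
have [c [h cx Hc]] := HG e.1.
have : nbhs (c e.1) [set z | forall a v K,
     pi_N a = 0 -> K *m K = - 1%:M -> 'D_a (fun z => lbr (Gam c z v) K) z = 0] by exact: Hc.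
rewrite nbhsE /= => -[B [oB Be] HB].
have hc := ec_atlas h.
pose W2 := W' `&` [set e' | cdom (ec c) e' /\ [set w : E * EndN | B w.1] (ec c e')].
have oW2 : chart_open W2.
  apply: (chart_openI hES) => //; apply: (chart_open_pre hES hc); exact: open_fst.
have [[sY tY] _] := FY.
pose Yc := field_rep (ec c) Y.
have sYc e' : W2 e' -> smooth_near (ec c e' : E * EndN) Yc.
  by move=> [W'e' [ce' _]]; exact: (smooth_field_near oW' sY hc W'e' ce').
have YcE e' : cdom c e'.1 -> Yc (ec c e') = ecoord (ec c) e' (Y e').
  by move=> ce'; exact: (field_rep_at hES Y hc ce').
(* With [u] the normal part and [S] the vertical part of [Y], the field [F] has normal part [J u]
   and vertical part [eps J S]; the subtracted commutator converts vertical parts back to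
   components. *)
pose b (w : E * EndN) : E := nE (w.2 *m pi_N (Yc w).1).
pose S (w : E * EndN) : EndN := (Yc w).2 + lbr (Gam c w.1 (Yc w).1) w.2.
pose F (w : E * EndN) : E * EndN := (b w, eps *: (w.2 *m S w) - lbr (Gam c w.1 (b w)) w.2).
have s1 e' : W2 e' -> smooth_near (ec c e' : E * EndN) (fun w => pi_N (Yc w).1).
  move=> W2e; apply: smooth_near_linear; first exact: pi_N_linear.
  by apply: smooth_near_fst; exact: sYc.
have s2 (w0 : E * EndN) : smooth_near w0 (fun w : E * EndN => w.2).
  by apply: smooth_near_snd; exact: smooth_near_id.
have sb e' : W2 e' -> smooth_near (ec c e' : E * EndN) b.
  move=> W2e; apply: smooth_near_linear; first exact: nE_linear.
  by apply: smooth_near_mulmx => //; exact: s1.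
have sS e' : W2 e' -> smooth_near (ec c e' : E * EndN) S.
  move=> W2e; have [_ [ce' _]] := W2e; apply: smooth_nearD.
    by apply: smooth_near_snd; exact: sYc.
  by apply: (smooth_Gam h ce'); apply: smooth_near_fst; exact: sYc.
have sKS e' : W2 e' -> smooth_near (ec c e' : E * EndN) (fun w => w.2 *m S w).
  by move=> W2e; apply: smooth_near_mulmx => //; exact: sS.
have sF e' : W2 e' -> smooth_near (ec c e' : E * EndN) F.
  move=> W2e; have [_ [ce' _]] := W2e; apply: smooth_near_pair; first exact: sb.
  apply: smooth_nearB; last by apply: (smooth_Gam h ce'); exact: sb.
  by apply: smooth_nearZ; [exact: smooth_near_cst|exact: sKS].
pose Y' := mkfield (X := ES) (ec c) F.
have Y'E e' : cdom c e'.1 -> ecoord (ec c) e' (Y' e') = F (ec c e').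
  by move=> ce'; exact: mkfield_coord.
have SK e' : W2 e' -> twistor e' ->
    S (ec c e') *m chJ c e' + chJ c e' *m S (ec c e') = 0.
  move=> [W'e' [ce' _]] te'; have KK := twistor_chart h ce' te'.
  have := (tangent_chart (Y e') h ce' te').1 (tY _ W'e' te').
  rewrite -YcE// => tYc; rewrite /S -[(ec c e').2]/(chJ c e') mulmxDl mulmxDr addrACA.
  by rewrite tYc (lbr_anti _ KK) addr0.
have tY' e' : W2 e' -> twistor e' -> twistor_tangent e' (Y' e').
  move=> W2e te'; have [_ [ce' _]] := W2e; have KK := twistor_chart h ce' te'.
  apply/(tangent_chart (Y' e') h ce' te'); rewrite Y'E// /F /=.
  rewrite -[nframe _ _ *m _ *m _]/(chJ c e').
  have KSK : chJ c e' *m S (ec c e') *m chJ c e' = S (ec c e').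
    have := SK _ W2e te'; move=> /eqP; rewrite addr_eq0 => /eqP SKe.
    by rewrite -mulmxA SKe mulmxN mulmxA KK mulNmx mul1mx opprK.
  rewrite mulmxBl mulmxBr addrACA -opprD (lbr_anti _ KK) subr0.
  by rewrite -scalemxAl -scalemxAr KSK mulmxA KK mulNmx mul1mx scalerN subrr.
have FY' : foliated_twistor_field D W2 Y'.
  apply: (FT_I aD h oW2) => [e' [_ []]//| |e' a W2e te' a0 /=].
    split; last exact: tY'.
    by apply: (smooth_mkfield hES hc) => [e' [_ []]|].
  have [W'e' [ce' Be']] := W2e.
  have [D1 D2] := FT_E aD h oW' FY W'e' ce' te' a0.
  rewrite -/Yc in D1 D2.
  have KK := twistor_chart h ce' te'.
  have HG' v : 'D_a (fun z => lbr (Gam c z v) (chJ c e')) (c e'.1) = 0 by exact: HB.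
  have dYc := smooth_near_diff (sYc _ W2e).
  have Du : 'D_(a, 0 : EndN) (fun w => pi_N (Yc w).1) (ec c e') = 0.
    rewrite derive_linear; last 2 first.
    - exact: pi_N_linear.
    - by apply: smooth_near_diff; apply: smooth_near_fst; exact: sYc.
    by rewrite (derive_fst _ dYc).
  have d2 := differentiable_snd (ec c e' : E * EndN).
  have Db : 'D_(a, 0 : EndN) b (ec c e') = 0.
    rewrite derive_linear; last 2 first.
    - exact: nE_linear.
    - by apply: smooth_near_diff; apply: smooth_near_mulmx => //; exact: s1.
    rewrite (derive_mulmx _ d2 (smooth_near_diff (s1 _ W2e))) Du mulmx0 addr0.
    by rewrite derive_is_snd mul0mx nE0.
  have Fb : pi_N ('D_(a, 0 : EndN) b (ec c e')) = 0 by rewrite Db pi_N0.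
  have DL f : smooth_near (ec c e' : E * EndN) f ->
      pi_N ('D_(a, 0 : EndN) f (ec c e')) = 0 ->
      'D_(a, 0 : EndN) (fun w => lbr (Gam c w.1 (f w)) w.2) (ec c e') = 0.
    by move=> sf F0; apply: derive_Gam.
  have sYc1 : smooth_near (ec c e' : E * EndN) (fun w => (Yc w).1).
    by apply: smooth_near_fst; exact: sYc.
  have DS : 'D_(a, 0 : EndN) S (ec c e') = 0.
    rewrite (@deriveD _ _ _ (fun w => (Yc w).2) (fun w => lbr (Gam c w.1 (Yc w).1) w.2)); last 2 first.
    - by apply: smooth_near_derivable; apply: smooth_near_snd; exact: sYc.
    - by apply: smooth_near_derivable; exact: (smooth_Gam h ce').
    rewrite (derive_snd _ dYc) D2 add0r; apply: DL => //.
    by rewrite (derive_fst _ dYc).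
  have sL := smooth_Gam h ce' (sb _ W2e).
  have dKS := smooth_near_diff (sKS _ W2e).
  have seKS : smooth_near (ec c e' : E * EndN) (fun w => eps *: (w.2 *m S w)).
    by apply: smooth_nearZ; [exact: smooth_near_cst|exact: sKS].
  have dF2 := smooth_near_diff (smooth_nearB seKS sL).
  have DF := derive_pair (a, 0 : EndN) (smooth_near_diff (sb _ W2e)) dF2.
  have rF := near_eq_derive (a, 0 : EndN) (field_rep_mkfield hES F hc ce').
  rewrite (etrans rF DF) /= Fb; split => //.
  rewrite (@deriveB _ _ _ (fun w => eps *: (w.2 *m S w))); last 2 first.
  - exact: smooth_near_derivable.
  - exact: smooth_near_derivable.
  rewrite (DL _ (sb _ W2e) Fb) subr0.
  have dc : differentiable (fun _ : E * EndN => eps) (ec c e') by exact: differentiable_cst.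
  rewrite (derive_scale _ dc dKS) (derive_cst eps) scale0r add0r.
  rewrite (derive_mulmx _ d2 (smooth_near_diff (sS _ W2e))) DS mulmx0 addr0.
  by rewrite derive_is_snd mul0mx scaler0.
have W2e : W2 e by [].
exists W2, Y'; split => //; first by move=> e' [/W'W].
move=> e' W2e' te'; have [W'e' [ce' _]] := W2e'.
have KK := twistor_chart h ce' te'.
apply/(Nhat_chart aD _ h ce' te' (tY' _ W2e' te')); rewrite Y'E//.
have [N1 N2] := (Nhat_chart aD _ h ce' te' (tY _ W'e' te')).1 (NY _ W'e' te').
rewrite -YcE// in N1 N2; split.
  rewrite [(F _).1]/(b _) /b pi_nE -N1 -!nfr_mul [(ec c e').2](chJE h ce').
  by rewrite !mulmxA -[_ *m nfrV c _ *m nfr c _]mulmxA nfrK// mulmx1.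
have SE : S (ec c e') = ver D c e' (Yc (ec c e')).
  by rewrite /S /ver /Gam /= (ga_can hX h ce').
have -> : ver D c e' (F (ec c e')) = eps *: (chJ c e' *m S (ec c e')).
  rewrite /ver /F /= -[nframe _ _ *m _ *m _]/(chJ c e') /Gam /= (ga_can hX h ce').
  by rewrite subrK.
by rewrite -scalemxAr -scalemxAl SE -N2 (chJE h ce') conj_mul.
Qed.

(* The composite of the two structures is (v, A) |-> (- v, A), so vertical and
   horizontal components of foliated sections can be separated. *)
Lemma projectable_commutator :
  projectable D (@I1 R p m M) -> projectable D (@I2 R p m M) ->
  forall c x a v K, fm_atlas c -> cdom c x -> pi_N a = 0 -> K *m K = - 1%:M ->
  'D_a (fun z => lbr (Gam c z v) K) (c x) = 0.
Proof.
move=> P1 P2 c x a v K h cx a0 KK; have hc := ec_atlas h.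
pose W : set ES := cdom (ec c).
have oW : chart_open W by exact: (chart_open_cdom hES).
(* Constant components make [Y] foliated, while its vertical part is the commutator [[Gamma(v), J]]
   itself. *)
pose Y := mkfield (X := ES) (ec c) (cst (v, 0 : EndN)).
have YE e' : cdom c e'.1 -> ecoord (ec c) e' (Y e') = (v, 0).
  by move=> ce'; exact: mkfield_coord.
have tY : twistor_field W Y.
  split; first by apply: (smooth_mkfield hES hc) => // e' _; exact: smooth_near_cst.
  move=> e' ce' te'; apply/(tangent_chart (Y e') h ce' te').
  by rewrite YE// mul0mx mulmx0 addr0.
have FY : foliated_twistor_field D W Y.
  apply: (FT_I aD h oW) => // e' b ce' te' b0 /=.
  rewrite (near_eq_derive _ (field_rep_mkfield hES (cst (v, 0 : EndN)) hc ce')) derive_cst /=.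
  by rewrite pi_N0.
pose s (e' : ES) : N * EndN := (pi_N (Y e').1, ver D (pch e'.1) e' (Y e')).
have NY e' : W e' -> twistor e' -> Nhat_proj D e' (Y e') (s e').
  move=> ce' te'; have [_ tYe] := tY; have [hp px] := ga_pchart hX e'.1.
  apply/(Nhat_chart aD _ hp px te' (tYe _ ce' te')).
  rewrite ncd_pchart pch_coord nfr_pchart mul1mx; split => //.
  by rewrite -[nfrV _ _]mul1mx -[1%:M](nfr_pchart e'.1) nfrVK// mulmx1.
have Fs : foliated_Nhat_section D W s.
  move=> e' ce' te'; exists W, Y.
  by split; [exact: oW|exact: ce'|by []|exact: FY|exact: NY].
have Fs' := P1 _ _ oW (P2 _ _ oW Fs).
pose e : ES := (x, nfrV c x *m K *m nfr c x).
have eE : ec c e = (c x, K).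
  rewrite (@ec_to _ _ _ M c e h cx) /= !mulmxA nfrVK// mul1mx.
  by rewrite -mulmxA nfrVK// mulmx1.
have te : twistor e.
  rewrite /twistor /mkset /=; apply: (conj_inj h cx); rewrite -(conj_mul _ _ h cx).
  have KE : nfr c x *m (nfrV c x *m K *m nfr c x) *m nfrV c x = K.
    by rewrite !mulmxA nfrVK// mul1mx -mulmxA nfrVK// mulmx1.
  by rewrite KE KK mulmxN mulNmx mulmx1 nfrVK.
have [W' [Y' [oW' W'e W'W FY' NY']]] := Fs' e cx te.
have [[sY' tY'] _] := FY'.
have [_ D2] := FT_E aD h oW' FY' W'e cx te a0.
rewrite eE in D2.
have sYc' : smooth_near (c x, K) (field_rep (ec c) Y').
  by rewrite -eE; exact: (smooth_field_near oW' sY' hc W'e cx).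
have dY' := smooth_near_diff sYc'.
have dp : differentiable (fun z : E => (z, K)) (c x).
  by apply: differentiable_pair; [exact: smooth_near_diff (smooth_near_id _)|exact: differentiable_cst].
have Dp : 'D_a (fun z : E => (z, K)) (c x) = (a, 0).
  rewrite derive_pair; last 2 first.
  - exact: smooth_near_diff (smooth_near_id _).
  - exact: differentiable_cst.
  by rewrite derive_id (derive_cst K).
(* [Y'] lifts the image [(- u, B)] of [(u, B)] with [B = [Gamma(v), K]], so its endomorphism
   component is [B - [Gamma(- v), K]], twice the commutator; along leaves it is constant because
   [Y'] is foliated. *)
have nW : \forall z \near c x, (field_rep (ec c) Y' (z, K)).2 = 2 *: lbr (Gam c z v) K.
  have nW1 : \forall w \near ec c e,
      [/\ W' (cof (ec c) w), cdom (ec c) (cof (ec c) w) & ec c (cof (ec c) w) = w].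
    exact: (near_chart_open hES oW' hc W'e cx).
  rewrite eE in nW1.
  have cp := differentiable_continuous dp.
  have nW2 : \forall z \near c x,
      [/\ W' (cof (ec c) (z, K)), cdom (ec c) (cof (ec c) (z, K)) & ec c (cof (ec c) (z, K)) = (z, K)].
    exact: (cp _ nW1).
  apply: filterS nW2 => z [W1 c1 zE].
  set e' := cof (ec c) (z, K) in W1 c1 zE.
  have K' : chJ c e' = K by rewrite /chJ zE.
  have te' : twistor e'.
    rewrite /twistor /mkset; apply: (conj_inj h c1); rewrite -(conj_mul _ _ h c1).
    by rewrite -(chJE h c1) K' KK mulmxN mulNmx mulmx1 nfrVK.
  have := (Nhat_chart aD _ h c1 te' (tY' _ W1 te')).1 (NY' _ W1 te').
  have [_ tYe] := tY.
  have [M1 M2] := (Nhat_chart aD _ h c1 te' (tYe _ c1 te')).1 (NY _ c1 te').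
  rewrite -zE (field_rep_at hES Y' hc c1); move: (ecoord (ec c) e' (Y' e')) => cc.
  rewrite /I1 /I2 /=; move=> [H1 H2].
  have JJ : e'.2 *m e'.2 = - 1%:M by exact: te'.
  have F1 : pi_N (cc.1 + v) = 0.
    rewrite pi_ND -H1 mulmxA JJ mulNmx mul1mx.
    by move: M1; rewrite YE//= => <-; rewrite -!nfr_mul mulmxN addNr.
  have GE : christoffel D c e'.1 cc.1 = - christoffel D c e'.1 v.
    have L := christoffel_linear openT hD h I c1.
    have := christoffel_F openT aD h I c1 F1.
    have -> : cc.1 + v = 1 *: cc.1 + v by rewrite scale1r.
    by rewrite L scale1r => /eqP; rewrite addr_eq0 => /eqP.
  move: H2; rewrite mulmxN mulmxA JJ mulNmx opprK mul1mx M2 YE// /ver /= add0r K' GE.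
  have -> : e'.1 = cof c z by [].
  rewrite /Gam => H2; have -> : cc.2 = lbr (christoffel D c (cof c z) v) K
     - lbr (- christoffel D c (cof c z) v) K by rewrite H2 addrK.
  by rewrite /lbr mulNmx mulmxN; apply/matrixP => i j; rewrite !mxE; ring.
have E2 := near_eq_derive a nW.
have d2Y : differentiable (fun w => (field_rep (ec c) Y' w).2) (c x, K).
  by apply: smooth_near_diff; exact: smooth_near_snd.
have := @derive_comp R _ _ _ (c x) a (fun z => (z, K)) (fun w => (field_rep (ec c) Y' w).2) dp d2Y.
rewrite Dp E2 (derive_snd _ dY') D2.
have dG : differentiable (fun z => lbr (Gam c z v) K) (c x).
  apply: smooth_near_diff; apply: smooth_near_lbr; last exact: smooth_near_cst.
  exact: (christoffel_smooth openT hD v h I cx).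
have d2c : differentiable (fun _ : E => 2 : R) (c x) by exact: differentiable_cst.
rewrite (derive_scale _ d2c dG) (derive_cst (2 : R)) scale0r add0r.
by move=> /eqP; rewrite scaler_eq0 pnatr_eq0/= => /eqP.
Qed.

End Criterion.

(** * Foliated forms *)

Section ComplexStructures.
Context {R : realType}.

(** The standard structure has a nonzero entry off the diagonal; conjugation by a permutation moves
    it to position [(j, i)]. *)
Lemma exists_complex_structure n q (i j : 'I_n) : n = (q + q)%N -> i != j ->
  exists K : 'M[R]_n, K *m K = - 1%:M /\ K j i != 0.
Proof.
move=> nE; subst n => ij; case: q i j ij => [|q] i j ij; first by case: i {ij}.
pose J0 : 'M[R]_(q.+1 + q.+1) := block_mx 0 (- 1%:M) 1%:M 0.
have JJ : J0 *m J0 = - 1%:M.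
  rewrite /J0 mulmx_block !mulmx0 !mul0mx !mul1mx !mulmx1 !addr0 !add0r.
  by rewrite (scalar_mx_block _ _ 1) opp_block_mx !oppr0.
pose i0 : 'I_(q.+1 + q.+1) := lshift _ ord0.
pose j0 : 'I_(q.+1 + q.+1) := rshift _ ord0.
have ij0 : i0 != j0 by rewrite /i0 /j0 eq_lrshift.
(* The second transposition brings the image of [j] to [j0] and fixes [i0], since [s1 j] and [j0]
   both differ from [i0]. *)
pose s1 := tperm i i0; pose s := (s1 * tperm (s1 j) j0)%g.
have si : s i = i0.
  rewrite permM tpermL; apply: tpermD; last by rewrite eq_sym.
  by rewrite -(tpermL i i0) (inj_eq perm_inj) eq_sym.
have sj : s j = j0 by rewrite permM tpermL.
exists (\matrix_(a, b) J0 (s a) (s b)); split; last first.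
  by rewrite mxE si sj /J0 block_mxEdl mxE eqxx oner_neq0.
apply/matrixP => a b; rewrite !mxE.
have := congr1 (fun T : 'M[R]_(q.+1 + q.+1) => T (s a) (s b)) JJ.
rewrite !mxE (inj_eq perm_inj) => <-.
by rewrite [RHS](reindex_inj (@perm_inj _ s)); apply: eq_bigr => k _; rewrite !mxE.
Qed.

(* For an elementary matrix e of square zero, K and its conjugates by 1 + e and 1 - e
   yield e K e, a nonzero multiple of an elementary matrix for a suitable K. *)
Lemma commute_complex_scalar n q (A : 'M[R]_n) : n = (q + q)%N -> (0 < n)%N ->
  (forall K : 'M[R]_n, K *m K = - 1%:M -> A *m K - K *m A = 0) ->
  A = (\tr A / n%:R)%:M.
Proof.
move=> nE n0 H.
have comm i j : i != j -> A *m delta_mx i j = delta_mx i j *m A.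
  move=> ij; have [K [KK Kji]] := exists_complex_structure nE ij.
  pose e : 'M[R]_n := delta_mx i j.
  have ee : e *m e = 0 by rewrite /e mul_delta_mx_cond eq_sym (negbTE ij) mulr0n.
  have eKe : e *m K *m e = K j i *: e.
    apply/matrixP => a b; rewrite mxE (bigD1 i)//= big1 ?addr0; last first.
      by move=> k ki; rewrite [e k b]mxE (negbTE ki)/= mulr0.
    rewrite mxE (bigD1 j)//= big1 ?addr0; last first.
      by move=> k kj; rewrite [e a k]mxE (negbTE kj) andbF mul0r.
    by rewrite !mxE !eqxx/= andbT; case: (a == i); case: (b == j); rewrite /= ?(mulr1, mul1r, mulr0, mul0r).
  have L (f : 'M[R]_n) : f *m f = 0 -> (1%:M + f) *m (1%:M - f) = 1%:M /\
      (1%:M - f) *m (1%:M + f) = 1%:M.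
    move=> ff; rewrite !mulmxDl !mulmxDr !mul1mx !mulmx1 !mulNmx !mulmxN ff oppr0.
    by rewrite !addr0 subrK addrK.
  have C (f : 'M[R]_n) : f *m f = 0 ->
      A *m ((1%:M + f) *m K *m (1%:M - f)) = (1%:M + f) *m K *m (1%:M - f) *m A.
    move=> ff; have [_ l2] := L f ff; apply/eqP; rewrite -subr_eq0; apply/eqP; apply: H.
    rewrite !mulmxA -[_ *m (1%:M - f) *m (1%:M + f)]mulmxA l2 mulmx1.
    rewrite -[_ *m K *m K]mulmxA KK mulmxN mulmx1 mulNmx.
    by have [-> _] := L f ff.
  have E1 := C e ee.
  have E2 := C (- e); rewrite mulNmx mulmxN !opprK in E2; have {}E2 := E2 ee.
  have AK : A *m K = K *m A by apply/eqP; rewrite -subr_eq0; apply/eqP; exact: H.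
  have EE : (1%:M + e) *m K *m (1%:M - e) + (1%:M - e) *m K *m (1%:M + e)
      = 2 *: K - 2 *: (e *m K *m e).
    rewrite !mulmxDl !mulmxDr !mul1mx !mulmx1 !mulNmx !mulmxN.
    move: (e *m K *m e) (K *m e) (e *m K) => b1 b2 b3.
    by apply/matrixP => a b; rewrite !mxE; ring.
  have : A *m ((1%:M + e) *m K *m (1%:M - e) + (1%:M - e) *m K *m (1%:M + e)) =
      ((1%:M + e) *m K *m (1%:M - e) + (1%:M - e) *m K *m (1%:M + e)) *m A.
    by rewrite [A *m _]mulmxDr [RHS]mulmxDl E1 E2.
  rewrite EE eKe mulmxBr mulmxBl -!scalemxAr -!scalemxAl AK => /addrI/oppr_inj.
  by rewrite !scalerA => /scalerI; apply; rewrite mulf_neq0// pnatr_eq0.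
have offd k i : k != i -> A k i = 0.
  move=> ki; have ik : i != k by rewrite eq_sym.
  have := congr1 (fun T : 'M[R]_n => T k k) (comm i k ik).
  rewrite !mxE (bigD1 i)//= big1 ?addr0; last first.
    by move=> a ai; rewrite mxE (negbTE ai)/= mulr0.
  rewrite mxE !eqxx/= mulr1 => ->; rewrite big1// => a _.
  by rewrite mxE (negbTE ki)/= mul0r.
have dg i j : A i i = A j j.
  have [->//|ij] := eqVneq i j.
  have := congr1 (fun T : 'M[R]_n => T i j) (comm i j ij).
  rewrite !mxE (bigD1 i)//= big1 ?addr0; last first.
    by move=> a ai; rewrite mxE (negbTE ai)/= mulr0.
  rewrite mxE !eqxx/= mulr1 => ->; rewrite (bigD1 j)//= big1 ?addr0; last first.
    by move=> a aj; rewrite mxE (negbTE aj) andbF mul0r.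
  by rewrite mxE !eqxx/= mul1r.
pose i0 := Ordinal n0.
have trE : \tr A = n%:R * A i0 i0.
  rewrite /mxtrace (eq_bigr (fun=> A i0 i0)) => [|i _]; last exact: dg.
  by rewrite sumr_const card_ord mulr_natl.
apply/matrixP => i j; rewrite !mxE trE mulrAC divff ?pnatr_eq0 -?lt0n// mul1r.
by have [->|ij] := eqVneq i j; rewrite ?mulr1n ?mulr0n; [exact: dg|exact: offd].
Qed.

End ComplexStructures.

(** * Forms on the slice spaces *)

Section Forms.
Context {R : realType} {p m : nat} (M : foliated_manifold R p m).
Notation E := 'cV[R]_(p + m).
Notation N := 'cV[R]_m.
Notation EndN := 'M[R]_m.
Notation X := (manifold M).
Notation coord := (coord (X := X)).
Notation ncd := (@ncd R p m M).
Notation nvect := (@nvect R p m M).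
Notation nE := (@normal_lift R p m).
Implicit Types (c : chart M E) (x : M) (U : set M).

Let hX := manifold_good M.

(** Balls are convex: the segment between two points with the same slice coordinates stays inside,
    and its direction is tangent to the leaves. *)
Lemma const_on_ball (f : E -> R) (z0 z z' : E) (r : R) :
  (forall w, ball z0 r w -> differentiable f w) ->
  (forall w a, ball z0 r w -> pi_N a = 0 -> 'D_a f w = 0) ->
  ball z0 r z -> ball z0 r z' -> pi_N z = pi_N z' -> f z = f z'.
Proof.
move=> df Df zr z'r zz'.
have seg (s : R) : 0 <= s <= 1 -> ball z0 r (z + s *: (z' - z)).
  move=> /andP[s0 s1]; move: zr z'r; rewrite -ball_normE /= => zr z'r.
  have -> : z0 - (z + s *: (z' - z)) = (1 - s) *: (z0 - z) + s *: (z0 - z').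
    rewrite scalerBl scale1r !scalerBr; apply/matrixP => i j; rewrite !mxE; ring.
  apply: (le_lt_trans (ler_normD _ _)); rewrite !normrZ !ger0_norm ?subr_ge0//.
  have [->|s0'] := eqVneq s 0; first by rewrite mul0r addr0 subr0 mul1r.
  have sp : 0 < s by rewrite lt_def s0' s0.
  apply: (@lt_le_trans _ _ ((1 - s) * r + s * r)); last by rewrite -mulrDl subrK mul1r.
  apply: ler_ltD; last by rewrite ltr_pM2l.
  by rewrite ler_wpM2l ?subr_ge0// ltW.
have [s|s /andP[s0 s1]] := @MVT_dir R E f z (z' - z) 1 ltr01.
  by move=> /seg; exact: df.
rewrite scale1r [z + _]addrC subrK Df; last 2 first.
- by apply: seg; rewrite !ltW.
- by rewrite pi_NB zz' subrr.
by rewrite mulr0 => /eqP; rewrite subr_eq0 => /eqP.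
Qed.

(** The image is a full ball, so that the plaques in [U'] are connected and leafwise constant
    functions factor through the slice. *)
Lemma box c x U : open U -> fm_atlas c -> cdom c x -> U x ->
  exists U' r, [/\ open U', U' x, U' `<=` U `&` cdom c, 0 < r & c @` U' = ball (c x) r].
Proof.
move=> oU h cx Ux.
have [r /= r0 Hr] := (nbhs_ballP (c x) _).1
  (open_nbhs_nbhs (conj (open_chart_open oU h) (ex_intro2 _ _ x (conj Ux cx) erefl))).
have inU y : cdom c y -> ball (c x) r (c y) -> U y.
  move=> cy /Hr[y' [Uy' cy'] yy'].
  by rewrite -(ga_can hX h cy) -yy' (ga_can hX h cy').
pose U' := [set y | cdom c y /\ ball (c x) r (c y)].
exists U', r; split => //.
- by apply: open_pre => //; exact: ball_open.
- by split => //; exact: ballxx.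
- by move=> y [cy By]; split => //; exact: inU.
- apply/seteqP; split=> [_ [y [cy By] <-]//|z /[dup] Bz /Hr[y [Uy cy] yz]].
  by exists y => //; split => //; rewrite yz.
Qed.

(** The transversal through [z0]: a section of the projection to the slice, which turns functions on
    the chart into functions on the slice. *)
Definition slice_lift (z0 : E) (y : N) : E := col_mx (usubmx z0) y.

Lemma pi_slice_lift z0 y : pi_N (slice_lift z0 y) = y.
Proof. by rewrite /pi_N /slice_lift col_mxKd. Qed.

(** Balls are taken entrywise, so replacing the leaf coordinates by those of the center does not
    leave the ball. *)
Lemma ball_slice_lift z0 r w : ball z0 r w -> ball z0 r (slice_lift z0 (pi_N w)).
Proof.
move=> [r0 H]; split => // i j; rewrite /slice_lift mxE.
case: splitP => k ik.
  have -> : i = lshift m k by exact: val_inj.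
  by rewrite mxE; exact: ballxx.
have -> : i = rshift p k by exact: val_inj.
by have := H (rshift p k) j; rewrite /pi_N mxE.
Qed.

Lemma smooth_slice_lift z0 y : smooth_near y (slice_lift z0).
Proof.
apply: (@smooth_near_eq _ _ _ _ (fun y => col_mx (usubmx z0) 0 + nE y)).
  by move=> y'; rewrite /slice_lift /normal_lift add_col_mx addr0 add0r.
apply: smooth_nearD; first exact: smooth_near_cst.
by apply: smooth_near_linear; [exact: nE_linear|exact: smooth_near_id].
Qed.

Section Box.
Variables (c : chart M E) (x : M) (U' : set M) (r : R).
Hypothesis (cU : c @` U' = ball (c x) r).

Lemma slice_image y : (slice c @` U') y -> ball (c x) r (slice_lift (c x) y).
Proof.
move=> [z U'z <-]; apply: ball_slice_lift.
by rewrite -cU; exists z.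
Qed.

Lemma slice_smooth k l (f : E -> 'M[R]_(k, l)) :
  (forall w, ball (c x) r w -> smooth_near w f) ->
  smooth_on (slice c @` U') (fun y => f (slice_lift (c x) y)).
Proof.
move=> sf; apply: smooth_onP => y /slice_image By.
by apply: smooth_near_comp; [exact: smooth_slice_lift|exact: sf].
Qed.

Lemma slice_const k l (f : E -> 'M[R]_(k, l)) y : U' y ->
  (forall w, ball (c x) r w -> smooth_near w f) ->
  (forall w a, ball (c x) r w -> pi_N a = 0 -> 'D_a f w = 0) ->
  f (c y) = f (slice_lift (c x) (slice c y)).
Proof.
move=> U'y sf Ff; have By : ball (c x) r (c y) by rewrite -cU; exists y.
apply/matrixP => i j; apply: (@const_on_ball (fun z => f z i j) (c x) _ _ r) => //.
- by move=> w /sf/smooth_near_diff; exact: differentiable_entry.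
- by move=> w a Bw a0; rewrite derive_entry ?Ff ?mxE//; exact: smooth_near_diff (sf _ Bw).
- exact: ball_slice_lift.
- by rewrite pi_slice_lift.
Qed.

End Box.

(** The form on the slice is found by restricting the coefficients to the transversal through [x];
    constancy along plaques recovers them elsewhere. *)
Lemma one_formI U (phi : one_form M) : open U ->
  (forall x, U x -> exists c (a : E -> 'rV[R]_m), [/\ fm_atlas c, cdom c x &
    forall y, U y -> cdom c y -> [/\ smooth_near (c y) a,
      forall b, pi_N b = 0 -> 'D_b a (c y) = 0 &
      forall v, phi y v = (a (c y) *m pi_N (coord c y v)) 0 0]]) ->
  foliated_one_form U phi.
Proof.
move=> oU H x Ux; have [c [a [h cx Ha]]] := H x Ux.
have [U' [r [oU' U'x U'U r0 cU]]] := box oU h cx Ux.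
have Hw w : ball (c x) r w -> exists2 y, U y /\ cdom c y & c y = w.
  by rewrite -cU => -[y /U'U ? <-]; exists y.
have sa w : ball (c x) r w -> smooth_near w a by move=> /Hw[y [Uy cy] <-]; have [] := Ha y Uy cy.
have Fa w b : ball (c x) r w -> pi_N b = 0 -> 'D_b a w = 0.
  by move=> /Hw[y [Uy cy] <-]; have [_ + _] := Ha y Uy cy; exact.
exists c, U', (fun y => a (slice_lift (c x) y)); split => //; split.
  exact: (slice_smooth cU).
move=> y v U'y; have [Uy cy] := U'U _ U'y; have [_ _ ->] := Ha y Uy cy.
by rewrite (slice_const cU U'y sa Fa).
Qed.

Lemma two_formI U (om : two_form M) : open U ->
  (forall x, U x -> exists c (Om : E -> N -> N -> N), [/\ fm_atlas c, cdom c x &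
    forall y, U y -> cdom c y -> [/\ forall a b, smooth_near (c y) (fun z => Om z a b),
      forall a b e, pi_N e = 0 -> 'D_e (fun z => Om z a b) (c y) = 0,
      forall a, linear (Om (c y) a),
      forall a b, Om (c y) a b = - Om (c y) b a &
      forall v w, ncd c y (om y v w) = Om (c y) (pi_N (coord c y v)) (pi_N (coord c y w))]]) ->
  foliated_two_form U om.
Proof.
move=> oU H x Ux; have [c [Om [h cx Ha]]] := H x Ux.
have [U' [r [oU' U'x U'U r0 cU]]] := box oU h cx Ux.
have Hw w : ball (c x) r w -> exists2 y, U y /\ cdom c y & c y = w.
  by rewrite -cU => -[y /U'U ? <-]; exists y.
have sa a b w : ball (c x) r w -> smooth_near w (fun z => Om z a b).
  by move=> /Hw[y [Uy cy] <-]; have [] := Ha y Uy cy.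
have Fa a b w e : ball (c x) r w -> pi_N e = 0 -> 'D_e (fun z => Om z a b) w = 0.
  by move=> /Hw[y [Uy cy] <-]; have [_ + _ _ _] := Ha y Uy cy; exact.
exists c, U', (fun y => Om (slice_lift (c x) y)); split.
- by split.
- by move=> a b; apply: (slice_smooth cU (f := fun z => Om z a b)); exact: sa.
- by move=> y a /(slice_image cU)/Hw[y' [Uy cy] <-]; have [_ _ + _ _] := Ha y' Uy cy; exact.
- by move=> y a b /(slice_image cU)/Hw[y' [Uy cy] <-]; have [_ _ _ + _] := Ha y' Uy cy; exact.
move=> y v w U'y; have [Uy cy] := U'U _ U'y; have [_ _ _ _ Hy] := Ha y Uy cy.
rewrite ncdE Hy.
exact: (slice_const cU U'y (sa _ _) (Fa _ _)).
Qed.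

(** The 2-form as a 1-form with values in End(N), in which shape [addc] can add it to a
    connection. *)
Definition form_tensor (t : two_form M) (x : M) (v : E) : EndN :=
  \matrix_(i, j) t x v (nE (delta_mx j 0)) i 0.

Lemma two_formE U (t : two_form M) x : foliated_two_form U t -> U x ->
  exists c U', [/\ fm_atlas c, open U', U' x, U' `<=` U `&` cdom c &
    forall y, U' y -> [/\ forall v w, form_tensor t y v *m w = t y v (nE w),
      linear (form_tensor t y),
      forall v, pi_N v = 0 -> form_tensor t y v = 0,
      forall a, smooth_near (c y) (fun z => crep c (form_tensor t) z a) &
      forall a e, pi_N e = 0 -> 'D_e (fun z => crep c (form_tensor t) z a) (c y) = 0]].
Proof.
move=> Ft Ux; have [c [U' [th [[h oU' U'x U'U] sth lth kth tE]]]] := Ft x Ux.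
exists c, U'; split => // y U'y; have [Uy cy] := U'U _ U'y.
have sl y' : U' y' -> (slice c @` U') (pi_N (c y')) by move=> ?; exists y'.
have tE' y' v w : U' y' -> t y' v w = nvect c y'
    (th (pi_N (c y')) (pi_N (coord c y' v)) (pi_N (coord c y' w))).
  move=> U'y'; have [_ cy'] := U'U _ U'y'.
  by rewrite -tE// ncdE ncdK.
have lt y' v : U' y' -> linear (fun w => t y' v (nE w)).
  move=> U'y' a u w; have [_ cy'] := U'U _ U'y'; rewrite !tE'// !pi_coord// !pi_nE ncd_linear.
  by rewrite lth ?nvect_linear//; exact: sl.
have BE y' v w : U' y' -> form_tensor t y' v *m w = t y' v (nE w).
  by move=> U'y'; rewrite /form_tensor (linear_mx _ (lt y' v U'y')).
have cE y' a w : U' y' -> crep c (form_tensor t) (c y') a *m w = th (pi_N (c y')) (pi_N a) w.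
  move=> U'y'; have [_ cy'] := U'U _ U'y'; rewrite /crep (ga_can hX h cy').
  rewrite -!mulmxA nfrV_mul BE// nfr_mul tE'// nvectK// (vectK hX _ h cy') pi_coord//.
  by rewrite pi_nE nvectK.
have entry (A : EndN) i j : A i j = (A *m (delta_mx j 0 : N)) i 0.
  by rewrite -colE mxE.
have ny : \forall z \near c y, forall a w, crep c (form_tensor t) z a *m w = th (pi_N z) (pi_N a) w.
  by apply: filterS (near_open h oU' U'y cy) => z [Uz cz zE] a w; rewrite -zE cE.
have oc : open (c @` U').
  have := open_chart_open oU' h; rewrite (_ : U' `&` cdom c = U')//.
  by apply/seteqP; split => [z []//|z Uz]; split => //; have [] := U'U _ Uz.
have spi (a b : N) : smooth_near (c y) (fun z : E => th (pi_N z) a b).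
  apply: (@smooth_on_near _ _ _ (c @` U')) => //.
  apply: (@smooth_on_comp _ _ _ _ _ (slice c @` U') (@pi_N R p m) (fun z => th z a b)) => //.
    by move=> _ [y' U'y' <-]; exact: sl.
  apply: smooth_onP => z _; apply: (@smooth_near_linear _ E E N z (@pi_N R p m) id) => //.
    exact: pi_N_linear.
  exact: smooth_near_id.
have sc a : smooth_near (c y) (fun z => crep c (form_tensor t) z a).
  apply: smooth_near_mx => i j.
  apply: (@smooth_near_ext _ _ _ _ (fun z => th (pi_N z) (pi_N a) (delta_mx j 0) i 0)).
    by apply: filterS ny => z nz; rewrite entry nz.
  exact: smooth_near_coord.
split => //.
- by move=> v w; exact: BE.
- move=> a u v; apply: mx_eq => w; rewrite mulmxDl -scalemxAl !BE// !tE'//.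
  have sk := kth (pi_N (c y)) _ _ (sl _ U'y).
  rewrite sk [th _ (pi_N (coord c y u)) _]sk [th _ (pi_N (coord c y v)) _]sk.
  have -> : pi_N (coord c y (a *: u + v)) = a *: pi_N (coord c y u) + pi_N (coord c y v).
    by rewrite (@coord_linear R E X) pi_N_linear.
  rewrite (lth _ _ (sl _ U'y)) -!nfrV_mul !mulmxN mulmxDr -scalemxAr opprD scalerN.
  by [].
- move=> v v0; apply: mx_eq => w; rewrite BE// tE'// mul0mx coord_F//.
  rewrite kth; last exact: sl.
  have -> : th (pi_N (c y)) (pi_N (coord c y (nE w))) 0 = 0.
    have := lth _ (pi_N (coord c y (nE w))) (sl _ U'y) 1 0 0.
    by rewrite scale1r add0r scale1r => /eqP; rewrite -subr_eq0 opprD addNKr oppr_eq0 => /eqP.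
  by rewrite oppr0 -nfrV_mul mulmx0.
- move=> a e e0; apply/matrixP => i j; rewrite -derive_entry; last exact: smooth_near_diff.
  rewrite (@near_eq_derive _ _ _ _ (fun z => th (pi_N z) (pi_N a) (delta_mx j 0) i 0)); last first.
    by apply: filterS ny => z nz; rewrite entry nz.
  rewrite (@derive_entry _ _ _ _ _ _ (fun z => th (pi_N z) (pi_N a) (delta_mx j 0))); last first.
    by apply: smooth_near_diff; exact: spi.
  have dpi : differentiable (@pi_N R p m) (c y).
    apply: smooth_near_diff; apply: (@smooth_near_linear _ E E N _ (@pi_N R p m) id) => //.
      exact: pi_N_linear.
    exact: smooth_near_id.
  have dth : differentiable (fun z => th z (pi_N a) (delta_mx j 0)) (pi_N (c y)).
    by have [+ _] := sth (pi_N a) (delta_mx j 0) 1%N; apply; exact: sl.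
  have := derive_comp e dpi dth => ->.
  have -> : 'D_e (@pi_N R p m) (c y) = 0.
    have pl : linear (@pi_N R p m) by exact: pi_N_linear.
    rewrite (@derive_linear _ E E N (c y) e (@pi_N R p m) id _ pl (smooth_near_diff (smooth_near_id _))).
    by rewrite derive_id.
  by rewrite derive0 !mxE.
Qed.

End Forms.

(** * Gluing connections *)

Section Partition.
Context {R : realType} {p m : nat} (M : foliated_manifold R p m).
Notation E := 'cV[R]_(p + m).
Notation N := 'cV[R]_m.
Notation X := (manifold M).
Implicit Types (c : chart M E) (x : M) (U : set M) (s t : M -> N) (D : connection_op M).

Let hX := manifold_good M.

Definition bump_on U (b : M -> R) (S O : set M) : Prop :=
  [/\ smooth_map (X := X) setT b, closed S /\ S `<=` U, open O,
      forall y, ~ S y -> b y = 0 & forall y, O y -> b y = 1].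

Lemma chart_bump x U : open U -> U x -> exists b S O, bump_on U b S O /\ O x.
Proof.
move=> oU Ux; have [h cx] := ga_pchart hX x.
set c := pchart (c := X) x in h cx.
have [U' [r [oU' U'x U'U r0 cU]]] := box oU h cx Ux.
have d0 : 0 < r / 2 by rewrite divr_gt0.
have [b [sb [V [oV Vc] bV] b0]] := bump (c x) d0.
set K := [set z : E | forall i j, `|z i j - c x i j| <= r / 2] in b0.
have Kr : K `<=` ball (c x) r.
  move=> z Kz; split => // i j; rewrite -ball_normE /= distrC.
  by apply: (le_lt_trans (Kz i j)); rewrite ltr_pdivrMr// ltr_pMr// ltr1n.
have Kc z : K z -> (c @` cdom c) z.
  by move=> /Kr; rewrite -cU => -[y /U'U[_ cy] <-]; exists y.
pose S := cof c @` K.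
have Sc y : S y -> [/\ U y, cdom c y & K (c y)].
  move=> [z Kz <-]; have := Kr _ Kz; rewrite -cU => -[y' /U'U[Uy cy] zE].
  by rewrite -zE (ga_can hX h cy) zE.
have cS y : cdom c y -> K (c y) -> S y.
  by move=> cy Ky; exists (c y) => //; exact: (ga_can hX h cy).
(* Closedness is needed in [M], not just in the chart: [S] is the continuous image of a compact box
   and [M] is Hausdorff. *)
have clS : closed S.
  apply: (compact_closed (@fm_hausdorff _ _ _ M)).
  apply: continuous_compact; last exact: compact_box.
  apply: continuous_in_subspaceT => z; rewrite inE => /Kc.
  by have [_ _ _ _] := fm_chart h; exact.
pose f y : R := if pselect (S y) then b (c y) else 0.
have fE y : cdom c y -> f y = b (c y).
  rewrite /f; case: pselect => // nS cy; apply/esym/eqP; apply/negPn/negP => bn.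
  by apply: nS; apply: cS => //; exact: b0.
exists f, S, [set y | cdom c y /\ V (c y)]; split; last by [].
split.
- apply: smooth_mapI => // y _; have [Sy|Sy] := pselect (S y).
    have [_ cy _] := Sc _ Sy; exists c; split => //.
    apply: (@smooth_near_ext _ _ _ _ b); last exact: sb.
    apply: filterS (near_chart hX h h cy cy) => z [c1 _ c3].
    by rewrite /= fE// c3.
  have [h' cy] := ga_pchart hX y; exists (pchart (c := X) y); split => //.
  apply: (@smooth_near_ext _ _ _ _ (fun=> 0)); last exact: smooth_near_cst.
  have oS : open (~` S) by exact: closed_openC.
  apply: filterS (near_open h' oS Sy cy) => z [nS _ _].
  by rewrite /= /f; case: pselect.
- by split => // y /Sc[].
- exact: open_pre.
- by move=> y Sy; rewrite /f; case: pselect.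
- by move=> y [cy Vy]; rewrite fE// bV.
Qed.

Lemma smooth_map_prod (r : seq nat) (f : nat -> M -> R) :
  (forall n, smooth_map (X := X) setT (f n)) ->
  smooth_map (X := X) setT (fun x => \prod_(i <- r) f i x).
Proof.
move=> sf; apply: (smooth_mapI hX) => x _; have [h cx] := ga_pchart hX x.
exists (pchart (c := X) x); split => //.
elim: r => [|i r IH].
  apply: smooth_near_eq; last exact: (smooth_near_cst _ (1 : R)).
  by move=> z; rewrite /= big_nil.
apply: (@smooth_near_eq _ _ _ _ (fun z => (f i \o cof (pchart (c := X) x)) z *
    ((fun x => \prod_(j <- r) f j x) \o cof (pchart (c := X) x)) z)).
  by move=> z; rewrite /= big_cons.
by apply: smooth_nearM => //; exact: (smooth_map_near (open_chart_open openT) (sf i) h Logic.I cx).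
Qed.

(* rho n = b_n (1 - b_0) ... (1 - b_(n-1)) for a sequence of bump functions b_n
   indexed by a countable basis: no local finiteness argument is needed, since all
   terms after the j-th vanish on the open set O j where b_j = 1. *)
Lemma partition_of_unity (I : Type) (i0 : I) (W : I -> set M) : open_cover W ->
  exists (rho : nat -> M -> R) (S : nat -> set M) (k : nat -> I) (O : nat -> set M),
  [/\ forall n, [/\ smooth_map (X := X) setT (rho n), closed (S n), S n `<=` W (k n) &
        forall x, ~ S n x -> rho n x = 0],
      forall j, open (O j), forall x, exists j, O j x,
      forall j n x, O j x -> (j < n)%N -> rho n x = 0 &
      forall j x, O j x -> \sum_(n < j.+1) rho n x = 1].
Proof.
move=> [oW cW]; have [B cB [Bo Bb]] := @fm_countable _ _ _ M.
have /countable_injP[f finj] := cB.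
pose good (d : I * ((M -> R) * (set M * set M))) :=
  bump_on (W d.1) d.2.1 d.2.2.1 d.2.2.2.
(* [f] numbers the basis. The [n]-th datum must have its basis set as the set where the bump
   function is [1], provided some bump function allows this; otherwise the zero function will do. *)
pose P n d := good d /\ forall V, B V -> f V = n -> (exists2 d', good d' & d'.2.2.2 = V) -> d.2.2.2 = V.
have trivial_good : good (i0, (fun=> 0, (set0, set0))).
  split => //.
  - apply: (smooth_mapI hX) => x _; have [h cx] := ga_pchart hX x.
    by exists (pchart (c := X) x); split => //; exact: smooth_near_cst.
  - by split => //; exact: closed0.
  - exact: open0.
have /choice[d dP] : forall n, exists d, P n d.
  move=> n; have [[V [BV fV [d gd dV]]]|H] := pselect (exists V, [/\ B V, f V = n & exists2 d', good d' & d'.2.2.2 = V]).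
    exists d; split => // V' BV' fV' _; rewrite dV; apply: finj; rewrite ?inE//.
    by rewrite fV.
  exists (i0, (fun=> 0, (set0, set0))); split => // V BV fV dV.
  by case: H; exists V.
pose b n := (d n).2.1.
pose rho n x := b n x * \prod_(0 <= i < n) (1 - b i x).
(* Telescoping: the partial sums miss [1] by a product that vanishes as soon as one factor has
   [b i x = 1]. *)
have sub n x : \sum_(0 <= i < n) rho i x = 1 - \prod_(0 <= i < n) (1 - b i x).
  elim: n => [|n IH]; first by rewrite !big_geq// subrr.
  rewrite !big_nat_recr//= IH /rho; set a := \prod_(_ <= _ < _) _; ring.
have bO j x : (d j).2.2.2 x -> b j x = 1 by have [[_ _ _ _ H] _] := dP j; exact: H.
exists rho, (fun n => (d n).2.2.1), (fun n => (d n).1), (fun n => (d n).2.2.2); split.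
- move=> n; have [[sb [cS SW] _ b0 _] _] := dP n; split => //; last first.
    by move=> x Sx; rewrite /rho /b b0// mul0r.
  apply: (smooth_mapI hX) => x _; have [h cx] := ga_pchart hX x.
  exists (pchart (c := X) x); split => //.
  have sb' i : smooth_map (X := X) setT (b i) by have [[]] := dP i.
  pose g i y := 1 - b i y.
  apply: (@smooth_near_eq _ _ _ _ (fun z => (b n \o cof (pchart (c := X) x)) z *
      ((fun x => \prod_(i <- index_iota 0 n) g i x) \o cof (pchart (c := X) x)) z)) => //.
  apply: smooth_nearM; first exact: (smooth_map_near (open_chart_open openT)).
  apply: (smooth_map_near (open_chart_open openT)) => //; apply: smooth_map_prod.
  move=> i; apply: (smooth_mapI hX) => y _; have [h' cy] := ga_pchart hX y.
  exists (pchart (c := X) y); split => //.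
  by apply: smooth_nearB; [exact: smooth_near_cst|exact: (smooth_map_near (open_chart_open openT))].
- by move=> j; have [[]] := dP j.
- move=> x; have [i Wx] := cW x.
  have [b1 [S1 [Q [g1 Qx]]]] := chart_bump (oW i) Wx.
  have [_ _ oO _ _] := g1.
  have [V [BV Vx] VQ] := Bb x _ (open_nbhs_nbhs (conj oO Qx)).
  exists (f V); have [_ H] := dP (f V); rewrite (H V)//.
  exists (i, (b1, (S1, V))) => //; case: g1 => [h1 h2 h3 h4 h5]; split => //.
    exact: Bo.
  by move=> y /VQ; exact: h5.
- move=> j n x Ox jn; rewrite /rho (big_cat_nat (n := j.+1))//=.
  by rewrite big_nat_recr//= (bO j x Ox) subrr mulr0 mul0r mulr0.
- move=> j x Ox; rewrite -(big_mkord xpredT (fun n => rho n x)) sub.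
  by rewrite big_nat_recr//= (bO j x Ox) subrr mulr0 subr0.
Qed.

End Partition.

(** * Affine combinations of connections *)

Section Mix.
Context {R : realType} {p m : nat} (M : foliated_manifold R p m).
Notation E := 'cV[R]_(p + m).
Notation N := 'cV[R]_m.
Notation X := (manifold M).
Notation ncd := (@ncd R p m M).
Notation sec_rep := (@section_rep R p m M).
Implicit Types (c : chart M E) (x : M) (U : set M) (s t : M -> N).

Let hX := manifold_good M.

Lemma ncd_sum c x n (F : 'I_n -> N) : ncd c x (\sum_(i < n) F i) = \sum_(i < n) ncd c x (F i).
Proof. by rewrite -nfr_mul mulmx_sumr; apply: eq_bigr => i _; rewrite nfr_mul. Qed.

Lemma smooth_map_sub U U' (f : M -> R) : U' `<=` U ->
  smooth_map (X := X) U f -> smooth_map (X := X) U' f.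
Proof.
move=> UU' sf c hc j; apply: Ck_on_sub (sf c hc j).
by move=> _ [x [/UU' Ux cx] <-]; exists x.
Qed.

Variables (I : Type) (W : I -> set M) (D : I -> connection_op M).
Variables (rho : nat -> M -> R) (S : nat -> set M) (k : nat -> I) (O : nat -> set M).
Hypotheses (oW : forall i, open (W i)) (aD : forall i, adapted_connection (W i) (D i)).
Hypothesis rhoP : forall n, [/\ smooth_map (X := X) setT (rho n), closed (S n), S n `<=` W (k n) &
        forall x, ~ S n x -> rho n x = 0].
Hypotheses (oO : forall j, open (O j)) (cO : forall x, exists j, O j x).
Hypothesis rho0 : forall j n x, O j x -> (j < n)%N -> rho n x = 0.
Hypothesis rho1 : forall j x, O j x -> \sum_(n < j.+1) rho n x = 1.

Let J : {J : M -> nat | forall x, O (J x) x}.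
Proof. by have [J JP] := choice cO; exists J. Qed.

(** The sum stops at an index [j] with [x] in [O j], beyond which all weights vanish; by [sum_indep]
    any such index gives the same value. Outside [W (k n)] the operator [D (k n)] is arbitrary, but
    there its weight is zero. *)
Definition mix : connection_op M := fun s x v =>
  \sum_(n < (sval J x).+1) rho n x *: D (k n) s x v.

Lemma sum_indep (V : lmodType R) (F : nat -> V) j j' x : O j x -> O j' x ->
  \sum_(n < j.+1) rho n x *: F n = \sum_(n < j'.+1) rho n x *: F n.
Proof.
wlog jj' : j j' / (j <= j')%N => [H|] Oj Oj'.
  by have [/H|/ltnW/H H'] := leqP j j'; [exact|apply/esym; exact: H'].
rewrite (big_ord_widen j'.+1 (fun n => rho n x *: F n)) ?ltnS// big_mkcond/=.
apply: eq_bigr => i _; case: ltnP => // ji.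
by rewrite (rho0 Oj)// scale0r.
Qed.

Lemma mixE j s x v : O j x -> mix s x v = \sum_(n < j.+1) rho n x *: D (k n) s x v.
Proof. by move=> Oj; exact: (sum_indep (fun n => D (k n) s x v) (svalP J x) Oj). Qed.

(** Two open sets cover: [W (k n)], where the connection is defined, and the complement of the
    closed set [S n], where the term is identically zero. *)
Lemma term_smooth n U s (Y : M -> E) x : open U -> smooth_section U s -> vfield U Y -> U x ->
  smooth_near (pchart (c := X) x x)
    (sec_rep (pchart (c := X) x) (fun y => rho n y *: D (k n) s y (Y y))).
Proof.
move=> oU ss sY Ux; have [h cx] := ga_pchart hX x; have [sr clS SW r0] := rhoP n.
have [/SW Wx|Sx] := pselect (S n x).
  have oUW : open (U `&` W (k n)) by exact: openI.
  apply: (@smooth_section_near _ _ _ _ (U `&` W (k n))) => //.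
  apply: smooth_sectionZ => //.
    exact: smooth_map_sub sr.
  apply: (conn_smooth (proj1 (aD (k n)))) => //.
  - exact: smooth_section_sub ss.
  - exact: vfield_sub sY.
have onS : open (~` S n) by exact: closed_openC.
apply: (@smooth_near_ext _ _ _ _ (fun=> 0)); last exact: smooth_near_cst.
apply: filterS (near_open h onS Sx cx) => z [nS _ _].
by rewrite /section_rep r0// scale0r -nfr_mul mulmx0.
Qed.

Lemma mix_connection : is_connection setT mix.
Proof.
move=> U oU _; have fact n x (P : Prop) : U x -> (W (k n) x -> P) -> (rho n x = 0 -> P) -> P.
  move=> _ H1 H2; have [_ _ SW r0] := rhoP n.
  by have [/SW|/r0] := pselect (S n x); [exact: H1|exact: H2].
split.
- move=> s x ss Ux a u v; rewrite /mix scaler_sumr -big_split/=; apply: eq_bigr => n _.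
  apply: (fact n x) => // [Wx|->]; last by rewrite !scale0r scaler0 addr0.
  have oUW : open (U `&` W (k n)) by exact: openI.
  rewrite (conn_linear (proj1 (aD (k n))) oUW (@subIsetr _ _ _))//.
    by rewrite scalerDr !scalerA mulrC.
  exact: smooth_section_sub ss.
- move=> s t x v ss st Ux; rewrite /mix -big_split/=; apply: eq_bigr => n _.
  apply: (fact n x) => // [Wx|->]; last by rewrite !scale0r addr0.
  have oUW : open (U `&` W (k n)) by exact: openI.
  rewrite (conn_add (proj1 (aD (k n))) _ oUW (@subIsetr _ _ _)) ?scalerDr//.
  - exact: smooth_section_sub ss.
  - exact: smooth_section_sub st.
- move=> f s x v sf ss Ux; rewrite /mix.
  rewrite -[_ *: s x]scale1r -(rho1 (svalP J x)) scaler_suml scaler_sumr -big_split/=.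
  apply: eq_bigr => n _.
  apply: (fact n x) => // [Wx|->]; last by rewrite !scale0r scaler0 addr0.
  have oUW : open (U `&` W (k n)) by exact: openI.
  rewrite (conn_leibniz (proj1 (aD (k n))) _ oUW (@subIsetr _ _ _))//.
  + by rewrite scalerDr !scalerA [f x * _]mulrC.
  + exact: smooth_map_sub sf.
  + exact: smooth_section_sub ss.
- move=> s Y ss sY; apply: smooth_sectionI => x Ux; have [h cx] := ga_pchart hX x.
  have [j Ox] := cO x.
  exists (pchart (c := X) x); split => //; set c := pchart (c := X) x in h cx *.
  apply: (@smooth_near_ext _ _ _ _ (fun z => \sum_(n < j.+1)
    sec_rep c (fun y => rho n y *: D (k n) s y (Y y)) z)).
    apply: filterS (near_open h (oO j) Ox cx) => z [Oz _ _].
    by rewrite /section_rep (mixE _ _ Oz) ncd_sum.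
  apply: smooth_near_sum => n _; exact: (term_smooth n oU ss sY Ux).
Qed.

Lemma mix_adapted : adapted_connection setT mix.
Proof.
split; first exact: mix_connection.
move=> U Z Y x oU _ sZ lY Ux; rewrite /mix.
rewrite -[RHS]scale1r -(rho1 (svalP J x)) scaler_suml; apply: eq_bigr => n _.
have [_ _ SW r0] := rhoP n.
have [/SW Wx|/r0->] := pselect (S n x); last by rewrite !scale0r.
have oUW : open (U `&` W (k n)) by exact: openI.
congr (_ *: _); apply: (proj2 (aD (k n)) (U `&` W (k n))) => //.
- exact: vfield_sub sZ.
- case: lY => sY FY; split; first exact: vfield_sub sY.
  by move=> y [Uy _]; exact: FY.
Qed.

Lemma christoffel_mix c x a :
  christoffel mix c x a = \sum_(n < (sval J x).+1) rho n x *: christoffel (D (k n)) c x a.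
Proof.
rewrite /christoffel ncdE; apply/matrixP => i j; rewrite mxE /mix ncd_sum !summxE.
by apply: eq_bigr => n _; rewrite -nfr_mul -scalemxAr nfr_mul mxE [RHS]mxE; congr (_ * _); rewrite mxE.
Qed.

(** The weights have sum [1], so averaging matrices that differ from a fixed one by scalars again
    changes it by a scalar. *)
Lemma christoffel_mix_scalar i c x a : 
  (forall n, S n x -> exists l : R, christoffel (D (k n)) c x a = christoffel (D i) c x a + l%:M) ->
  exists l : R, christoffel mix c x a = christoffel (D i) c x a + l%:M.
Proof.
move=> H; have /choice[l lE] : forall n, exists l : R, 
    rho n x *: christoffel (D (k n)) c x a = rho n x *: (christoffel (D i) c x a + l%:M).
  move=> n; have [/H[l ->]|Sx] := pselect (S n x); first by exists l.
  by exists 0; have [_ _ _ ->] := rhoP n; rewrite // !scale0r.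
exists (\sum_(n < (sval J x).+1) rho n x * l n); rewrite christoffel_mix.
rewrite (eq_bigr (fun n : 'I_ _ => rho n x *: christoffel (D i) c x a + (rho n x * l n)%:M)).
  by rewrite big_split/= -scaler_suml rho1 ?scale1r ?raddf_sum//; exact: (svalP J).
by move=> n _; rewrite lE scalerDr -scale_scalar_mx.
Qed.

End Mix.

Section Glue.
Context {R : realType} {p m : nat} (M : foliated_manifold R p m).

Lemma glue_connections (I : Type) (W : I -> set M) (D : I -> connection_op M) :
  open_cover W -> (forall i, adapted_connection (W i) (D i)) ->
  (forall i j c x a, fm_atlas c -> W i x -> W j x -> cdom c x ->
    exists l : R, christoffel (D j) c x a = christoffel (D i) c x a + l%:M) ->
  exists2 D', adapted_connection setT D' & forall i c x a, fm_atlas c -> W i x -> cdom c x ->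
    exists l : R, christoffel D' c x a = christoffel (D i) c x a + l%:M.
Proof.
(* The partition of unity wants a default index; without any index the covered manifold is empty and
   every operator will do. *)
move=> oW aD H; have [[i0 _]|nI] := pselect (exists i : I, True); last first.
  have nM : M -> False by move=> x; have [i _] := (proj2 oW) x; apply: nI; exists i.
  exists (fun _ _ _ => 0); last by move=> i c x; case: (nM x).
  split; last by move=> U' Y Z x; case: (nM x).
  move=> U' _ _; split.
  - by move=> s x; case: (nM x).
  - by move=> s t x; case: (nM x).
  - by move=> f s x; case: (nM x).
  - by move=> s Y _ _; apply: smooth_sectionI => x; case: (nM x).
have [rho [S [k [Q [rhoP oO cO rho0 rho1]]]]] := partition_of_unity i0 oW.
exists (mix D rho k cO).
  exact: (mix_adapted (proj1 oW) aD rhoP).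
move=> i c x a h Wx cx; apply: (christoffel_mix_scalar rhoP) => // n Sx.
by apply: (H i) => //; have [_ _ SW _] := rhoP n; exact: SW.
Qed.

End Glue.

(** * From a projective structure to an adapted connection *)

Section Backward.
Context {R : realType} {p m : nat} (M : foliated_manifold R p m).
Notation E := 'cV[R]_(p + m).
Notation N := 'cV[R]_m.
Notation X := (manifold M).
Notation coord := (coord (X := X)).
Notation vect := (vect (X := X)).
Notation nfr := (@nfr R p m M).
Notation nfrV := (@nfrV R p m M).
Notation nE := (@normal_lift R p m).
Implicit Types (c : chart M E) (x : M) (U : set M) (s t : M -> N).

Let hX := manifold_good M.

Lemma adapted_connection_sub U U' (D : connection_op M) : U' `<=` U ->
  adapted_connection U D -> adapted_connection U' D.
Proof.
move=> UU' [hD aD]; split=> [V oV VU'|V Y Z x oV VU'].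
  by apply: hD => //; exact: subset_trans UU'.
by apply: aD => //; exact: subset_trans UU'.
Qed.

Lemma foliated_connection_sub U U' (D : connection_op M) : U' `<=` U ->
  foliated_connection U D -> foliated_connection U' D.
Proof.
move=> UU' [aD FD]; split; first exact: adapted_connection_sub aD.
by move=> V Y s oV VU'; apply: FD => //; exact: subset_trans UU'.
Qed.

Lemma form_tensor_smooth U (t : two_form M) : foliated_two_form U t ->
  smooth_tensor U (form_tensor t).
Proof.
move=> Ft; split=> x Ux; have [c [U' [h oU' U'x U'U H]]] := two_formE Ft Ux;
  have [_ lt _ st _] := H x U'x => //.
by exists c; split => //; have [] := U'U _ U'x.
Qed.

Lemma foliated_two_form_zero U : open U -> foliated_two_form (M := M) U (fun _ _ _ => 0).
Proof.
move=> oU; apply: two_formI => // x Ux; have [h cx] := ga_pchart hX x.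
exists (pchart (c := X) x), (fun _ _ _ => 0); split => // y Uy cy; split => //.
- by move=> a b; exact: smooth_near_cst.
- by move=> a b e _; exact: derive_cst.
- by move=> a r u v; rewrite scaler0 addr0.
- by move=> a b; rewrite oppr0.
- by move=> v w; rewrite -nfr_mul mulmx0.
Qed.

(** A representative of zero on the trivial cover. If the normal class vanishes, it is cohomologous
    to the normal cocycle. *)
Lemma zero_cocycle : is_cocycle (@foliated_two_form R p m M)
  (fun _ : unit => setT) (fun _ _ _ => 0).
Proof.
split.
- by split=> [_|x]; [exact: openT|exists tt].
- by move=> _ _; apply: foliated_two_form_zero; exact: openI openT openT.
- by move=> *; rewrite addr0.
Qed.

Lemma zero_cocycle_zero : H1_zero (Cocycle zero_cocycle).
Proof.
exists unit, (fun=> setT), id, (fun _ _ => 0); split => //.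
- by split=> [_|x]; [exact: openT|exists tt].
- by move=> _; apply: foliated_two_form_zero; exact: openT.
- by move=> *; rewrite subrr.
Qed.

Lemma foliated_two_form_sub U U' (t : two_form M) : open U' -> U' `<=` U ->
  foliated_two_form U t -> foliated_two_form U' t.
Proof.
move=> oU' UU' Ft x U'x; have [c [V [th [[h oV Vx VU] sth lth kth tE]]]] := Ft x (UU' _ U'x).
have sub : slice c @` (V `&` U') `<=` slice c @` V by apply: image_subset => y [].
exists c, (V `&` U'), th; split.
- split => //; first exact: openI.
  by move=> y [/VU[]].
- by move=> a b j; apply: Ck_on_sub sub _; exact: sth.
- by move=> y a /sub; exact: lth.
- by move=> y a b /sub; exact: kth.
- by move=> y v w [Vy _]; exact: tE.
Qed.

Section Forms.
Variables (U : set M) (D D' : connection_op M) (phi : one_form M) (t t' : two_form M).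
Hypotheses (oU : open U) (hD : is_connection U D) (hD' : is_connection U D').
Hypotheses (pc : projective_change U D D' phi).
Hypotheses (Ft : foliated_two_form U t) (Ft' : foliated_two_form U t').
Hypothesis tt' : forall x, U x -> pi_wedge phi x = t x - t' x.

(** [odot phi] and [pi_wedge phi] share the term [phi(w) v]; subtracting the second from the first
    leaves [2 phi(v) w], a scalar endomorphism for each [v]. *)
Lemma christoffel_corrected c x a : fm_atlas c -> U x -> cdom c x ->
  exists l : R, christoffel (addc D' (form_tensor t')) c x a =
    christoffel (addc D (form_tensor t)) c x a + l%:M.
Proof.
move=> h Ux cx; set v := vect c x a; exists (2 * phi x v).
have vE : coord c x v = a by rewrite /v (vectK hX a h cx).
have [_ [U' [_ _ U'x _ /(_ _ U'x)[tE _ _ _ _]]]] := two_formE Ft Ux.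
have [_ [V' [_ _ V'x _ /(_ _ V'x)[tE' _ _ _ _]]]] := two_formE Ft' Ux.
have BE : diffc D D' x v + form_tensor t' x v - form_tensor t x v = (2 * phi x v)%:M.
  apply: mx_eq => w; have := (projective_changeP oU hD hD' phi).1 pc x v (nE w) Ux.
  have := congr1 (fun f => f v (nE w)) (tt' Ux); rewrite /pi_wedge/= /odot pi_nE.
  move=> tw dw; rewrite [LHS]mulmxBl [X in X - _]mulmxDl dw tE tE' mul_scalar_mx.
  have -> : t' x v (nE w) = t x v (nE w) - (t x - t' x) v (nE w).
    by rewrite /= opprB addrC subrK.
  rewrite -tw; move: (t x v (nE w)) (pi_N v) => b1 b2.
  by apply/matrixP => i j; rewrite !mxE; ring.
have := diffc_chart oU hD hD' v h Ux cx; rewrite vE => dE.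
apply/eqP; rewrite addrC -subr_eq !christoffel_addc// /crep (ga_can hX h cx) -/v.
have -> : (2 * phi x v)%:M = nfr c x *m (2 * phi x v)%:M *m nfrV c x.
  by rewrite mul_mx_scalar -scalemxAl nfrVK// scalemx1.
rewrite -BE mulmxBr mulmxDr mulmxBl mulmxDl -dE.
by apply/eqP; rewrite opprD addrACA addrA.
Qed.

End Forms.

Lemma backward (P : set (set M * connection_op M)) :
  projective_system P -> normal_class_vanishes P ->
  exists D : connection_op M, adapted_connection [set: M]%classic D /\
     projectable D (@I1 R p m M) /\ projectable D (@I2 R p m M).
Proof.
(* Comparing the normal cocycle with the zero cocycle provides a refinement [W] and forms [t] with
   [0 - pi_wedge phi = t l - t k]. *)
move=> [P1 P2 P3] /(_ (Cocycle zero_cocycle))[_ /(_ zero_cocycle_zero)].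
move=> [phi [Hphi [h [K [W [r [r' [t [cW rW _ tW tE]]]]]]]]].
pose U k := (sval (r k)).1; pose D k := (sval (r k)).2.
have oW k : open (W k) := proj1 cW k.
have [aDk fD] : (forall k, adapted_connection (W k) (D k)) /\
    forall k, foliated_connection (U k) (D k).
  split=> k; have [_ [fD _]] := P1 _ (svalP (r k)) => //.
  by apply: adapted_connection_sub (proj1 fD); exact: rW.
have oU k : open (U k).
  by rewrite /U; have [[c [[oc _ _ _ _] _] <-] _] := P1 _ (svalP (r k)).
pose D1 k := addc (D k) (form_tensor (t k)).
have aD1 k : adapted_connection (W k) (D1 k).
  apply: (adapted_addc (oW k) (aDk k) (form_tensor_smooth (tW k))).
  by move=> x v Wx; have [_ [U' [_ _ U'x _ /(_ _ U'x)[_ _ H _ _]]]] := two_formE (tW k) Wx; exact: H.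
have [D' aD' D'E] : exists2 D', adapted_connection setT D' &
    forall k c x a, fm_atlas c -> W k x -> cdom c x ->
    exists l : R, christoffel D' c x a = christoffel (D1 k) c x a + l%:M.
  apply: glue_connections => // k l c x a hc Wk Wl cx.
  have sub : W k `&` W l `<=` U k `&` U l by move=> y [/rW ? /rW].
  have [_ pc] := Hphi (r k) (r l).
  apply: (@christoffel_corrected (W k `&` W l) (D k) (D l) (phi (r k) (r l)) (t k) (t l)) => //.
  - exact: openI.
  - by apply: (proj1 (adapted_connection_sub _ (aDk k))).
  - by apply: (proj1 (adapted_connection_sub _ (aDk l))).
  - move=> V Y y v oV VU; apply: pc => //; exact: subset_trans sub.
  - by apply: foliated_two_form_sub (tW k); [exact: openI|move=> ? []].
  - by apply: foliated_two_form_sub (tW l); [exact: openI|move=> ? []].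
  - by move=> y [Wky Wly]; have := tE k l y Wky Wly; rewrite sub0r => /eqP; rewrite eqr_oppLR opprB => /eqP.
have Fc x : exists c, [/\ fm_atlas c, cdom c x & \forall z \near c x, forall a v K,
     pi_N a = 0 -> K *m K = - 1%:M -> 'D_a (fun z => lbr (Gam D' c z v) K) z = 0].
  have [k Wx] := proj2 cW x.
  have [c [U' [hc oU' U'x U'W H]]] := two_formE (tW k) Wx.
  have cx := proj2 (U'W _ U'x); exists c; split => //.
  apply: filterS (near_open hc oU' U'x cx) => z [U'z cz <-] a v J a0 _.
  set y := cof c z in U'z cz *; have [Wy _] := U'W _ U'z.
  have Uy : U k y by exact: rW.
  have [_ _ _ /(_ v) sB /(_ v a a0) FB] := H y U'z.
  have [hD _] := proj1 (fD k).
  have sG := christoffel_smooth (oU k) hD v hc Uy cz.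
  have FG := foliated_christoffel v (oU k) (fD k) hc Uy cz a0.
  (* The scalar [l] varies with the point in an uncontrolled way, but the commutator removes it
     before any derivative is taken. *)
  have nG : \forall z' \near c y, lbr (Gam D' c z' v) J =
      lbr (christoffel (D k) c (cof c z') v + crep c (form_tensor (t k)) z' v) J.
    apply: filterS (near_open hc oU' U'z cz) => z' [U'z' cz' z'E].
    have [l lE] := D'E k c (cof c z') v hc (proj1 (U'W _ U'z')) cz'.
    by rewrite /Gam lE lbr_scalar christoffel_addc// z'E.
  have dG := smooth_near_diff sG; have dB := smooth_near_diff sB.
  have dJ : differentiable (fun _ : E => J) (c y) by exact: differentiable_cst.
  rewrite (near_eq_derive _ nG) (derive_lbr _ (differentiableD dG dB) dJ).
  rewrite derive_cst (deriveD (diff_derivable dG) (diff_derivable dB)) FG FB addr0.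
  by rewrite /lbr !mul0mx !mulmx0 !subrr addr0.
exists D'; split => //; split.
  have -> : @I1 R p m M = fun e w => (e.2 *m w.1, 1 *: (e.2 *m w.2)).
    by apply: funext => e; apply: funext => s1; rewrite scale1r.
  exact: commutator_projectable.
have -> : @I2 R p m M = fun e w => (e.2 *m w.1, -1 *: (e.2 *m w.2)).
  by apply: funext => e; apply: funext => s1; rewrite scaleN1r.
exact: commutator_projectable.
Qed.

End Backward.

(** * Projective changes *)

Section Projective.
Context {R : realType} {p m : nat} (M : foliated_manifold R p m).
Notation E := 'cV[R]_(p + m).
Notation N := 'cV[R]_m.
Notation EndN := 'M[R]_m.
Notation X := (manifold M).
Notation coord := (coord (X := X)).
Notation nE := (@normal_lift R p m).
Implicit Types (c : chart M E) (x : M) (U : set M) (L : E -> EndN).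

Let hX := manifold_good M.

(** [L] as a bilinear map of two normal vectors, with the arguments exchanged. *)
Definition swp L (a : E) : EndN := \matrix_(i, j) (L (nE (delta_mx j 0)) *m pi_N a) i 0.

Lemma swpE L a w : linear L -> swp L a *m w = L (nE w) *m pi_N a.
Proof.
move=> lL; rewrite /swp; apply: (linear_mx (l := fun w => L (nE w) *m pi_N a)) => r u v.
by rewrite nE_linear lL mulmxDl -scalemxAl.
Qed.

Lemma linear_nE (V : lmodType R) (f : E -> V) a : linear f -> (forall b, pi_N b = 0 -> f b = 0) ->
  f (nE (pi_N a)) = f a.
Proof.
move=> lf f0; have := lf 1 (a - nE (pi_N a)) (nE (pi_N a)).
by rewrite !scale1r subrK (f0 _ (pi_sub_nE a)) add0r.
Qed.

(** The endomorphism [w |-> f(v) w + f(w) v] has trace [m f(v) + f(v)], whence the denominator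
    [m + 1]. *)
Definition proj_form L (v : E) : R := \tr (L v) / m.+1%:R.

Definition proj_at L : Prop := forall v w,
  L v *m pi_N w = proj_form L v *: pi_N w + proj_form L w *: pi_N v.

Lemma tr_swp L (f : E -> R) v : linear f -> (forall w, L w = (f w)%:M) ->
  \tr (swp L v) = f (nE (pi_N v)).
Proof.
move=> lf LE; rewrite /mxtrace [pi_N v]delta_decomp.
pose F : {linear E -> R} := HB.pack f (GRing.isLinear.Build _ _ _ _ _ lf).
pose G : {linear N -> E} := HB.pack nE (GRing.isLinear.Build _ _ _ _ _ (@nE_linear R p m)).
rewrite -[nE]/(G : N -> E) -[f]/(F : E -> R) !linear_sum; apply: eq_bigr => j _.
by rewrite /swp mxE LE mul_scalar_mx !linearZ/= mxE mulrC.
Qed.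

(** A priori [f] is an arbitrary function; one coordinate of the identity at a basis vector shows
    that it is linear and vanishes in leaf directions. The trace then recovers it, so a projective
    change determines its form. *)
Lemma proj_atI L (f : E -> R) : (0 < m)%N -> linear L -> (forall a, pi_N a = 0 -> L a = 0) ->
  (forall v w, L v *m pi_N w = f v *: pi_N w + f w *: pi_N v) ->
  proj_form L = f /\ proj_at L.
Proof.
move=> m0 lL L0 Lf; pose e : E := nE (delta_mx (Ordinal m0) 0).
pose k := Ordinal m0.
have [b [b1 Lb]] : exists b : N, b k 0 = 1 /\ forall v, L v *m b = f v *: b + f e *: pi_N v.
  exists (delta_mx k 0); split; first by rewrite mxE !eqxx.
  by move=> v; have := Lf v e; rewrite /e pi_nE.
have f0 a : pi_N a = 0 -> f a = 0.
  move=> a0; have := Lb a; rewrite L0// mul0mx a0 scaler0 addr0.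
  by move=> /(congr1 (fun w : N => w k 0)); rewrite !mxE b1 mulr1.
have lf : linear f.
  move=> a u v; have := Lb (a *: u + v).
  rewrite lL mulmxDl -scalemxAl !Lb pi_N_linear; move: (pi_N u) (pi_N v) => b2 b3.
  move=> /(congr1 (fun w : N => w k 0)); rewrite !mxE b1 /GRing.scale/= => H.
  by move: H; move: (f e) (b2 _ _) (b3 _ _) => x1 x2 x3 H; lra.
have LE v : L v = (f v)%:M + swp (fun w => (f w)%:M) v.
  apply: mx_eq => w; have := Lf v (nE w); rewrite pi_nE => ->.
  rewrite mulmxDl mul_scalar_mx swpE ?mul_scalar_mx// => a u1 u2.
  by rewrite lf scale_scalar_mx raddfD.
have fE : proj_form L = f.
  apply: funext => v; rewrite /proj_form LE raddfD/= mxtrace_scalar (@tr_swp _ f)//.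
  rewrite (linear_nE _ lf f0) -mulrSr -(mulr_natr (f v)) mulfK// pnatr_eq0.
by split => // v w; rewrite fE.
Qed.

Lemma proj_at_sub L L' : proj_at L -> proj_at L' -> proj_at (fun v => L v - L' v).
Proof.
move=> H H' v w; rewrite mulmxBl H H' /proj_form !raddfB/= !mulrBl.
move: (_ / _) (_ / _) (_ / _) (_ / _) (pi_N v) (pi_N w) => x1 x2 x3 x4 b1 b2.
by apply/matrixP => i j; rewrite !mxE; ring.
Qed.

Section Foliated.
Variables (U : set M) (D D' : connection_op M).
Hypotheses (oU : open U) (fD : foliated_connection U D) (fD' : foliated_connection U D').

Let hD : is_connection U D. Proof. by case: fD => [[]]. Qed.
Let hD' : is_connection U D'. Proof. by case: fD' => [[]]. Qed.

Let aD : adapted_connection U D. Proof. by case: fD. Qed.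

Let aD' : adapted_connection U D'. Proof. by case: fD'. Qed.

Lemma diffc_F x a : U x -> pi_N a = 0 -> diffc D D' x a = 0.
Proof.
move=> Ux a0; have [h cx] := ga_pchart hX x; rewrite /diffc.
by rewrite (christoffel_F oU aD h Ux cx a0) (christoffel_F oU aD' h Ux cx a0) subrr.
Qed.

Definition dGam c (z a : E) : EndN := christoffel D' c (cof c z) a - christoffel D c (cof c z) a.

Lemma dGam_smooth c x a : fm_atlas c -> U x -> cdom c x -> smooth_near (c x) (fun z => dGam c z a).
Proof.
move=> h Ux cx; apply: smooth_nearB; [exact: (christoffel_smooth oU hD')|exact: (christoffel_smooth oU hD)].
Qed.

Lemma dGam_F c x a e : fm_atlas c -> U x -> cdom c x -> pi_N e = 0 ->
  'D_e (fun z => dGam c z a) (c x) = 0.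
Proof.
move=> h Ux cx e0; have d1 := smooth_near_derivable (v := e) (christoffel_smooth oU hD a h Ux cx).
have d2 := smooth_near_derivable (v := e) (christoffel_smooth oU hD' a h Ux cx).
rewrite (deriveB d2 d1).
by rewrite (foliated_christoffel a oU fD h Ux cx e0) (foliated_christoffel a oU fD' h Ux cx e0) subrr.
Qed.

Lemma dGam_linear c x : fm_atlas c -> U x -> cdom c x -> linear (dGam c (c x)).
Proof.
move=> h Ux cx a u v; rewrite /dGam (ga_can hX h cx).
rewrite (christoffel_linear oU hD h Ux cx) (christoffel_linear oU hD' h Ux cx).
by rewrite opprD addrACA scalerBr.
Qed.

Lemma dGam_pi c x a : fm_atlas c -> U x -> cdom c x -> dGam c (c x) (nE (pi_N a)) = dGam c (c x) a.
Proof.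
move=> h Ux cx; apply: linear_nE; first exact: dGam_linear.
move=> b b0; rewrite /dGam (ga_can hX h cx).
by rewrite (christoffel_F oU aD h Ux cx b0) (christoffel_F oU aD' h Ux cx b0) subrr.
Qed.

(** The trace formula makes sense for any two connections and involves no choice; for projectively
    related ones it is the form of the change. *)
Definition diff_form (x : M) : E -> R := proj_form (diffc D D' x).

Lemma diff_formE c x v : fm_atlas c -> U x -> cdom c x ->
  diff_form x v = \tr (dGam c (c x) (coord c x v)) / m.+1%:R.
Proof.
move=> h Ux cx; have := diffc_chart oU hD hD' v h Ux cx.
rewrite /dGam (ga_can hX h cx) => ->.
by rewrite mxtrace_mulC mulmxA nfrK// mul1mx.
Qed.

Lemma diff_form_foliated : foliated_one_form U diff_form.
Proof.
apply: one_formI => // x Ux; have [h cx] := ga_pchart hX x.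
set c := pchart (c := X) x in h cx.
exists c, (fun z => \row_j (\tr (dGam c z (nE (delta_mx j 0))) / m.+1%:R)); split => // y Uy cy.
have sr : smooth_near (c y) (fun z => \row_j (\tr (dGam c z (nE (delta_mx j 0))) / m.+1%:R) : 'rV[R]_m).
  apply: smooth_near_mx => i j.
  apply: (@smooth_near_eq _ _ _ _ (fun z => \tr (dGam c z (nE (delta_mx j 0))) * m.+1%:R^-1)).
    by move=> z; rewrite mxE.
  apply: smooth_nearM; last exact: smooth_near_cst.
  apply: (@smooth_near_linear _ _ _ _ _ (@mxtrace R m)); last exact: dGam_smooth.
  by move=> a u v; rewrite linearP.
split => //.
- move=> b b0; apply/matrixP => i j; rewrite -derive_entry; last exact: smooth_near_diff.
  pose l (A : EndN) := \tr A / m.+1%:R : R.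
  have ll : linear l by move=> a u v; rewrite /l linearP/= mulrDl /GRing.scale/= mulrA.
  rewrite (_ : (fun z => _) = fun z => l (dGam c z (nE (delta_mx j 0)))); last first.
    by apply: funext => z; rewrite mxE.
  have dG := smooth_near_diff (dGam_smooth (nE (delta_mx j 0)) h Uy cy).
  rewrite (derive_linear b _ ll dG) dGam_F// mxE.
  by rewrite /l mxtrace0 mul0r.
- move=> v; rewrite (diff_formE v h Uy cy) -(dGam_pi _ h Uy cy).
  set w := pi_N _.
  pose l (b : N) := \tr (dGam c (c y) (nE b)) / m.+1%:R : R.
  have ll : linear l.
    by move=> a u1 u2; rewrite /l nE_linear dGam_linear// linearP/= mulrDl /GRing.scale/= mulrA.
  pose L : {linear N -> R} := HB.pack l (GRing.isLinear.Build _ _ _ _ _ ll).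
  rewrite -[LHS]/(L w) {1}[w]delta_decomp linear_sum mxE; apply: eq_bigr => j _.
  by rewrite linearZ/= !mxE mulrC.
Qed.

End Foliated.

End Projective.

(** * From an adapted connection to a projective structure *)

Section Forward.
Context {R : realType} {p m : nat} (M : foliated_manifold R p m).
Notation E := 'cV[R]_(p + m).
Notation N := 'cV[R]_m.
Notation EndN := 'M[R]_m.
Notation X := (manifold M).
Notation coord := (coord (X := X)).
Notation vect := (vect (X := X)).
Notation ncd := (@ncd R p m M).
Notation nvect := (@nvect R p m M).
Notation nfr := (@nfr R p m M).
Notation nfrV := (@nfrV R p m M).
Notation nE := (@normal_lift R p m).
Notation ntr := (@ntr R p m M).
Implicit Types (c : chart M E) (x : M) (U : set M) (L : E -> EndN).

Let hX := manifold_good M.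

Variable D : connection_op M.
Hypothesis aD : adapted_connection setT D.
Hypothesis DF : forall c x a v K, fm_atlas c -> cdom c x -> pi_N a = 0 -> K *m K = - 1%:M ->
  'D_a (fun z => lbr (Gam D c z v) K) (c x) = 0.
Hypotheses (q : nat) (mE : m = (q + q)%N) (m0 : (0 < m)%N).

Let hD : is_connection setT D. Proof. by case: aD. Qed.

Definition trace_free (A : EndN) : EndN := A - (\tr A / m%:R)%:M.

Lemma trace_free_linear : linear trace_free.
Proof.
move=> a A B; rewrite /trace_free linearP/= mulrDl -mulrA raddfD/= -scale_scalar_mx.
by rewrite scalerBr opprD addrACA.
Qed.

Let Gl c x : fm_atlas c -> cdom c x -> linear (christoffel D c x).
Proof. by move=> h cx; exact: (christoffel_linear openT hD h Logic.I cx). Qed.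

Let G0 c x a : fm_atlas c -> cdom c x -> pi_N a = 0 -> christoffel D c x a = 0.
Proof. by move=> h cx; exact: (christoffel_F openT aD h Logic.I cx). Qed.

Let Gs c x v : fm_atlas c -> cdom c x -> smooth_near (c x) (fun z => Gam D c z v).
Proof. by move=> h cx; exact: (christoffel_smooth openT hD v h Logic.I cx). Qed.

Definition TF c (z a : E) : EndN := trace_free (Gam D c z a).

Lemma TF_smooth c x v : fm_atlas c -> cdom c x -> smooth_near (c x) (fun z => TF c z v).
Proof.
by move=> h cx; apply: (smooth_near_linear _ trace_free_linear); exact: Gs.
Qed.

Lemma TF_F c x v e : fm_atlas c -> cdom c x -> pi_N e = 0 -> 'D_e (fun z => TF c z v) (c x) = 0.
Proof.
move=> h cx e0; have sG := Gs v h cx; have dG := smooth_near_diff sG.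
rewrite (derive_linear e _ trace_free_linear dG) /trace_free.
rewrite {1}(@commute_complex_scalar R m q ('D_e (fun z => Gam D c z v) (c x)))// ?subrr//.
move=> K KK; have := DF v h cx e0 KK.
have dK : differentiable (fun _ : E => K) (c x) by exact: differentiable_cst.
by rewrite (derive_lbr _ dG dK) (derive_cst K) /lbr mulmx0 mul0mx subrr addr0.
Qed.

Lemma TF_linear c x : fm_atlas c -> cdom c x -> linear (TF c (c x)).
Proof.
move=> h cx a u v; rewrite /TF /Gam (ga_can hX h cx) Gl//.
exact: trace_free_linear.
Qed.

Lemma TF_pi c x a : fm_atlas c -> cdom c x -> TF c (c x) (nE (pi_N a)) = TF c (c x) a.
Proof.
move=> h cx; apply: linear_nE; first exact: TF_linear.
move=> b b0; rewrite /TF /Gam (ga_can hX h cx) G0//.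
by rewrite /trace_free mxtrace0 mul0r raddf0 subr0.
Qed.

(** A separate form for each chart: on overlaps the traces of the connection matrices differ by the
    logarithmic derivative of the determinant of the transition matrix. *)
Definition theta c x (v : E) : R := \tr (christoffel D c x (coord c x v)) / m%:R.

Lemma theta_linear c x : fm_atlas c -> cdom c x -> linear (theta c x).
Proof.
move=> h cx a u v; rewrite /theta (@coord_linear R E X) Gl// linearP/= mulrDl.
by rewrite /GRing.scale/= mulrA.
Qed.

Lemma theta_F c x v : fm_atlas c -> cdom c x -> pi_N v = 0 -> theta c x v = 0.
Proof.
by move=> h cx v0; rewrite /theta G0 ?mxtrace0 ?mul0r//; exact: coord_F.
Qed.

(** The preferred chart jumps with [x], so this matrix has no regularity in [x]; it serves through
    its antisymmetrization, which is the torsion. *)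
Definition Gp x : E -> EndN := christoffel D (pchart (c := X) x) x.

Lemma Gp_linear x : linear (Gp x).
Proof. by have [h cx] := ga_pchart hX x; exact: Gl. Qed.

Lemma Gp_F x v : pi_N v = 0 -> Gp x v = 0.
Proof. by have [h cx] := ga_pchart hX x; exact: G0. Qed.

(* The torsion of D is a tensor, although christoffel D is not. *)
Lemma torsion_chg c x v w : fm_atlas c -> cdom c x ->
  nfr c x *m (Gp x v *m w - Gp x (nE w) *m pi_N v) =
  christoffel D c x (coord c x v) *m ncd c x w -
  christoffel D c x (nE (ncd c x w)) *m pi_N (coord c x v).
Proof.
move=> h cx; have [h' px] := ga_pchart hX x; set P := pchart (c := X) x in h' px.
have nE1 : nfr c x = ntr P c (P x) by rewrite (nfr_chg h' h px cx) nfr_pchart mulmx1.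
have H u u' : nfr c x *m (Gp x u *m u') =
    christoffel D c x (coord c x u) *m ncd c x u' + 'D_u (ntr P c) (P x) *m u'.
  have := christoffel_chg openT hD u h' h Logic.I px cx.
  rewrite -(coordE hX u h cx) -nE1 -/P => cE.
  by rewrite -nfr_mul !mulmxA cE -mulmxDl subrK.
rewrite mulmxBr !H.
have -> : 'D_(nE w) (ntr P c) (P x) *m pi_N v = 'D_v (ntr P c) (P x) *m w.
  by rewrite (ntr_sym _ _ h' h px cx) pi_nE.
rewrite opprD addrACA subrr addr0 (pi_coord _ h cx).
congr (_ - _ *m _); rewrite -(linear_nE _ (Gl h cx) (fun b => G0 h cx)) (pi_coord _ h cx).
by rewrite pi_nE.
Qed.

(* D - 1/2 (theta_c (.) pi_N) - 1/2 T_D is torsionless, and in the chart c only the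
   trace-free part of the connection matrix of D enters its symmetric coefficients. *)
Definition corr c x (v : E) : EndN := - (2^-1 *:
  (((theta c x v)%:M + swp (fun w => (theta c x w)%:M) v) + (Gp x v - swp (Gp x) v))).

Lemma corrE c x v w : fm_atlas c -> cdom c x -> corr c x v *m w =
  - (2^-1 *: ((theta c x v *: w + theta c x (nE w) *: pi_N v) +
              (Gp x v *m w - Gp x (nE w) *m pi_N v))).
Proof.
move=> h cx; rewrite /corr mulNmx -scalemxAl mulmxDl [X in X + _]mulmxDl [X in _ + X]mulmxBl.
rewrite mul_scalar_mx !swpE ?mul_scalar_mx//; first exact: Gp_linear.
by move=> a u1 u2; rewrite theta_linear// scale_scalar_mx raddfD.
Qed.

Definition nabla c : connection_op M := addc D (corr c).

(** Subtracting half the torsion symmetrizes the connection matrix into two terms with factor [1/2];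
    subtracting [theta / 2] in each makes them trace-free. This fixes both constants. *)
Lemma christoffel_nablaE c x a : fm_atlas c -> cdom c x ->
  christoffel (nabla c) c x a = 2^-1 *: (TF c (c x) a + swp (TF c (c x)) a).
Proof.
move=> h cx; rewrite christoffel_addc// /crep (ga_can hX h cx).
apply: mx_eq => w; rewrite mulmxDl -!mulmxA nfrV_mul corrE// mulmxN -scalemxAr mulmxDr.
rewrite torsion_chg// nvectK// (vectK hX a h cx) mulmxDr -!scalemxAr !nfr_mul nvectK//.
rewrite -(pi_coord _ h cx) (vectK hX a h cx) -scalemxAl mulmxDl swpE; last exact: TF_linear.
have -> : theta c x (vect c x a) = \tr (christoffel D c x a) / m%:R.
  by rewrite /theta (vectK hX a h cx).
have -> : theta c x (nE (nvect c x w)) = \tr (christoffel D c x (nE w)) / m%:R.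
  rewrite /theta -(linear_nE _ (Gl h cx) (fun b => G0 h cx)) (pi_coord _ h cx) pi_nE.
  by rewrite nvectK.
rewrite /TF /Gam (ga_can hX h cx) /trace_free !mulmxBl !mul_scalar_mx.
move: (christoffel D c x a *m w) (christoffel D c x (nE w) *m pi_N a) (_ / _) (_ / _) (pi_N a).
move=> b1 b2 t1 t2 b3.
by apply/matrixP => i j; rewrite !mxE; lra.
Qed.

Lemma sym_tensor_mul c x a w : fm_atlas c -> cdom c x ->
  (2^-1 *: (TF c (c x) a + swp (TF c (c x)) a)) *m w =
  2^-1 *: (TF c (c x) a *m w + TF c (c x) (nE w) *m pi_N a).
Proof. by move=> h cx; rewrite -scalemxAl mulmxDl swpE//; exact: TF_linear. Qed.

Lemma swp_TF_smooth c x a : fm_atlas c -> cdom c x -> smooth_near (c x) (fun z => swp (TF c z) a).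
Proof.
move=> h cx; apply: smooth_near_mx => i j.
apply: (@smooth_near_eq _ _ _ _ (fun z => (TF c z (nE (delta_mx j 0)) *m pi_N a) i 0)).
  by move=> z; rewrite mxE.
apply: smooth_near_coord; apply: smooth_near_mulmx; last exact: smooth_near_cst.
exact: TF_smooth.
Qed.

Lemma corr_smooth c : fm_atlas c -> smooth_tensor (cdom c) (corr c).
Proof.
move=> h; split=> [x cx a u v|x cx].
  apply: mx_eq => w; rewrite mulmxDl -scalemxAl !corrE// theta_linear// Gp_linear pi_N_linear.
  rewrite [(_ + Gp x v) *m _]mulmxDl -scalemxAl; move: (Gp x u *m w) (Gp x v *m w) => b1 b2.
  rewrite mulmxDr -scalemxAr; move: (pi_N u) (pi_N v) => b5 b6.
  move: (_ *m b5) (_ *m b6) => b3 b4.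
  move: (theta c x u) (theta c x v) (theta c x _) => t1 t2 t3; rewrite /GRing.scale/=.
  by apply/matrixP => i j; rewrite !mxE; ring.
exists c; split => // a.
apply: (@smooth_near_ext _ _ _ _ (fun z => 2^-1 *: (TF c z a + swp (TF c z) a) - Gam D c z a)).
  apply: filterS (near_chart hX h h cx cx) => z [cz _ zE].
  rewrite -{1 2}zE -christoffel_nablaE// christoffel_addc// /Gam zE.
  by rewrite addrC addKr.
apply: smooth_nearB; last exact: Gs.
apply: smooth_nearZ; first exact: smooth_near_cst.
by apply: smooth_nearD; [exact: TF_smooth|exact: swp_TF_smooth].
Qed.

Lemma corr_F c x v : fm_atlas c -> cdom c x -> pi_N v = 0 -> corr c x v = 0.
Proof.
move=> h cx v0; apply: mx_eq => w; rewrite corrE// theta_F// Gp_F// v0 mul0mx scale0r.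
by rewrite scaler0 mulmx0 subrr !addr0 scaler0 oppr0.
Qed.

Lemma nabla_adapted c : fm_atlas c -> adapted_connection (cdom c) (nabla c).
Proof.
move=> h; apply: adapted_addc.
- exact: open_cdom.
- by apply: adapted_connection_sub aD.
- exact: corr_smooth.
- by move=> x v; exact: corr_F.
Qed.

Lemma nabla_foliated c : fm_atlas c -> foliated_connection (cdom c) (nabla c).
Proof.
move=> h; apply: foliated_connectionI; [exact: open_cdom|exact: nabla_adapted|].
move=> x cx; exists c; split => // y e a _ cy e0.
have nG : \forall z \near c y, christoffel (nabla c) c (cof c z) a =
    2^-1 *: (TF c z a + swp (TF c z) a).
  by apply: filterS (near_chart hX h h cy cy) => z [cz _ zE]; rewrite (christoffel_nablaE a h cz) zE.
rewrite (near_eq_derive _ nG).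
have dT v := smooth_near_diff (TF_smooth v h cy).
have dS := smooth_near_diff (swp_TF_smooth a h cy).
have dTS : differentiable (fun z => TF c z a + swp (TF c z) a) (c y) by exact: differentiableD.
rewrite (derive_linear (l := fun A : EndN => 2^-1 *: A) _ _ _ dTS); last first.
  by move=> r u v; rewrite scalerDr !scalerA mulrC.
rewrite (deriveD (diff_derivable (dT a)) (diff_derivable dS)) TF_F// add0r.
rewrite (_ : 'D_e _ _ = 0) ?scaler0//; apply/matrixP => i j.
rewrite -derive_entry//.
rewrite (_ : (fun z => _) = fun z => (TF c z (nE (delta_mx j 0)) *m pi_N a) i 0); last first.
  by apply: funext => z; rewrite mxE.
have dp : differentiable (fun _ : E => pi_N a) (c y) by exact: differentiable_cst.
rewrite (@derive_entry _ _ _ _ _ _ (fun z => TF c z (nE (delta_mx j 0)) *m pi_N a)); last exact: differentiable_mulmx.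
by rewrite (derive_mulmx _ (dT _) dp) TF_F// (derive_cst (pi_N a)) mul0mx mulmx0 addr0 !mxE.
Qed.

Lemma nabla_torsionless c : fm_atlas c -> torsionless (cdom c) (nabla c).
Proof.
move=> h; apply: torsionlessI; [exact: open_cdom|by case: (nabla_adapted h)|].
move=> x cx; exists c; split => // v w.
rewrite !christoffel_nablaE// !sym_tensor_mul// !TF_pi//.
by rewrite addrC.
Qed.

Lemma diffc_addc (B B' : M -> E -> EndN) x v :
  diffc (addc D B) (addc D B') x v = B' x v - B x v.
Proof.
have [hp px] := ga_pchart hX x; rewrite /diffc !(christoffel_addc _ _ _ hp px).
rewrite opprD addrACA subrr add0r /crep (ga_can hX hp px).
have vE : vect (pchart (c := X) x) x v = v.
  by rewrite -[RHS](coordK hX v hp px) (coord_pchart hX).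
have nV : nfrV (pchart (c := X) x) x = 1%:M.
  by rewrite -[LHS]mulmx1 -{1}(nfr_pchart x) (nfrK hp px).
by rewrite nV nfr_pchart !mulmx1 !mul1mx vE.
Qed.

(** The torsion part of [corr] does not depend on the chart and cancels, leaving the difference of
    the [theta]. *)
Lemma nabla_diff c c' x v w : fm_atlas c -> fm_atlas c' -> cdom c x -> cdom c' x ->
  diffc (nabla c) (nabla c') x v *m pi_N w =
  (2^-1 * (theta c x v - theta c' x v)) *: pi_N w + (2^-1 * (theta c x w - theta c' x w)) *: pi_N v.
Proof.
move=> h h' cx c'x; rewrite /nabla (diffc_addc (corr c) (corr c')) mulmxBl.
rewrite [X in X - _](corrE v (pi_N w) h' c'x) [X in _ - X](corrE v (pi_N w) h cx).
rewrite (linear_nE _ (theta_linear h cx) (fun b => theta_F h cx)).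
rewrite (linear_nE _ (theta_linear h' c'x) (fun b => theta_F h' c'x)).
move: (theta c x v) (theta c x w) (theta c' x v) (theta c' x w) (_ - _ *m _) => t1 t2 t3 t4 b.
move: (pi_N v) (pi_N w) => b1 b2.
by apply/matrixP => i j; rewrite !mxE; ring.
Qed.

Lemma nabla_proj c c' x : fm_atlas c -> fm_atlas c' -> cdom c x -> cdom c' x ->
  proj_form (diffc (nabla c) (nabla c') x) = (fun v => 2^-1 * (theta c x v - theta c' x v)) /\
  proj_at (diffc (nabla c) (nabla c') x).
Proof.
move=> h h' cx c'x; have oI : open (cdom c `&` cdom c') by apply: openI; exact: open_cdom.
have f1 : foliated_connection (cdom c `&` cdom c') (nabla c).
  by apply: foliated_connection_sub (nabla_foliated h) => y [].
have f2 : foliated_connection (cdom c `&` cdom c') (nabla c').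
  by apply: foliated_connection_sub (nabla_foliated h') => y [].
apply: proj_atI => //.
- by apply: (diffc_linear oI (proj1 (proj1 f1)) (proj1 (proj1 f2))); split.
- by move=> a; exact: (diffc_F oI f1 f2 (conj cx c'x)).
- by move=> v w; exact: nabla_diff.
Qed.

End Forward.

(** * Vanishing classes *)

Section CechZero.
Context {T : topologicalType} {A : zmodType}.
Variable Sh : set T -> (T -> A) -> Prop.
Hypothesis shS : forall U U' f, open U' -> U' `<=` U -> Sh U f -> Sh U' f.
Hypothesis shB : forall U f g, open U -> Sh U f -> Sh U g -> Sh U (fun x => f x - g x).
Hypothesis shD : forall U f g, open U -> Sh U f -> Sh U g -> Sh U (fun x => f x + g x).
Implicit Types z : cocycle Sh.

Lemma open_cover_prod (K K' : Type) (W : K -> set T) (W' : K' -> set T) :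
  open_cover W -> open_cover W' -> open_cover (fun kl : K * K' => W kl.1 `&` W' kl.2).
Proof.
move=> [oW cW] [oW' cW']; split=> [kl|x]; first exact: openI.
by have [k Wx] := cW x; have [l Wx'] := cW' x; exists (k, l).
Qed.

Lemma H1_zero_cohomologous z z' : H1_zero z -> H1_zero z' -> cohomologous z z'.
Proof.
move=> [K [W [r [t [cW rW tW tE]]]]] [K' [W' [r' [t' [cW' rW' tW' tE']]]]].
exists (K * K')%type, (fun kl => W kl.1 `&` W' kl.2), (r \o fst), (r' \o snd).
exists (fun kl x => t' kl.2 x - t kl.1 x); split.
- exact: open_cover_prod.
- by move=> [k l] x [/rW].
- by move=> [k l] x [_ /rW'].
- move=> [k l] /=; have oI : open (W k `&` W' l) by exact: openI (proj1 cW k) (proj1 cW' l).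
  by apply: shB => //; [apply: shS oI _ (tW' l) => x []|apply: shS oI _ (tW k) => x []].
- move=> [k l] [k' l'] x [/= Wk Wl] [Wk' Wl'] /=; rewrite tE// tE'//.
  by rewrite !opprB addrACA [RHS]addrACA; congr (_ + _); rewrite addrC.
Qed.

Lemma cohomologous_H1_zero z z' : H1_zero z -> cohomologous z z' -> H1_zero z'.
Proof.
move=> [K [W [r [t [cW rW tW tE]]]]] [K' [W' [r1 [r' [t' [cW' rW1 rW' tW' tE']]]]]].
have [_ shz cz] := cc_proof z.
exists (K * K')%type, (fun kl => W kl.1 `&` W' kl.2), (r' \o snd).
(* The indices of [z] are reached by both [r] and [r1]; the value of the cocycle between them
   converts one refinement into the other. *)
exists (fun kl x => t kl.1 x + (cc_val (r kl.1) (r1 kl.2) x + t' kl.2 x)); split.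
- exact: open_cover_prod.
- by move=> [k l] x [_ /rW'].
- move=> [k l] /=; have oI : open (W k `&` W' l) by exact: openI (proj1 cW k) (proj1 cW' l).
  apply: shD => //; first by apply: shS oI _ (tW k) => x [].
  apply: shD => //; last by apply: shS oI _ (tW' l) => x [].
  by apply: shS oI _ (shz _ _) => x [/rW ? /rW1].
- move=> [k l] [k' l'] x [/= Wk Wl] [Wk' Wl'] /=.
  have e1 := tE' _ _ _ Wl Wl'; have e2 := tE _ _ _ Wk Wk'.
  have e3 := cz (r k) (r1 l) (r1 l') x (rW _ _ Wk) (rW1 _ _ Wl) (rW1 _ _ Wl').
  have e4 := cz (r k) (r k') (r1 l') x (rW _ _ Wk) (rW _ _ Wk') (rW1 _ _ Wl').
  rewrite opprD addrACA -e2 opprD [X in _ = _ + X]addrACA -e1.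
  by rewrite addrA [X in _ = X + _]addrA e4 -e3 [X in _ = X + _]addrAC subrr add0r addrC subrK.
Qed.

End CechZero.

(** * Foliated 2-forms in every chart *)

Section BasicForms.
Context {R : realType} {p m : nat} (M : foliated_manifold R p m).
Notation E := 'cV[R]_(p + m).
Notation X := (manifold M).
Notation coord := (coord (X := X)).
Notation vect := (vect (X := X)).
Notation ncd := (@ncd R p m M).
Notation nE := (@normal_lift R p m).
Implicit Types (c : chart M E) (x : M) (U : set M) (t : two_form M).

Let hX := manifold_good M.

(** Asks for constancy along the leaves in all charts, whereas [foliated_two_form] offers one
    unspecified chart at each point; in this form two forms can be subtracted. *)
Definition basic_form U t : Prop :=
  (forall x, U x -> forall v w, t x v w = form_tensor t x v *m pi_N w /\ t x v w = - t x w v) /\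
  forall c x a, fm_atlas c -> U x -> cdom c x ->
    smooth_near (c x) (fun z => crep c (form_tensor t) z a) /\
    forall e, pi_N e = 0 -> 'D_e (fun z => crep c (form_tensor t) z a) (c x) = 0.

Lemma two_form_pi U t x v w : foliated_two_form U t -> U x ->
  t x v w = t x v (nE (pi_N w)) /\ t x v w = - t x w v.
Proof.
move=> Ft Ux; have [c [U' [th [[h oU' U'x U'U] _ _ kth tE]]]] := Ft x Ux.
have [_ cx] := U'U _ U'x; have tE' a b := tE x a b U'x; rewrite ncdE in tE'.
have inj a b : ncd c x a = ncd c x b -> a = b.
  by move=> ab; rewrite -(ncdK a h cx) ab ncdK.
split; apply: inj; first by rewrite !tE' !(pi_coord _ h cx) pi_nE.
by rewrite -[RHS]nfr_mul mulmxN nfr_mul !tE' kth//; exists x.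
Qed.

(** Added to a foliated connection, the form gives another foliated connection. Connection matrices
    of both are constant along the leaves in every chart, hence so is their difference; no
    transformation law of forms is computed. *)
Lemma foliated_basic U t : open U ->
  (forall x, exists U0 D0, [/\ open U0, U0 x & foliated_connection U0 D0]) ->
  foliated_two_form U t -> basic_form U t.
Proof.
move=> oU HD Ft; split=> [x Ux v w|c x a h Ux cx].
  have [c [U' [_ _ U'x _ /(_ _ U'x)[tE _ _ _ _]]]] := two_formE Ft Ux.
  by have [e1 e2] := two_form_pi v w Ft Ux; split => //; rewrite e1 -tE.
have [c1 [U' [h1 oU' U'x U'U H]]] := two_formE Ft Ux.
have [U0 [D0 [oU0 U0x fD0]]] := HD x.
pose V := U' `&` U0; have oV : open V by exact: openI.
have VU' : V `<=` U' by move=> y [].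
have fD : foliated_connection V D0 by apply: foliated_connection_sub fD0 => y [].
have [[hD _] _] := fD.
have sB : smooth_tensor V (form_tensor t).
  split=> y [/[dup] U'y /H[_ lB _ sB _] _] //; exists c1; split => //.
  by have [] := U'U _ U'y.
have hD1 : is_connection V (addc D0 (form_tensor t)) by exact: is_connection_addc.
have fD1 : foliated_connection V (addc D0 (form_tensor t)).
  apply: foliated_connectionI => //.
    apply: adapted_addc => //; first exact: (proj1 fD).
    by move=> y v [/H[_ _ B0 _ _] _]; exact: B0.
  move=> y Vy; have cy : cdom c1 y by have [] := U'U _ (VU' _ Vy).
  exists c1; split => // z e v Vz cz e0.
  have [_ _ _ sBz FBz] := H z (VU' _ Vz).
  have nG : \forall z' \near c1 z, christoffel (addc D0 (form_tensor t)) c1 (cof c1 z') v =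
      christoffel D0 c1 (cof c1 z') v + crep c1 (form_tensor t) z' v.
    apply: filterS (near_chart hX h1 h1 cz cz) => z' [cz' _ z'E].
    by rewrite (christoffel_addc _ _ _ h1 cz') z'E.
  have d1 := smooth_near_derivable (v := e) (christoffel_smooth oV hD v h1 Vz cz).
  have d2 := smooth_near_derivable (v := e) (sBz v).
  rewrite (near_eq_derive _ nG) (deriveD d1 d2) (FBz _ _ e0).
  by rewrite (foliated_christoffel v oV fD h1 Vz cz e0) addr0.
have Vx : V x by [].
have nG : \forall z \near c x, christoffel (addc D0 (form_tensor t)) c (cof c z) a -
    christoffel D0 c (cof c z) a = crep c (form_tensor t) z a.
  apply: filterS (near_chart hX h h cx cx) => z' [cz' _ z'E].
  by rewrite (christoffel_addc _ _ _ h cz') z'E addrC addKr.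
have s1 := christoffel_smooth oV hD1 a h Vx cx.
have s2 := christoffel_smooth oV hD a h Vx cx.
split; first by apply: smooth_near_ext nG _; exact: smooth_nearB.
move=> e e0; rewrite -(near_eq_derive _ nG).
rewrite (deriveB (smooth_near_derivable s1) (smooth_near_derivable s2)).
by rewrite (foliated_christoffel a oV fD h Vx cx e0) (foliated_christoffel a oV fD1 h Vx cx e0) subrr.
Qed.

Lemma basic_foliated U t : open U -> basic_form U t -> foliated_two_form U t.
Proof.
move=> oU [tE tB]; apply: two_formI => // x Ux; have [h cx] := ga_pchart hX x.
set c := pchart (c := X) x in h cx.
exists c, (fun z a b => crep c (form_tensor t) z (nE a) *m b); split => // y Uy cy.
have tE1 v w := proj1 (tE y Uy v w); have tE2 v w := proj2 (tE y Uy v w).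
(* Antisymmetry carries the dependence on normal parts over from the second argument to the
   first. *)
have Bpi v v' : pi_N v = pi_N v' -> form_tensor t y v = form_tensor t y v'.
  move=> vv'; apply: mx_eq => w; have := tE1 v (nE w); have := tE1 v' (nE w).
  by rewrite pi_nE => <- <-; rewrite tE2 [RHS]tE2 !tE1 vv'.
have OmE a b : crep c (form_tensor t) (c y) (nE a) *m b =
    ncd c y (t y (vect c y (nE a)) (vect c y (nE b))).
  rewrite tE1 /crep (ga_can hX h cy) -!mulmxA nfrV_mul nfr_mul.
  by rewrite (pi_vect _ h cy) pi_nE.
split.
- move=> a b; apply: smooth_near_mulmx; last exact: smooth_near_cst.
  by have [] := tB c y (nE a) h Uy cy.
- move=> a b e e0; have [sB /(_ e e0) FB] := tB c y (nE a) h Uy cy.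
  have db : differentiable (fun _ : E => b) (c y) by exact: differentiable_cst.
  by rewrite (derive_mulmx _ (smooth_near_diff sB) db) FB (derive_cst b) mul0mx mulmx0 addr0.
- by move=> a r u v; rewrite mulmxDr -scalemxAr.
- by move=> a b; rewrite !OmE tE2 -nfr_mul mulmxN nfr_mul.
- move=> v w; rewrite (OmE (pi_N (coord c y v)) (pi_N (coord c y w))).
  set a := pi_N (coord c y v); set b := pi_N (coord c y w).
  rewrite (tE1 v w) (tE1 (vect c y (nE a)) (vect c y (nE b))).
  rewrite (pi_vect (nE b) h cy) pi_nE {}/b (pi_coord w h cy) (ncdK _ h cy).
  congr (ncd _ _ (_ *m _)); apply: Bpi.
  by rewrite (pi_vect (nE a) h cy) pi_nE {}/a (pi_coord v h cy) (ncdK _ h cy).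
Qed.

Lemma form_tensorB t t' x v :
  form_tensor (fun y => t y - t' y) x v = form_tensor t x v - form_tensor t' x v.
Proof. by apply/matrixP => i j; rewrite !mxE. Qed.

Lemma basic_formB U t t' : basic_form U t -> basic_form U t' ->
  basic_form U (fun x => t x - t' x).
Proof.
move=> [tE tB] [tE' tB']; split=> [x Ux v w|c x a h Ux cx].
  have [e1 e2] := tE x Ux v w; have [e3 e4] := tE' x Ux v w.
  rewrite form_tensorB mulmxBl -e1 -e3; split => //.
  change (t x v w - t' x v w = - (t x w v - t' x w v)).
  by rewrite e2 e4 opprD.
have cE : (fun z => crep c (form_tensor (fun x => t x - t' x)) z a) =
    fun z => crep c (form_tensor t) z a - crep c (form_tensor t') z a.
  by apply: funext => z; rewrite /crep form_tensorB mulmxBr mulmxBl.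
have [s1 F1] := tB c x a h Ux cx; have [s2 F2] := tB' c x a h Ux cx; rewrite cE.
split=> [|e e0]; first exact: smooth_nearB.
rewrite (deriveB (smooth_near_derivable s1) (smooth_near_derivable s2)).
by rewrite F1// F2// subrr.
Qed.

End BasicForms.

(** * The projective structure generated by the connections [nabla] *)

Section Structure.
Context {R : realType} {p m : nat} (M : foliated_manifold R p m).
Notation E := 'cV[R]_(p + m).
Notation N := 'cV[R]_m.
Notation EndN := 'M[R]_m.
Notation X := (manifold M).
Notation coord := (coord (X := X)).
Notation nE := (@normal_lift R p m).
Implicit Types (c : chart M E) (x : M) (U : set M).

Let hX := manifold_good M.

Hypothesis m0 : (0 < m)%N.

Lemma atlas_adapted c : fm_atlas c -> adapted_neighborhood (cdom c).
Proof.
move=> h; exists c => //; split; first exact: fm_chart.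
by move=> c' h'; split; exact: fm_transition.
Qed.

Lemma adapted_open U : adapted_neighborhood U -> @open M U.
Proof. by move=> [c [[oc _ _ _ _] _] <-]. Qed.

Lemma change_form U D D' phi x : open U -> foliated_connection U D -> foliated_connection U D' ->
  projective_change U D D' phi -> U x ->
  phi x = proj_form (diffc D D' x) /\ proj_at (diffc D D' x).
Proof.
move=> oU fD fD' pc Ux; have [[hD _] _] := fD; have [[hD' _] _] := fD'.
have [] := @proj_atI R p m (diffc D D' x) (phi x) m0 => [|||-> //].
- exact: (diffc_linear oU hD hD' Ux).
- by move=> a; exact: (diffc_F oU fD fD' Ux).
- by move=> v w; exact: ((projective_changeP oU hD hD' phi).1 pc x v w Ux).
Qed.

Lemma pi_wedge_foliated U D D' : open U -> foliated_connection U D -> foliated_connection U D' ->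
  foliated_two_form U (pi_wedge (diff_form D D')).
Proof.
move=> oU fD fD'; apply: two_formI => // x Ux; have [h cx] := ga_pchart hX x.
set c := pchart (c := X) x in h cx.
pose l (A : EndN) := \tr A / m.+1%:R : R.
have ll : linear l by move=> a u v; rewrite /l linearP/= mulrDl /GRing.scale/= mulrA.
exists c, (fun z a b => l (dGam D D' c z (nE b)) *: a - l (dGam D D' c z (nE a)) *: b).
split => // y Uy cy.
have sl a : smooth_near (c y) (fun z => l (dGam D D' c z a)).
  by apply: (smooth_near_linear _ ll); exact: (dGam_smooth oU fD fD').
have Fl a e : pi_N e = 0 -> 'D_e (fun z => l (dGam D D' c z a)) (c y) = 0.
  move=> e0; have dG := smooth_near_diff (dGam_smooth oU fD fD' a h Uy cy).
  by rewrite (derive_linear e _ ll dG) (dGam_F oU fD fD')// /l mxtrace0 mul0r.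
have lG := dGam_linear oU fD fD' h Uy cy.
split.
- move=> a b; apply: smooth_nearB; apply: smooth_nearZ => //; exact: smooth_near_cst.
- move=> a b e e0.
  have s1 b1 b2 : smooth_near (c y) (fun z => l (dGam D D' c z b1) *: (b2 : N)).
    by apply: smooth_nearZ => //; exact: smooth_near_cst.
  rewrite (deriveB (smooth_near_derivable (s1 _ _)) (smooth_near_derivable (s1 _ _))).
  have Z b1 b2 : 'D_e (fun z => l (dGam D D' c z b1) *: (b2 : N)) (c y) = 0.
    have db : differentiable (fun _ : E => b2) (c y) by exact: differentiable_cst.
    rewrite (derive_scale e (smooth_near_diff (sl b1)) db).
    by rewrite Fl// (derive_cst b2) scale0r scaler0 addr0.
  by rewrite !Z subrr.
- move=> a r u v; rewrite nE_linear lG ll.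
  move: (l _) (l _) (l _) => t1 t2 t3; rewrite /GRing.scale/=.
  by apply/matrixP => i j; rewrite !mxE; ring.
- by move=> a b; rewrite opprB.
- move=> v w; rewrite /pi_wedge !(diff_formE oU fD fD' _ h Uy cy) -!/(l _).
  rewrite !(dGam_pi oU fD fD' _ h Uy cy) -nfr_mul mulmxBr -!scalemxAr !nfr_mul.
  by rewrite !(pi_coord _ h cy).
Qed.

Section Fixed.
Variable D : connection_op M.
Hypothesis aD : adapted_connection setT D.
Hypothesis DF : forall c x a v K, fm_atlas c -> cdom c x -> pi_N a = 0 -> K *m K = - 1%:M ->
  'D_a (fun z => lbr (Gam D c z v) K) (c x) = 0.
Hypotheses (q : nat) (mE : m = (q + q)%N).

Let nf c (h : fm_atlas c) : foliated_connection (cdom c) (nabla D c).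
Proof. exact: (nabla_foliated aD DF mE m0). Qed.

(* Its coefficients in the chart c involve only the trace-free part of the
   connection matrix of D, which is why it is projectable. *)
Definition half_torsion c : two_form M := fun x v w =>
  - (2^-1 *: ((Gp D x v *m pi_N w - Gp D x (nE (pi_N w)) *m pi_N v)
              - (theta D c x v *: pi_N w - theta D c x w *: pi_N v))).

Lemma half_torsion_foliated c : fm_atlas c -> foliated_two_form (cdom c) (half_torsion c).
Proof.
move=> h; apply: two_formI; first exact: open_cdom.
move=> x cx; exists c, (fun z a b => - (2^-1 *: (TF D c z (nE a) *m b - TF D c z (nE b) *m a))).
split => // y _ cy.
have lT := TF_linear aD h cy.
have sT a := TF_smooth aD a h cy.
have FT a e (e0 : pi_N e = 0) := TF_F aD DF mE m0 a h cy e0.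
pose l (b : N) := - (2^-1 *: b).
have ll : linear l.
  by move=> r u v; rewrite /l scalerDr opprD -!scalerN scalerA mulrC -scalerA.
have sm a b : smooth_near (c y) (fun z => TF D c z (nE a) *m (b : N)).
  by apply: smooth_near_mulmx; [exact: sT|exact: smooth_near_cst].
have Fm a b e : pi_N e = 0 -> 'D_e (fun z => TF D c z (nE a) *m (b : N)) (c y) = 0.
  move=> e0; have db : differentiable (fun _ : E => b) (c y) by exact: differentiable_cst.
  by rewrite (derive_mulmx _ (smooth_near_diff (sT _)) db) FT// (derive_cst b) mul0mx mulmx0 addr0.
split.
- by move=> a b; apply: (smooth_near_linear _ ll); exact: smooth_nearB.
- move=> a b e e0.
  have dm : differentiable (fun z => TF D c z (nE a) *m b - TF D c z (nE b) *m a) (c y).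
    by apply: smooth_near_diff; exact: smooth_nearB.
  rewrite (derive_linear e _ ll dm).
  rewrite (deriveB (smooth_near_derivable (sm _ _)) (smooth_near_derivable (sm _ _))).
  by rewrite !Fm// subrr /l scaler0 oppr0.
- move=> a r u v; rewrite nE_linear lT.
  move: (TF D c (c y) (nE a)) (TF D c (c y) (nE u)) (TF D c (c y) (nE v)) => A1 A2 A3.
  rewrite mulmxDr mulmxDl -scalemxAr -scalemxAl.
  move: (_ *m u) (_ *m v) (A2 *m a) (A3 *m a) => b1 b2 b3 b4.
  by apply/matrixP => i j; rewrite !mxE; ring.
- by move=> a b; rewrite opprK -scalerN opprB.
- move=> v w; rewrite /half_torsion -nfr_mul mulmxN -scalemxAr mulmxBr.
  rewrite (torsion_chg aD v (pi_N w) h cy) mulmxBr -!scalemxAr !nfr_mul -!(pi_coord _ h cy).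
  rewrite !(TF_pi aD _ h cy).
  have lG : linear (christoffel D c y).
    by have [hD _] := aD; exact: (christoffel_linear openT hD h Logic.I cy).
  rewrite (linear_nE _ lG (fun b => christoffel_F openT aD h Logic.I cy)).
  rewrite /theta /TF /Gam (ga_can hX h cy) /trace_free !mulmxBl !mul_scalar_mx.
  move: (pi_N (coord c y v)) (pi_N (coord c y w)) => b3 b4.
  move: (coord c y v) (coord c y w) => a1 a2.
  move: (christoffel D c y a1) (christoffel D c y a2) => A1 A2.
  move: (A1 *m b4) (A2 *m b3) (\tr A1 / _) (\tr A2 / _) => b1 b2 t1 t2.
  by apply/matrixP => i j; rewrite !mxE; ring.
Qed.

(** All admissible connections related to every [nabla D c] are taken at once, so maximality is
    built in. The relation is pointwise; the forms of the changes are recovered from traces. *)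
Definition system : set (set M * connection_op M) := fun a =>
  [/\ adapted_neighborhood a.1, foliated_connection a.1 a.2, torsionless a.1 a.2 &
    forall c x, fm_atlas c -> cdom c x -> a.1 x -> proj_at (diffc a.2 (nabla D c) x)].

Lemma system_nabla c : fm_atlas c -> system (cdom c, nabla D c).
Proof.
move=> h; split => /=.
- exact: atlas_adapted.
- exact: nf.
- exact: (nabla_torsionless aD).
- by move=> c' x h' c'x cx; have [] := nabla_proj aD DF mE m0 h h' cx c'x.
Qed.

Lemma diffc_sub (D1 D2 D3 : connection_op M) x v :
  diffc D1 D2 x v = diffc D1 D3 x v - diffc D2 D3 x v.
Proof. by rewrite /diffc opprB [RHS]addrC addrA subrK. Qed.

Lemma system_pair a b x : system a -> system b -> a.1 x -> b.1 x -> proj_at (diffc a.2 b.2 x).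
Proof.
move=> [_ _ _ Ha] [_ _ _ Hb] ax bx; have [h cx] := ga_pchart hX x.
rewrite (_ : diffc a.2 b.2 x = fun v => diffc a.2 (nabla D (pchart (c := X) x)) x v -
    diffc b.2 (nabla D (pchart (c := X) x)) x v); last first.
  by apply: funext => v; exact: diffc_sub.
by apply: proj_at_sub; [exact: Ha|exact: Hb].
Qed.

Lemma system_inter a b : system a -> system b ->
  [/\ open (a.1 `&` b.1), foliated_connection (a.1 `&` b.1) a.2 &
      foliated_connection (a.1 `&` b.1) b.2].
Proof.
move=> [/adapted_open oa fa _ _] [/adapted_open ob fb _ _]; split; first exact: openI.
- by apply: foliated_connection_sub fa => y [].
- by apply: foliated_connection_sub fb => y [].
Qed.

Lemma system_change a b : system a -> system b ->
  foliated_one_form (a.1 `&` b.1) (diff_form a.2 b.2) /\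
  projective_change (a.1 `&` b.1) a.2 b.2 (diff_form a.2 b.2).
Proof.
move=> sa sb; have [oab fa fb] := system_inter sa sb; split.
  exact: diff_form_foliated.
apply/(projective_changeP oab (proj1 (proj1 fa)) (proj1 (proj1 fb))) => x v w [ax bx].
exact: (system_pair sa sb ax bx).
Qed.

(** For maximality: a larger system contains every [nabla D c], so its members are related to all of
    them and already belong to [system]. *)
Lemma system_structure : projective_structure system.
Proof.
split.
  split.
  - by move=> a [].
  - move=> x; have [h cx] := ga_pchart hX x.
    by exists (cdom (pchart (c := X) x), nabla D (pchart (c := X) x)) => //; exact: system_nabla.
  - by move=> a b sa sb; exists (diff_form a.2 b.2); have [] := system_change sa sb.
move=> P' [P1 P2 P3] sub; apply/seteqP; split => // a Pa.
have [na [fa ta]] := P1 _ Pa; split => // c x h cx ax.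
have [phi _ pc] := P3 _ _ Pa (sub _ (system_nabla h)).
have oI : open (a.1 `&` cdom c) by apply: openI; [exact: adapted_open|exact: open_cdom].
have [] := @change_form (a.1 `&` cdom c) a.2 (nabla D c) phi x oI _ _ pc (conj ax cx) => //.
- by apply: foliated_connection_sub fa => y [].
- by apply: foliated_connection_sub (nf h) => y [].
Qed.

Let has_foliated x : exists U0 D0, [/\ open U0, U0 x & foliated_connection (M := M) U0 D0].
Proof.
have [h cx] := ga_pchart hX x.
exists (cdom (pchart (c := X) x)), (nabla D (pchart (c := X) x)).
by split => //; [exact: open_cdom|exact: nf].
Qed.

Lemma two_formB U (t t' : two_form M) : open U -> foliated_two_form U t ->
  foliated_two_form U t' -> foliated_two_form U (fun x => t x - t' x).
Proof.
move=> oU /(foliated_basic oU has_foliated) bt /(foliated_basic oU has_foliated) bt'.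
exact: (basic_foliated oU (basic_formB bt bt')).
Qed.

Lemma two_formD U (t t' : two_form M) : open U -> foliated_two_form U t ->
  foliated_two_form U t' -> foliated_two_form U (fun x => t x + t' x).
Proof.
move=> oU Ft Ft'; have F0 := foliated_two_form_zero (M := M) oU.
have := two_formB oU Ft (two_formB oU F0 Ft').
by rewrite (_ : (fun x => _) = fun x => t x + t' x)//; apply: funext => x; rewrite sub0r opprK.
Qed.

(** The chart domains with their [nabla] refine the cover by all members. There [phi] is forced to
    be half the difference of the [theta], and the torsion parts of the two [half_torsion] forms
    cancel. *)
Lemma system_zero (phi : {a | system a} -> {a | system a} -> one_form M)
    (h : is_cocycle (@foliated_two_form R p m M) (fun a : {a | system a} => (sval a).1)
                 (fun a b => pi_wedge (phi a b))) :
  (forall a b, projective_change ((sval a).1 `&` (sval b).1) (sval a).2 (sval b).2 (phi a b)) ->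
  H1_zero (Cocycle h).
Proof.
move=> pc; pose K := {c | @fm_atlas R p m M c}.
exists K, (fun k => cdom (sval k)), (fun k => exist system _ (system_nabla (svalP k))),
  (fun k => half_torsion (sval k)); split.
- split=> [k|x]; first exact: (open_cdom (svalP k)).
  have [hc cx] := ga_pchart hX x; by exists (exist _ _ hc).
- by move=> k x.
- by move=> k; exact: (half_torsion_foliated (svalP k)).
- move=> k k' x; set c := sval k; set c' := sval k'; move=> cx c'x.
  have hc : fm_atlas c := svalP k; have hc' : fm_atlas c' := svalP k'.
  pose a : {a | system a} := exist _ _ (system_nabla (svalP k)).
  pose b : {a | system a} := exist _ _ (system_nabla (svalP k')).
  change (pi_wedge (phi a b) x = half_torsion c' x - half_torsion c x).
  have [oI fa fb] := system_inter (svalP a) (svalP b).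
  have [phiE _] := change_form oI fa fb (pc a b) (conj cx c'x).
  have [psiE _] := nabla_proj aD DF mE m0 hc hc' cx c'x.
  apply: funext => v; apply: funext => w; rewrite /pi_wedge phiE psiE.
  change (2^-1 * (theta D c x w - theta D c' x w) *: pi_N v -
    2^-1 * (theta D c x v - theta D c' x v) *: pi_N w =
    half_torsion c' x v w - half_torsion c x v w).
  rewrite /half_torsion; move: (Gp D x v *m pi_N w - _) => b1.
  move: (theta D c x v) (theta D c x w) (theta D c' x v) (theta D c' x w) => t1 t2 t3 t4.
  move: (pi_N v) (pi_N w) => b2 b3.
  by apply/matrixP => i j; rewrite !mxE; ring.
Qed.

Lemma system_cocycle : is_cocycle (@foliated_two_form R p m M)
  (fun a : {a | system a} => (sval a).1)
  (fun a b => pi_wedge (diff_form (sval a).2 (sval b).2)).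
Proof.
split.
- split=> [a|x]; first by have [/adapted_open] := svalP a.
  have [h cx] := ga_pchart hX x.
  by exists (exist _ _ (system_nabla h)).
- move=> a b; have [oI fa fb] := system_inter (svalP a) (svalP b).
  exact: pi_wedge_foliated.
- move=> a b c x _ _ _; apply: funext => v; apply: funext => w.
  have E1 u : diff_form (sval a).2 (sval c).2 x u =
      diff_form (sval a).2 (sval b).2 x u + diff_form (sval b).2 (sval c).2 x u.
    rewrite /diff_form /proj_form (diffc_sub (sval a).2 (sval b).2 (sval c).2).
    move: (diffc (sval a).2 (sval c).2 x u) (diffc (sval b).2 (sval c).2 x u) => A B.
    by rewrite raddfB/= -mulrDl subrK.
  change (pi_wedge (diff_form (sval a).2 (sval b).2) x v w +
    pi_wedge (diff_form (sval b).2 (sval c).2) x v w =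
    pi_wedge (diff_form (sval a).2 (sval c).2) x v w).
  by rewrite /pi_wedge !E1 !scalerDl opprD addrACA.
Qed.

(** Whatever forms [phi] represent the class, [system_zero] trivializes their cocycle; the two
    inclusions are then formal. *)
Lemma system_vanishes : normal_class_vanishes system.
Proof.
have shS U U' (t : two_form M) : open U' -> U' `<=` U -> foliated_two_form U t ->
  foliated_two_form U' t := @foliated_two_form_sub R p m M U U' t.
move=> z; split=> [[phi [pc [h hz]]]|z0].
  apply: (cohomologous_H1_zero shS two_formD) hz.
  by apply: system_zero => a b; have [] := pc a b.
exists (fun a b => diff_form (sval a).2 (sval b).2); split.
  by move=> a b /=; exact: (system_change (svalP a) (svalP b)).
exists system_cocycle; apply: (H1_zero_cohomologous shS two_formB) => //.
by apply: system_zero => a b; have [] := system_change (svalP a) (svalP b).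
Qed.

End Fixed.

End Structure.

Theorem theorem4p2 (R : realType) (p q : nat) (M : foliated_manifold R p (2 * q))
    (hq : (1 <= q)%N) :
  (exists D : connection_op M,
     adapted_connection [set: M]%classic D /\
     projectable D (@I1 R p (2 * q) M) /\
     projectable D (@I2 R p (2 * q) M))
  <->
  (exists P : set (set M * connection_op M),
     projective_structure P /\ normal_class_vanishes P).
Proof.
split=> [[D [aD [pI1 pI2]]]|[P [[sP _] vP]]]; last exact: backward sP vP.
have m0 : (0 < 2 * q)%N by rewrite muln_gt0.
have mE : (2 * q = q + q)%N by rewrite mul2n addnn.
have DF := projectable_commutator aD pI1 pI2.
exists (system D); split.
- exact: (system_structure m0 aD DF mE).
- exact: (system_vanishes m0 aD DF mE).
Qed.
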